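(* Let $\boldsymbol{X}=(X_i)_{i\in\mathbb{Z}}$ be a stationary real-valued time series with tail process $\boldsymbol{Y}=(Y_i)_{i\in\mathbb{Z}}$. Let $(c_n)_{n\in\mathbb{N}}\subseteq(0,\infty)$ and $(r_n)_{n\in\mathbb{N}}\subseteq\mathbb{N}$ satisfy, as $n\to\infty$, $c_n\to\infty$, $r_n\to\infty$, $n\mathbb{P}(|X_0|>c_n)\to\infty$ and $r_n\mathbb{P}(|X_0|>c_n)\to0$. Let $k_n=\lfloor n/r_n\rfloor$ and $\boldsymbol{X}_{n,j}=(X_{(j-1)r_n+1},\dots,X_{jr_n})$, $j=1,\dots,k_n$. Assume that for all $x,y>0$ $$\lim_{m\to\infty}\limsup_{n\to\infty}\mathbb{P}\left(\max_{m\le|i|\le r_n}|X_i|>c_nx\,\Big|\,|X_0|>c_ny\right)=0,$$ and that $$\mathbb{E}\left[e^{-\frac{1}{n\mathbb{P}(|X_0|>c_n)}\sum_{j=1}^{k_n}h(c_n^{-1}\boldsymbol{X}_{n,j})}\right]-\left(\mathbb{E}\left[e^{-\frac{1}{n\mathbb{P}(|X_0|>c_n)}h(c_n^{-1}\boldsymbol{X}_{n,1})}\right]\right)^{k_n}\to0\quad(n\to\infty)$$ for every $h:l_0\to[0,\infty)$ which is bounded, shift-invariant and Lipschitz continuous, and whose support is a subset of $\{\boldsymbol{x}\in l_0:\|\boldsymbol{x}\|>\epsilon\}$ for some $\epsilon>0$. Let $N_n^c=\{j\in\{1,\dots,k_n\}:\|\boldsymbol{X}_{n,j}\|>c_n\}$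 and $N_n^e=\{i\in\{1,\dots,n\}:|X_i|>c_n\}$. Conditionally on $X_1,\dots,X_n$, let $K_n$ be uniform on $N_n^c$ and let $T_n$ be uniform on $N_n^e$, and let $\boldsymbol{X}_n^{T_n}:=\boldsymbol{X}_{n,j}$, where $\boldsymbol{X}_{n,j}$ is the block which contains $X_{T_n}$. Let $\vartheta=\mathbb{E}[|\mathrm{e}(\boldsymbol{Y})|^{-1}]$. Then, as $n\to\infty$, $$\frac{|N_n^c|}{\vartheta n\mathbb{P}(|X_0|>c_n)}\to1\quad\text{and}\quad\frac{|N_n^e|}{n\mathbb{P}(|X_0|>c_n)}\to1$$ in probability, so in particular $|N_n^c|\to+\infty$ and $|N_n^e|\to+\infty$ in probability. Moreover, for every anchoring function $A$ such that $\mathbb{P}(\boldsymbol{Y}\in\mathrm{disc}\,A)=0$, $$\mathbb{P}\left(\varphi_A(c_n^{-1}\boldsymbol{X}_{n,K_n})\in\cdot\right)\to\mathbb{P}(\boldsymbol{Z}^A\in\cdot)\quad\text{and}\quad\mathbb{P}\left(c_n^{-1}\varphi_{T_n}\boldsymbol{X}_n^{T_n}\in\cdot\right)\to\mathbb{P}(\boldsymbol{Y}\in\cdot)$$ weakly in $l_0$ with respect to the uniform norm $\|\cdot\|$.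
   Context: $l_0=\{\boldsymbol{x}\in\mathbb{R}^{\mathbb{Z}}:\lim_{|i|\to\infty}|x_i|=0\}$ with the uniform norm $\|\boldsymbol{x}\|=\sup_i|x_i|$. Finite blocks of $\boldsymbol{X}$ are regarded as elements of $l_0$ by keeping the observations at their time indices and adding zeros at all other positions. The shift is $\varphi_k\boldsymbol{x}=(x_{i+k})_{i\in\mathbb{Z}}$ (so $\varphi_{T_n}\boldsymbol{X}_n^{T_n}$ has $X_{T_n}$ at position $0$). A function $h$ on $l_0$ is shift-invariant if $h(\varphi_k\boldsymbol{x})=h(\boldsymbol{x})$ for all $\boldsymbol{x}\in l_0$, $k\in\mathbb{Z}$. $|N|$ denotes the cardinality of a set $N$. The block $\boldsymbol{X}_n^{T_n}$ is not defined if $T_n\in\{k_nr_n+1,\dots,n\}$; this event has probability at most $r_n\mathbb{P}(|X_0|>c_n)\to0$ and is neglected (define the block arbitrarily there, and likewise define $K_n,T_n$ arbitrarily when $N_n^c$, respectively $N_n^e$, is empty). Tail process: $\boldsymbol{Y}$ is the tail process of a (strictly) stationary $\boldsymbol{X}$ if $\mathbb{P}(|Y_0|>1)=1$ and, for every $m\in\mathbb{N}$, the conditional distribution of $(u^{-1}X_i)_{-m\le i\le m}$ given $|X_0|>u$ converges weakly, as $u\to\infty$, to the distribution of $(Y_i)_{-m\le i\le m}$. Under the first displayed assumption $\mathbb{P}(\boldsymbol{Y}\in l_0)=1$. $\mathrm{e}(\boldsymbol{x})=\{k\in\mathbb{Z}:|x_k|>1\}$, $\mathcal{E}=\{\boldsymbol{x}\in\mathbb{R}^{\mathbb{Z}}:1\le|\mathrm{e}(\boldsymbol{x})|<\infty\}$,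 $\mathcal{E}_0=\{\boldsymbol{x}\in\mathcal{E}:|x_0|>1\}$. An anchoring function is a measurable map $A:\mathcal{E}_0\to\mathbb{Z}$ such that for all $\boldsymbol{x}\in\mathcal{E}_0$, $A(\boldsymbol{x})\in\mathrm{e}(\boldsymbol{x})$ and $A(\varphi_k\boldsymbol{x})+k=A(\boldsymbol{x})$ for all $k\in\mathrm{e}(\boldsymbol{x})$; it is extended to $\mathcal{E}$ by $A(\boldsymbol{x}):=A(\varphi_k\boldsymbol{x})+k$ for any $k\in\mathrm{e}(\boldsymbol{x})$ (independent of the choice of $k$). $\varphi_A\boldsymbol{x}:=\varphi_{A(\boldsymbol{x})}\boldsymbol{x}$. $\mathrm{disc}\,A$ is the set of discontinuity points, with respect to $\|\cdot\|$, of $A$ restricted to $\mathcal{E}\cap l_0=\{\boldsymbol{x}\in l_0:\|\boldsymbol{x}\|>1\}$. $\boldsymbol{Z}^A$ is a random element with distribution $\mathbb{P}(\boldsymbol{Y}\in\cdot\mid A(\boldsymbol{Y})=0)$ (the conditioning event is known to have positive probability, equal to $\vartheta$). *)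

(* Defs.v *)
From HB Require Import structures.
From mathcomp Require Import all_boot all_order all_algebra.
From mathcomp Require Import finmap zify.
From mathcomp Require Import all_classical all_reals all_analysis.

Set Implicit Arguments.
Unset Strict Implicit.
Unset Printing Implicit Defensive.

Import Order.TTheory GRing.Theory Num.Theory.
Import numFieldNormedType.Exports.

Local Open Scope classical_set_scope.
Local Open Scope ring_scope.

Section l0_space.
Variable R : realType.
Implicit Types (x y : int -> R).

Definition vanishes x : Prop :=
  forall e : R, 0 < e ->
    exists N : nat, forall i : int, (N <= `|i|)%N -> `|x i| < e.

Definition vanishing : {pred (int -> R)} := fun x => `[< vanishes x >].

Lemma vanishingP x : reflect (vanishes x) (x \in vanishing).
Proof. exact: asboolP. Qed.

Lemma vanishing_submod : GRing.submod_closed vanishing.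
Proof.
split.
  by apply/vanishingP => e e0; exists 0%N => i _; rewrite normr0.
move=> a x y /vanishingP vx /vanishingP vy; apply/vanishingP => e e0.
have d0 : 0 < e / 2 / (`|a| + 1).
  by rewrite !divr_gt0// ltr_wpDl.
have [N1 xN] := vx _ d0.
have [N2 yN] := vy _ (divr_gt0 e0 (ltr0n _ 2)).
exists (maxn N1 N2) => i; rewrite geq_max => /andP[/xN xi /yN yi].
rewrite [e]splitr; apply: (le_lt_trans (ler_normD _ _)).
apply: ler_ltD => //; rewrite normrM.
apply: (@le_trans _ _ ((`|a| + 1) * `|x i|)).
  by rewrite ler_wpM2r// lerDl.
by rewrite mulrC -ler_pdivlMr ?ltr_wpDl// ltW.
Qed.

HB.instance Definition _ :=
  GRing.isSubmodClosed.Build R (int -> R) vanishing vanishing_submod.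

Record l0 : Type := L0 { l0_fun :> int -> R; l0_in : l0_fun \in vanishing }.

HB.instance Definition _ := [isSub for l0_fun].
HB.instance Definition _ := [Choice of l0 by <:].
HB.instance Definition _ := [SubChoice_isSubLmodule of l0 by <:].

Definition l0_norm (x : l0) : R := sup [set `|x i| | i in [set: int]].

Lemma l0_has_sup (x : l0) : has_sup [set `|x i| | i in [set: int]].
Proof.
split; first by exists `|x 0|, 0.
have /vanishingP/(_ 1 ltr01)[N xN] := l0_in x.
exists (1 + \sum_(i < N) (`|x i%:Z| + `|x (- i%:Z)|)) => _ [i _ <-].
have S0 (P : pred 'I_N) : 0 <= \sum_(i < N | P i) (`|x i%:Z| + `|x (- i%:Z)|).
  by apply: sumr_ge0 => j _; rewrite addr_ge0.
case: (leqP N `|i|) => [/xN/ltW xi|iN].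
  by rewrite (le_trans xi)// lerDl.
rewrite (bigD1 (Ordinal iN))//= -[leLHS]add0r lerD//.
rewrite -[leLHS]addr0; apply: lerD => //.
case: (intP i) => [|n|n]; rewrite ?abszN ?absz_nat.
- by rewrite lerDl.
- by rewrite lerDl.
- by rewrite lerDr.
Qed.

Lemma l0_norm_ub (x : l0) i : `|x i| <= l0_norm x.
Proof. by apply: sup_upper_bound; [exact: l0_has_sup|exists i]. Qed.

Lemma l0_norm_le (x : l0) M : (forall i, `|x i| <= M) -> l0_norm x <= M.
Proof.
by move=> xM; apply: ge_sup; [exists `|x 0|, 0|move=> _ [i _ <-]].
Qed.

Lemma l0_norm_ge0 (x : l0) : 0 <= l0_norm x.
Proof. exact: le_trans (normr_ge0 _) (l0_norm_ub x 0). Qed.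

Lemma l0_normD (x y : l0) : l0_norm (x + y) <= l0_norm x + l0_norm y.
Proof.
apply: l0_norm_le => i; apply: (le_trans (ler_normD _ _)).
by apply: lerD; exact: l0_norm_ub.
Qed.

Lemma l0_normZ (a : R) (x : l0) : l0_norm (a *: x) = `|a| * l0_norm x.
Proof.
have leZ (b : R) (y : l0) : l0_norm (b *: y) <= `|b| * l0_norm y.
  by apply: l0_norm_le => i; rewrite normrM ler_wpM2l// l0_norm_ub.
apply/eqP; rewrite eq_le leZ/=.
have [->|a0] := eqVneq a 0; first by rewrite normr0 mul0r l0_norm_ge0.
rewrite -ler_pdivlMl ?normr_gt0// -normfV.
by rewrite -{1}[x]scale1r -(mulVf a0) -scalerA leZ.
Qed.

Lemma l0_norm0_eq0 (x : l0) : l0_norm x = 0 -> x = 0.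
Proof.
move=> x0; apply/val_inj/funext => i /=; apply/eqP.
by rewrite -normr_le0 -x0 l0_norm_ub.
Qed.

HB.instance Definition _ :=
  Lmodule_isNormed.Build R l0 l0_normD l0_normZ l0_norm0_eq0.

Lemma l0_normE (x : l0) : `|x| = sup [set `|x i| | i in [set: int]].
Proof. by []. Qed.

(* The tail process lies in [l0] only almost surely; paths outside [l0] are
   sent to 0. *)
Definition to_l0 (x : int -> R) : l0 := insubd (0 : l0) x.

Definition shift (k : int) (x : int -> R) : int -> R := fun i => x (i + k).

Lemma shift_vanishing k (x : l0) : shift k x \in vanishing.
Proof.
have /vanishingP vx := l0_in x; apply/vanishingP => e /vx[N xN].
exists (N + `|k|)%N => i Ni; apply: xN.
rewrite -(leq_add2r `|k|) (leq_trans Ni)//.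
by rewrite -[X in (`|X| <= _)%N](addrK k) (leq_trans (leqD_dist _ 0 _))//
  subr0 sub0r abszN.
Qed.

Definition shift_l0 (k : int) (x : l0) : l0 := L0 (shift_vanishing k x).

Lemma window_vanishing (a b : int) x :
  (fun i => if a < i <= b then x i else 0) \in vanishing.
Proof.
apply/vanishingP => e e0; exists (`|a| + `|b|).+1 => i Ni.
by case: ifPn => [/andP[ai ib]|_]; [exfalso; lia|rewrite normr0].
Qed.

(* The [j]-th block (x_((j-1)r+1), ..., x_(jr)), for [1 <= j]. *)
Definition block (r j : nat) x : l0 :=
  L0 (window_vanishing (j.-1 * r)%N%:Z (j * r)%N%:Z x).

(* For [0 < i] and [0 < r]: the [j] with [(j-1)r+1 <= i <= jr]. An index left
   over after the last of the [n %/ r] blocks gets [n %/ r + 1]. *)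
Definition block_index (r i : nat) : nat := (i.-1 %/ r).+1.

Definition path_sigma : set (set (int -> R)) :=
  <<s \bigcup_(i in [set: int])
        preimage_set_system setT (fun x : int -> R => x i) measurable >>.

Definition borel_l0 : set (set l0) := <<s @open l0 >>.

Definition exceed x : set int := [set k | 1 < `|x k|].

Definition excE : set (int -> R) :=
  [set x | exceed x !=set0 /\ finite_set (exceed x)].

Definition excE0 : set (int -> R) := [set x | excE x /\ 1 < `|x 0|].

(* Only the values of [A] on [excE0] matter. *)
Definition anchoring (A : (int -> R) -> int) : Prop :=
  (forall B : set int, path_sigma (excE0 `&` A @^-1` B)) /\
  (forall x, excE0 x ->
     exceed x (A x) /\ forall k, exceed x k -> A (shift k x) + k = A x).

(* Extension of an anchoring function to [excE]; it does not depend on which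
   [k] is picked, and it is set to 0 outside [excE]. *)
Definition anchor_ext (A : (int -> R) -> int) x : int :=
  if `[< excE x >] then let k := xget 0 (exceed x) in A (shift k x) + k else 0.

Definition anchor_shift (A : (int -> R) -> int) (x : l0) : l0 :=
  shift_l0 (anchor_ext A x) x.

Definition anchor_disc (A : (int -> R) -> int) : set l0 :=
  let D : set l0 := [set x | excE x] in
  [set x | D x /\
    ~ ((anchor_ext A z : discrete_topology int) @[z --> within D (nbhs x)]
         --> (anchor_ext A x : discrete_topology int))].

Definition shift_invariant (h : l0 -> R) : Prop :=
  forall (x : l0) (k : int), h (shift_l0 k x) = h x.

End l0_space.

Section probability.
Context {R : realType}.

Definition prob d (T : measurableType d) (P : probability T R) (B : set T) : R :=
  fine (P B).

Definition mean d (T : measurableType d) (P : probability T R) (f : T -> R) :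
  R := fine ('E_P[f])%E.

Definition cprob d (T : measurableType d) (P : probability T R) (B C : set T) :
  R := prob P (B `&` C) / prob P C.

Definition cvg_in_prob d (T : measurableType d) (P : probability T R)
    (V : nat -> T -> R) (l : R) : Prop :=
  forall e : R, 0 < e -> prob P [set w | e < `|V n w - l|] @[n --> \oo] --> (0 : R).

Definition cvg_in_prob_pinfty d (T : measurableType d) (P : probability T R)
    (V : nat -> T -> R) : Prop :=
  forall M : R, prob P [set w | M < V n w] @[n --> \oo] --> (1 : R).

Definition weak_cvg (E : topologicalType)
    d (T : measurableType d) (P : probability T R) (V : nat -> T -> E)
    d' (T' : measurableType d') (Q : probability T' R) (W : T' -> E) : Prop :=
  forall f : E -> R, continuous f -> (exists M : R, forall x, `|f x| <= M) ->
    ('E_P[f \o V n] @[n --> \oo] --> 'E_Q[f \o W])%E.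

(* Conditionally on the sigma-algebra [F], [K] is uniform on the (random,
   duplicate-free) list [N], where [N] is nonempty. *)
Definition cond_uniform d (T : measurableType d) (P : probability T R)
    (F : set (set T)) (N : T -> seq nat) (K : T -> nat) : Prop :=
  forall (G : set T) (j : nat), F G ->
    P [set w | [/\ G w, N w != [::] & K w = j]] =
    (\int[P]_(w in G) (((j \in N w)%:R / (size (N w))%:R : R)%:E))%E.

Section time_series.
Context d (T : measurableType d) (P : probability T R).
Variable X : int -> {RV P >-> R}.

Definition path_of (w : T) : int -> R := fun i => X i w.

Definition stationary : Prop :=
  forall (k : int) (B : set (int -> R)), path_sigma B ->
    P [set w | B (shift k (path_of w))] = P [set w | B (path_of w)].

(* sigma(X_1, ..., X_n) *)
Definition sigma_upto (n : nat) : set (set T) :=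
  <<s \bigcup_(i in [set i : int | 1 <= i <= n%:Z])
        preimage_set_system setT (X i) measurable >>.

Definition Nc (c : nat -> R) (r : nat -> nat) (n : nat) (w : T) : seq nat :=
  [seq j <- index_iota 1 (n %/ r n).+1 |
    c n < `|block (r n) j (path_of w)|].

Definition Ne (c : nat -> R) (n : nat) (w : T) : seq nat :=
  [seq i <- index_iota 1 n.+1 | c n < `|X i%:Z w|].

(* |e|^{-1}: [fset_set] of an infinite set is empty and [0^-1 = 0], so this is
   0 when [exceed] is infinite. *)
Definition theta : R :=
  mean P (fun w => (#|` fset_set (exceed (path_of w))|)%:R^-1).

End time_series.

Definition tail_process d (T : measurableType d) (P : probability T R)
    (X : int -> {RV P >-> R})
    d' (T' : measurableType d') (Q : probability T' R)
    (Y : int -> {RV Q >-> R}) : Prop :=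
  Q [set w | 1 < `|Y 0 w|] = 1%E /\
  forall (m : nat) (f : 'rV[R]_(m.*2.+1) -> R),
    continuous f -> (exists M : R, forall x, `|f x| <= M) ->
    (\int[P]_(w in [set w | u < `|X 0 w|])
        f (\row_i (u^-1 * X (i%:Z - m%:Z) w)) / prob P [set w | u < `|X 0 w|])
      @[u --> +oo]
    --> mean Q (fun w => f (\row_i Y (i%:Z - m%:Z) w)).

(* [Z] has the law of [Y] given [A(Y) = 0], on the Borel sets of [l0]. *)
Definition is_ZA d (T : measurableType d) (Q : probability T R)
    (Y : int -> {RV Q >-> R}) (A : (int -> R) -> int)
    d' (T' : measurableType d') (Q' : probability T' R) (Z : T' -> l0 R) : Prop :=
  forall B : set (l0 R), borel_l0 B ->
    measurable (Z @^-1` B) /\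
    prob Q' (Z @^-1` B) =
      cprob Q [set w | B (to_l0 (path_of Y w))]
              [set w | excE (path_of Y w) /\ anchor_ext A (path_of Y w) = 0].

End probability.

(* Main.v *)
Require Import Defs.
From HB Require Import structures.
From mathcomp Require Import all_boot all_order all_algebra finmap.
From mathcomp Require Import ring lra zify.
From mathcomp Require Import all_classical all_reals all_analysis measurable_realfun.

(** Write p_n for the probability that |X_0| > c_n, B_j for the j-th block divided
    by c_n, and S_n(G) for the sum of G(B_j) over the k_n blocks divided by
    n p_n. Each claim is a law of large numbers S_n(G) -> nu(G) for a suitable
    function G of a cluster.

    All functions of interest are cluster sums [csum g]: G(x) is the sum over the
    exceedances i of x (the i with |x_i| > 1) of g(x seen from i). The number of
    exceedances is [csum] of the indicator of |x_0| > 1; the indicator that there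
    is an exceedance is [csum] of one over their number, and also, since exactly
    one exceedance is the anchor, [csum] of the indicator of A(x) = 0; and f of
    the cluster seen from its anchor is [csum] of f times that indicator.

    Means ([mean_clsum_csum]). By stationarity the mean of G(B_1) is p_n times the
    sum over i <= r_n of the conditional mean, given |X_0| > c_n, of g at the
    window ]-i, r_n - i] of X / c_n. For most i this window is close to the whole
    path by anticlustering, and the path converges to the tail process Y. Hence
    the mean of S_n(G) converges to the mean of g(Y): first for Lipschitz g
    ([mu_cvg_lip]), then for g continuous at almost every path of Y ([mu_cvg]).
    For this one needs that Y vanishes at infinity ([Y_vanishing]) and that |Y_i|
    is never 1 ([Y_no_unit]), so that the exceedances of nearby paths agree.

    Concentration ([test_L1_cvg]). For a bounded Lipschitz shift-invariant h, the
    mixing condition and the convergence of means give the limit exp(-nu(h)) of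
    the Laplace transform of S_n(h) at 1, and exp(-2 nu(h)) at 2. So the variance
    of exp(-S_n(h)) vanishes. Together with the convergence of the means this is
    convergence in mean: S_n(h) -> nu(h) in L1.

    Law of large numbers ([clsum_L1_cvg]). A general G lies above its Lipschitz
    envelopes [env k G], to which the previous step applies, and the L1 distance
    to them is a difference of means, whose limit tends to 0 as k grows.

    Selection ([select_cvg]). A mean at a uniformly chosen cluster or exceedance is
    the mean of a quotient, the sum over all of them divided by their number; both
    are of the form S_n(G) and converge to constants. For clusters the limit is
    the mean of f(Y) on A(Y) = 0 divided by [theta Y], and [theta Y] is the
    probability of A(Y) = 0 because both are the limit of the normalised number
    of clusters; so the limit is the mean of f(Z). For exceedances it is the mean
    of f(Y). *)

Set Implicit Arguments.
Unset Strict Implicit.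
Unset Printing Implicit Defensive.

Import Order.TTheory GRing.Theory Num.Theory.
Import numFieldNormedType.Exports.

Local Open Scope classical_set_scope.
Local Open Scope ring_scope.

(** * Means of bounded measurable functions *)

Section bounded_measurable.
Context {R : realType} d (T : measurableType d).
Implicit Types f g : T -> R.

(** All functions whose mean is taken below are bounded; this class is closed
    under everything that is done to them. *)
Definition bmeas f : Prop :=
  measurable_fun setT f /\ exists M : R, forall w, `|f w| <= M.

Lemma bmeas_cst a : bmeas (fun=> a).
Proof. by split; [exact: measurable_cst|exists `|a|]. Qed.

Lemma bmeasD f g : bmeas f -> bmeas g -> bmeas (fun w => f w + g w).
Proof.
move=> [mf [M fM]] [mg [N gN]]; split; first exact: measurable_funD.
by exists (M + N) => w; rewrite (le_trans (ler_normD _ _))// lerD.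
Qed.

Lemma bmeasN f : bmeas f -> bmeas (fun w => - f w).
Proof.
move=> [mf [M fM]]; split; first exact: measurableT_comp.
by exists M => w; rewrite normrN.
Qed.

Lemma bmeasB f g : bmeas f -> bmeas g -> bmeas (fun w => f w - g w).
Proof. by move=> bf bg; apply: bmeasD => //; exact: bmeasN. Qed.

Lemma bmeasM f g : bmeas f -> bmeas g -> bmeas (fun w => f w * g w).
Proof.
move=> [mf [M fM]] [mg [N gN]]; split; first exact: measurable_funM.
by exists (M * N) => w; rewrite normrM ler_pM.
Qed.

Lemma bmeasZ a f : bmeas f -> bmeas (fun w => a * f w).
Proof. by move=> bf; apply: bmeasM => //; exact: bmeas_cst. Qed.

Lemma bmeas_norm f : bmeas f -> bmeas (fun w => `|f w|).
Proof.
move=> [mf [M fM]]; split; first exact: measurableT_comp.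
by exists M => w; rewrite normr_id.
Qed.

Lemma bmeas_indic (A : set T) : measurable A -> bmeas (\1_A : T -> R).
Proof.
move=> mA; split; first exact: measurable_indic.
by exists 1 => w; rewrite indicE; case: (_ \in _); rewrite ?normr1 ?normr0.
Qed.

Lemma bmeas_sum I (s : seq I) (F : I -> T -> R) :
  (forall i, bmeas (F i)) -> bmeas (fun w => \sum_(i <- s) F i w).
Proof.
move=> bF; elim: s => [|i s IH].
  by under eq_fun do rewrite big_nil; exact: bmeas_cst.
by under eq_fun do rewrite big_cons; exact: bmeasD.
Qed.

Lemma bmeas_itv f (a b : R) :
  measurable_fun setT f -> (forall w, a <= f w <= b) -> bmeas f.
Proof.
move=> mf fab; split => //; exists (`|a| + `|b|) => w.
have /andP[af fb] := fab w.
rewrite ler_norml; apply/andP; split.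
  by rewrite (le_trans _ af)// opprD lerBlDr ler_wpDr// lerNl ler_normr lexx orbT.
by rewrite (le_trans fb)// ler_wpDl// ler_norm.
Qed.

Lemma measurable_fun_expR f :
  measurable_fun setT f -> measurable_fun setT (fun w => expR (f w)).
Proof. by move=> mf; apply: measurableT_comp. Qed.

End bounded_measurable.

Section mean_theory.
Context {R : realType} d (T : measurableType d) (P : probability T R).
Implicit Types f g : T -> R.

Lemma bmeas_integrable f : bmeas f -> P.-integrable setT (EFin \o f).
Proof.
move=> [mf [M fM]]; apply: measurable_bounded_integrable => //.
  by rewrite (le_lt_trans (probability_le1 P measurableT))// ltry.
exists M; split; first exact: num_real.
by move=> x Mx w _ /=; rewrite (le_trans (fM w))// ltW.
Qed.

Lemma meanE f : mean P f = \int[P]_w f w.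
Proof. by rewrite /mean unlock. Qed.

Lemma expectation_mean f : bmeas f -> ('E_P[f])%E = (mean P f)%:E.
Proof.
move=> bf; rewrite /mean unlock fineK//.
exact: (integrable_fin_num measurableT (bmeas_integrable bf)).
Qed.

Lemma mean_cst a : mean P (fun=> a) = a.
Proof.
rewrite meanE Rintegral_cst//.
by rewrite (_ : fine _ = 1) ?mulr1//; exact: (congr1 fine (probability_setT P)).
Qed.

Lemma meanD f g : bmeas f -> bmeas g ->
  mean P (fun w => f w + g w) = mean P f + mean P g.
Proof.
by move=> bf bg; rewrite !meanE RintegralD//; exact: bmeas_integrable.
Qed.

Lemma meanB f g : bmeas f -> bmeas g ->
  mean P (fun w => f w - g w) = mean P f - mean P g.
Proof.
by move=> bf bg; rewrite !meanE RintegralB//; exact: bmeas_integrable.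
Qed.

Lemma meanZ a f : bmeas f -> mean P (fun w => a * f w) = a * mean P f.
Proof. by move=> bf; rewrite !meanE RintegralZl//; exact: bmeas_integrable. Qed.

Lemma mean_sum I (s : seq I) (F : I -> T -> R) : (forall i, bmeas (F i)) ->
  mean P (fun w => \sum_(i <- s) F i w) = \sum_(i <- s) mean P (F i).
Proof.
move=> bF; elim: s => [|i s IH].
  rewrite big_nil (_ : (fun _ => _) = fun=> 0) ?mean_cst//.
  by apply/funext => w; rewrite big_nil.
rewrite big_cons -IH -meanD//; last exact: bmeas_sum.
by congr (mean P _); apply/funext => w; rewrite big_cons.
Qed.

Lemma mean_le f g : bmeas f -> bmeas g -> (forall w, f w <= g w) ->
  mean P f <= mean P g.
Proof.
by move=> bf bg fg; rewrite !meanE; apply: le_Rintegral => //;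
  exact: bmeas_integrable.
Qed.

Lemma mean_ge0 f : (forall w, 0 <= f w) -> 0 <= mean P f.
Proof. by move=> f0; rewrite meanE; exact: Rintegral_ge0. Qed.

Lemma mean_norm f : bmeas f -> `|mean P f| <= mean P (fun w => `|f w|).
Proof.
by move=> bf; rewrite !meanE le_normr_Rintegral//; exact: bmeas_integrable.
Qed.

Lemma probK (A : set T) : measurable A -> (prob P A)%:E = P A.
Proof. by move=> mA; rewrite /prob fineK// fin_num_measure. Qed.

Lemma prob_ge0 (A : set T) : 0 <= prob P A.
Proof. by rewrite /prob fine_ge0. Qed.

Lemma prob_le1 (A : set T) : measurable A -> prob P A <= 1.
Proof. by move=> mA; rewrite -lee_fin probK// probability_le1. Qed.

Lemma le_prob (A B : set T) : measurable A -> measurable B -> A `<=` B ->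
  prob P A <= prob P B.
Proof.
by move=> mA mB AB; rewrite -lee_fin !probK// le_measure// inE.
Qed.

Lemma mean_indic (A : set T) : measurable A -> mean P (\1_A : T -> R) = prob P A.
Proof. by move=> mA; rewrite /mean expectation_indic. Qed.

Lemma mean_ae_eq f g : bmeas f -> bmeas g -> {ae P, forall w, f w = g w} ->
  mean P f = mean P g.
Proof.
move=> [mf _] [mg _] fg; rewrite !meanE /Rintegral; congr fine.
apply: ae_eq_integral => //; [exact/measurable_EFinP|exact/measurable_EFinP|].
by move: fg; apply: filterS => w /= -> _.
Qed.

Lemma mean_dct (fn : nat -> T -> R) f (M : R) :
  (forall n, measurable_fun setT (fn n)) -> measurable_fun setT f ->
  (forall n w, `|fn n w| <= M) ->
  {ae P, forall w, fn n w @[n --> \oo] --> f w} ->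
  mean P (fn n) @[n --> \oo] --> mean P f.
Proof.
move=> mfn mf fnM fnf.
have := @dominated_convergence _ _ _ P setT measurableT
  (fun n w => (fn n w)%:E) (fun w => (f w)%:E) (cst M%:E).
case.
- by move=> n; exact/measurable_EFinP.
- exact/measurable_EFinP.
- by move: fnf; apply: filterS => w fnf _; apply: cvg_EFin; [exact: nearW|exact: fnf].
- by apply: finite_measure_integrable_cst.
- by apply: aeW => w n _ /=; rewrite lee_fin.
move=> fi _ H; rewrite meanE.
under eq_fun do rewrite meanE.
rewrite /Rintegral; apply: fine_cvg.
by rewrite fineK//; exact: (integrable_fin_num measurableT fi).
Qed.

Lemma markov_mean f (A : set T) (a : R) : bmeas f -> measurable A ->
  0 < a -> (forall w, 0 <= f w) -> (forall w, A w -> a <= f w) ->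
  prob P A <= mean P f / a.
Proof.
move=> bf mA a0 f0 Af; rewrite ler_pdivlMr// mulrC -(mean_indic mA) -meanZ;
  last exact: bmeas_indic.
apply: mean_le => //; first by apply: bmeasZ; exact: bmeas_indic.
move=> w; rewrite indicE; case: (boolP (w \in A)) => [|_]; last by rewrite mulr0.
by rewrite mulr1 inE => /Af.
Qed.

End mean_theory.

(** * Measurability and layer sets *)

Lemma indic_boolE {R : pzRingType} (T : Type) (b : T -> bool) w :
  \1_[set w | b w] w = (b w)%:R :> R.
Proof. by rewrite indicE; congr (nat_of_bool _)%:R; apply/idP/idP; rewrite inE. Qed.

Section measurable_layers.
Context {R : realType} d (T : measurableType d).
Implicit Types f : T -> R.

Lemma measurable_ge_set f (t : R) :
  measurable_fun setT f -> measurable [set w | t <= f w].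
Proof.
move=> mf; rewrite (_ : [set _ | _] = setT `&` f @^-1` `[t, +oo[).
  by apply: mf => //; exact: measurable_itv.
by apply/seteqP; split => w /=; rewrite in_itv/= andbT// => -[].
Qed.

Lemma measurable_gt_set f (t : R) :
  measurable_fun setT f -> measurable [set w | t < f w].
Proof.
move=> mf; rewrite (_ : [set _ | _] = setT `&` f @^-1` `]t, +oo[).
  by apply: mf => //; exact: measurable_itv.
by apply/seteqP; split => w /=; rewrite in_itv/= andbT// => -[].
Qed.

Lemma measurable_inv_ge0 f : measurable_fun setT f -> (forall w, 0 <= f w) ->
  measurable_fun setT (fun w => (f w)^-1).
Proof.
move=> mf f0.
rewrite (_ : (fun _ => _) = fun w => \1_[set w | 0 < f w] w * expR (- ln (f w))).
  apply: measurable_funM; first by apply: measurable_indic; exact: measurable_gt_set.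
  apply: measurable_fun_expR; apply: measurableT_comp => //.
  by apply: measurableT_comp; [exact: measurable_ln|exact: mf].
apply/funext => w; rewrite indic_boolE.
have := f0 w; rewrite le_eqVlt => /predU1P[w0|w0].
  by rewrite -w0 ltxx mul0r invr0.
by rewrite w0 mul1r expRN lnK.
Qed.

Lemma bigcup_countable_measurable (I : countType) (D : set I) (F : I -> set T) :
  (forall i, D i -> measurable (F i)) -> measurable (\bigcup_(i in D) F i).
Proof.
move=> mF; pose G n := if @choice.unpickle I n is Some i then F i else (set0 : set T).
rewrite (_ : \bigcup_(i in D) F i = \bigcup_(n in @choice.pickle I @` D) G n).
  by apply: bigcup_measurable => _ [i Di <-]; rewrite /G choice.pickleK; exact: mF.
by rewrite bigcup_image; apply: eq_bigcupr => i _; rewrite /G choice.pickleK.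
Qed.

Lemma bigcap_countable_measurable (I : countType) (D : set I) (F : I -> set T) :
  (forall i, D i -> measurable (F i)) -> measurable (\bigcap_(i in D) F i).
Proof.
move=> mF; rewrite -[X in measurable X]setCK setC_bigcap; apply: measurableC.
by apply: bigcup_countable_measurable => i Di; apply: measurableC; exact: mF.
Qed.

End measurable_layers.

Lemma le_inv_nat_eq0 {R : realType} (x K : R) :
  (forall k : nat, `|x| <= K / k.+1%:R) -> x = 0.
Proof.
move=> xK; apply/eqP; rewrite -normr_le0; apply/ler_addgt0Pl => e e0.
rewrite addr0.
have K0 : 0 <= K by have := xK 0%N; rewrite divr1; exact: le_trans.
apply: (le_trans (xK (Num.truncn (K / e)))).
rewrite ler_pdivrMr ?ltr0n// mulrC -ler_pdivrMr//.
by rewrite ltW// truncnS_gt.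
Qed.

Section same_law.
Context {R : realType}.

Lemma floor_layers (k : nat) (t : R) : 0 <= t -> t <= k%:R ->
  `|t - \sum_(l < k) (l.+1%:R <= t)%R%:R| <= 1.
Proof.
elim: k t => [|k IH] t t0 tk.
  by rewrite big_ord0 subr0 (le_anti (introT andP (conj tk t0))) normr0.
rewrite big_ord_recr/=; have [tk'|tk'] := leP t k%:R.
  rewrite (_ : (k.+1%:R <= t) = false) ?addr0; first exact: IH.
  by apply/negbTE; rewrite -ltNge (le_lt_trans tk')// ltr_nat.
rewrite (eq_bigr (fun=> 1)) => [|i _]; last first.
  by rewrite (le_trans _ (ltW tk'))// ler_nat.
rewrite sumr_const card_ord; move: tk tk'; rewrite -natr1 => tk tk'.
by case: (_ <= t); rewrite ler_norml /=; lra.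
Qed.

(** Stationarity, the conditional law of a uniform choice and the law of [Z] are
    all given by probabilities of events. Up to [C / k], a function is a
    combination of the indicators of k of its layers [t <= phi], so these
    identities carry over to means. *)
Lemma eq_mean_layers d (T : measurableType d) (P : probability T R)
    d' (T' : measurableType d') (Q : probability T' R)
    (u phi : T -> R) (v psi : T' -> R) (C : R) : 0 < C ->
  bmeas u -> (forall w, 0 <= u w) -> bmeas v -> (forall w, 0 <= v w) ->
  measurable_fun setT phi -> (forall w, 0 <= phi w <= C) ->
  measurable_fun setT psi -> (forall w, 0 <= psi w <= C) ->
  (forall t : R, mean P (fun w => u w * \1_[set w | t <= phi w] w) =
                 mean Q (fun w => v w * \1_[set w | t <= psi w] w)) ->
  mean P (fun w => u w * phi w) = mean Q (fun w => v w * psi w).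
Proof.
move=> C0 bu u0 bv v0 mphi phiC mpsi psiC uv.
pose s k (t : R) := C / k.+1%:R * \sum_(l < k.+1) (l.+1%:R * (C / k.+1%:R) <= t)%R%:R.
have sE k t : 0 <= t <= C -> `|t - s k t| <= C / k.+1%:R.
  move=> /andP[t0 tC]; have c0 : 0 < C / k.+1%:R by rewrite divr_gt0.
  rewrite /s -{1}[t](@mulfVK _ (C / k.+1%:R)) ?gt_eqF// [_ * (C / _)]mulrC.
  rewrite -mulrBr normrM gtr0_norm// -[leRHS]mulr1 ler_pM2l//.
  under eq_bigr do rewrite -ler_pdivlMr//.
  apply: floor_layers; first by rewrite divr_ge0// ltW.
  by rewrite ler_pdivrMr// mulrC divfK ?gt_eqF.
have main d0 (T0 : measurableType d0) (P0 : probability T0 R) (u1 f : T0 -> R) k :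
    bmeas u1 -> (forall w, 0 <= u1 w) -> measurable_fun setT f ->
    (forall w, 0 <= f w <= C) ->
    `|mean P0 (fun w => u1 w * f w) - C / k.+1%:R * \sum_(l < k.+1)
       mean P0 (fun w => u1 w * \1_[set w | l.+1%:R * (C / k.+1%:R) <= f w] w)|
    <= mean P0 u1 * (C / k.+1%:R).
  move=> bu1 u10 mf fC.
  have bf : bmeas f by exact: bmeas_itv fC.
  have bl (l : 'I_k.+1) :
      bmeas (fun w => u1 w * \1_[set w | l.+1%:R * (C / k.+1%:R) <= f w] w).
    by apply: bmeasM => //; apply: bmeas_indic; exact: measurable_ge_set.
  rewrite -mean_sum// -meanZ; last exact: bmeas_sum.
  rewrite -meanB; [|exact: bmeasM|by apply: bmeasZ; exact: bmeas_sum].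
  have bd : bmeas (fun w => u1 w * f w - C / k.+1%:R * \sum_(l < k.+1)
      u1 w * \1_[set w | l.+1%:R * (C / k.+1%:R) <= f w] w).
    by apply: bmeasB; [exact: bmeasM|apply: bmeasZ; exact: bmeas_sum].
  apply: (le_trans (mean_norm _ bd)).
  rewrite [leRHS]mulrC -meanZ//; apply: mean_le; [exact: bmeas_norm|exact: bmeasZ|].
  move=> w; rewrite -mulr_sumr mulrCA -mulrBr normrM ger0_norm// mulrC.
  rewrite ler_wpM2r//.
  have := sE k _ (fC w); rewrite /s; congr (`|_ - _ * _| <= _).
  by apply: eq_bigr => l _; rewrite indicE mem_setE.
apply/eqP; rewrite -subr_eq0; apply/eqP.
apply: (@le_inv_nat_eq0 _ _ (C * (mean P u + mean Q v))) => k.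
have /= H1 := main _ _ P u phi k bu u0 mphi phiC.
have /= := main _ _ Q v psi k bv v0 mpsi psiC.
under eq_bigr do rewrite -uv.
move: H1; set S := \sum_(_ < _) _ => H1 H2.
have sub3 (x y z : R) : x - y = (x - z) - (y - z) by ring.
rewrite (sub3 _ _ (C / k.+1%:R * S)).
apply: (le_trans (ler_normB _ _)); rewrite (le_trans (lerD H1 H2))//.
by rewrite -mulrDl mulrCA !mulrA.
Qed.

Lemma eq_mean_law d (T : measurableType d) (P : probability T R)
    d' (T' : measurableType d') (Q : probability T' R)
    (phi : T -> R) (psi : T' -> R) (C : R) : 0 < C ->
  measurable_fun setT phi -> (forall w, 0 <= phi w <= C) ->
  measurable_fun setT psi -> (forall w, 0 <= psi w <= C) ->
  (forall t : R, prob P [set w | t <= phi w] = prob Q [set w | t <= psi w]) ->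
  mean P phi = mean Q psi.
Proof.
move=> C0 mphi phiC mpsi psiC uv.
have := @eq_mean_layers _ _ P _ _ Q (fun=> 1) phi (fun=> 1) psi C C0.
have one d0 (T0 : measurableType d0) (f : T0 -> R) :
  (fun w => 1 * f w) = f by apply/funext => w; rewrite mul1r.
rewrite !one; apply => //; try exact: bmeas_cst.
by move=> t; rewrite !one !mean_indic//; exact: measurable_ge_set.
Qed.

End same_law.

(** * The space of vanishing sequences *)

Section l0_topology.
Context {R : realType}.
Implicit Types x y : l0 R.

(** The measurable sets of [l0_borel] and [pathT] are [borel_l0] and
    [path_sigma]. *)
Definition l0_borel : Type := g_sigma_algebraType (@open (l0 R)).
HB.instance Definition _ := Measurable.on l0_borel.

Definition pathT : Type := g_sigma_algebraType
  (\bigcup_(i in [set: int])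
     preimage_set_system setT (fun x : int -> R => x i) measurable).
HB.instance Definition _ := Measurable.on pathT.

Lemma l0_coordB x y i : (x - y) i = x i - y i.
Proof. by []. Qed.

Lemma l0_coordZ (a : R) x i : (a *: x) i = a * x i.
Proof. by []. Qed.

Lemma l0_ext x y : (forall i, x i = y i) -> x = y.
Proof. by move=> xy; apply/val_inj/funext. Qed.

Lemma le_coord_norm x i : `|x i| <= `|x|.
Proof. exact: l0_norm_ub. Qed.

Lemma norm_le_coord x M : (forall i, `|x i| <= M) -> `|x| <= M.
Proof. exact: l0_norm_le. Qed.

Lemma lt_norm_coord x M : M < `|x| -> exists i, M < `|x i|.
Proof.
move=> Mx; apply: contrapT => /forallNP H.
suff : `|x| <= M by rewrite leNgt Mx.
by apply: norm_le_coord => i; rewrite leNgt; apply/negP.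
Qed.

Lemma l0_nbhsP x (A : set (l0 R)) :
  nbhs x A <-> exists2 e : R, 0 < e & forall y, `|x - y| < e -> A y.
Proof.
split.
  by move/nbhs_normP => [e /= e0 eA]; exists e => // y xy; exact: eA.
by move=> [e e0 eA]; apply/nbhs_normP; exists e.
Qed.

Lemma l0_cvgP x (f : l0 R -> R) :
  {for x, continuous f} <-> forall e : R, 0 < e ->
    exists2 d : R, 0 < d & forall y, `|x - y| < d -> `|f x - f y| < e.
Proof.
split.
  move=> /cvgrPdist_lt fx e e0.
  by have /l0_nbhsP := fx _ e0.
move=> H; apply: (iffRL (@cvgrPdist_lt _ R _ (nbhs x) _ f (f x))) => e e0.
by apply/l0_nbhsP; exact: H.
Qed.

Lemma continuous_coord i : continuous (fun x => x i).
Proof.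
move=> x; apply/l0_cvgP => e e0; exists e => // y xy.
by rewrite -l0_coordB (le_lt_trans (le_coord_norm _ _)).
Qed.

(** [block] is the special case of a window that starts at a multiple of its
    length; shifted blocks are windows again. *)
Definition clip (a b : int) (x : int -> R) : l0 R := L0 (window_vanishing a b x).

Lemma shift_l0E k x i : shift_l0 k x i = x (i + k).
Proof. by []. Qed.

Lemma clipE a b (x : int -> R) i : clip a b x i = if a < i <= b then x i else 0.
Proof. by []. Qed.

Lemma shift_l0D k l x : shift_l0 k (shift_l0 l x) = shift_l0 (k + l) x.
Proof. by apply: l0_ext => i; rewrite !shift_l0E addrA. Qed.

Lemma shift_l0_0 x : shift_l0 0 x = x.
Proof. by apply: l0_ext => i; rewrite shift_l0E addr0. Qed.

Lemma shift_l0B k x y : shift_l0 k (x - y) = shift_l0 k x - shift_l0 k y.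
Proof. exact: l0_ext. Qed.

Lemma shift_l0Z k a x : shift_l0 k (a *: x) = a *: shift_l0 k x.
Proof. exact: l0_ext. Qed.

Lemma norm_shift k x : `|shift_l0 k x| = `|x|.
Proof.
apply/eqP; rewrite eq_le; apply/andP; split; apply: norm_le_coord => i.
  by rewrite shift_l0E le_coord_norm.
by rewrite -[i in x i](addrNK k) -shift_l0E le_coord_norm.
Qed.

(** For [k = (N, m, t)]: supported by [-N, N], with coordinates t_i / (m + 1). The
    type of the index is countable, which is what separability is used for. *)
Definition grid (k : nat * nat * seq int) : l0 R :=
  clip (- k.1.1%:Z - 1) k.1.1%:Z
    (fun i => (nth 0 k.2 (absz (i + k.1.1%:Z)))%:~R / k.1.2.+1%:R).

(** Cut [x] where it is below [e / 2] and round down what remains. *)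
Lemma grid_dense x (e : R) : 0 < e -> exists k, `|x - grid k| < e.
Proof.
move=> e0; have /vanishingP vx := l0_in x.
have [N xN] := vx _ (divr_gt0 e0 (ltr0n _ 2)).
pose m := Num.trunc (2 / e).
exists (N, m, [seq Num.floor (x (i%:Z - N%:Z) * m.+1%:R) | i <- iota 0 (N + N + 1)%N]).
apply: (@le_lt_trans _ _ (e / 2)); last by rewrite ltr_pdivrMr// ltr_pMr// ltr1n.
apply: norm_le_coord => i; rewrite l0_coordB /grid clipE/=.
case: ifPn => [/andP[iN Ni]|iN]; last first.
  by rewrite subr0 ltW// xN// ; lia.
have ik : (absz (i + N%:Z)%R < N + N + 1)%N by lia.
rewrite (nth_map 0%N) ?size_iota// nth_iota// add0n.
rewrite (_ : (absz (i + N%:Z))%:Z - N%:Z = i); last by lia.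
have m0 : 0 < m.+1%:R :> R by rewrite ltr0n.
have := floor_itv (x i * m.+1%:R); rewrite intrD mulr1z => /andP[h1 h2].
move: h1 h2; set F := (Num.floor _)%:~R => h1 h2.
rewrite (_ : x i - F / m.+1%:R = (x i * m.+1%:R - F) / m.+1%:R); last first.
  by rewrite mulrBl mulfK ?gt_eqF.
rewrite normrM.
rewrite normfV (gtr0_norm m0) ler_pdivrMr//.
apply: (@le_trans _ _ 1); first by rewrite ger0_norm ?subr_ge0//; lra.
rewrite -ler_pdivrMl ?divr_gt0// mulr1 invf_div ltW//.
exact: truncnS_gt.
Qed.

(** As [l0] is separable, an open set is a countable union of closed balls around
    points of the grid, and a ball of the uniform norm is a condition on each
    coordinate. *)
Lemma measurable_l0 d (T : measurableType d) (V : T -> l0 R) :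
  (forall i, measurable_fun setT (fun w => V w i)) ->
  measurable_fun setT (V : T -> l0_borel).
Proof.
move=> mV.
have mB q (e : R) : measurable [set w | `|V w - q| <= e].
  rewrite (_ : [set _ | _] = \bigcap_(i : int) [set w | - e <= - `|V w i - q i|]).
    apply: bigcap_countable_measurable => i _; apply: measurable_ge_set; apply: measurableT_comp => //.
    by apply: measurableT_comp => //; exact: measurable_funD.
  apply/seteqP; split => w /= H.
    by move=> i _ /=; rewrite lerN2 -l0_coordB (le_trans _ H)// le_coord_norm.
  by apply: norm_le_coord => i; have /= := H i I; rewrite lerN2.
apply: measurability; first by [].
move=> _ [U oU <-]; rewrite setTI.
pose good (k : nat * (nat * nat * seq int)) :=
  forall y, `|y - grid k.2| <= k.1.+1%:R^-1 -> U y.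
rewrite (_ : _ @^-1` _ = \bigcup_(k in [set k | good k])
    [set w | `|V w - grid k.2| <= k.1.+1%:R^-1]).
  by apply: bigcup_countable_measurable => k _; exact: mB.
apply/seteqP; split => w /=; last by move=> [k gk /gk].
move=> UV; have /l0_nbhsP[e e0 eU] : nbhs (V w) U by exact: open_nbhs_nbhs.
pose m := Num.trunc (2 / e).
have me : m.+1%:R^-1 < e / 2.
  rewrite -[ltRHS]invrK ltf_pV2 ?posrE ?ltr0n ?invr_gt0 ?divr_gt0//.
  by rewrite invf_div; exact: truncnS_gt.
have [k kV] := grid_dense (V w) (e := m.+1%:R^-1) (ltac:(by rewrite invr_gt0)).
exists (m, k) => /=; last exact: ltW.
move=> y /= yk; apply: eU.
rewrite (_ : V w - y = (V w - grid k) - (y - grid k)); last first.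
  by rewrite opprB addrA subrK.
apply: (le_lt_trans (ler_normB _ _)).
by rewrite [ltRHS]splitr ltrD// ?(lt_trans kV)// (le_lt_trans yk).
Qed.

Lemma continuous_measurable_l0 (f : l0 R -> R) :
  continuous f -> measurable_fun setT (f : l0_borel -> R).
Proof.
move=> /continuousP cf; apply: (measurability _ (RGenOpens.measurableE R)).
move=> _ [_ [a [b ->] <-]]; rewrite setTI; apply: sub_sigma_algebra.
exact/cf/interval_open.
Qed.

Lemma measurable_coord i : measurable_fun setT (fun x : l0_borel => (x : l0 R) i).
Proof.
apply: (@continuous_measurable_l0 (fun x => x i)); exact: continuous_coord.
Qed.

Lemma measurable_shift_l0 k :
  measurable_fun setT (shift_l0 k : l0_borel -> l0_borel).
Proof. by apply: measurable_l0 => i; exact: measurable_coord. Qed.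

Lemma measurable_scale (a : R) :
  measurable_fun setT (( *:%R a) : l0_borel -> l0_borel).
Proof.
apply: measurable_l0 => i; apply: measurable_funM; first exact: measurable_cst.
exact: measurable_coord.
Qed.

Lemma measurable_path d (T : measurableType d) (V : T -> int -> R) :
  (forall i, measurable_fun setT (fun w => V w i)) ->
  measurable_fun setT (V : T -> pathT).
Proof.
move=> mV; apply: measurability; first by [].
move=> _ [_ [i _ [B mB <-]] <-]; rewrite !setTI.
by rewrite -[X in measurable X]setTI; exact: (mV i).
Qed.

Lemma measurable_path_coord i : measurable_fun setT (fun x : pathT => (x : int -> R) i).
Proof.
by move=> _ B mB; apply: sub_sigma_algebra; exists i => //; exists B.
Qed.

Lemma measurable_clip a b : measurable_fun setT (clip a b : pathT -> l0_borel).
Proof.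
apply: measurable_l0 => i; rewrite (_ : (fun w => clip a b w i) =
  if a < i <= b then fun w => w i else cst 0); last by case: ifP => h;
    apply/funext => w; rewrite clipE h.
by case: ifP => _; [exact: measurable_path_coord|exact: measurable_cst].
Qed.

Lemma measurable_vanishing :
  measurable ([set x : int -> R | x \in @vanishing R] : set pathT).
Proof.
rewrite (_ : [set _ | _] = \bigcap_(m : nat) \bigcup_(N : nat)
    \bigcap_(i in [set i : int | (N <= `|i|)%N])
      [set x : pathT | - m.+1%:R^-1 < - `|(x : int -> R) i|]).
  apply: bigcapT_measurable => m; apply: bigcupT_measurable => N.
  apply: bigcap_countable_measurable => i _; apply: measurable_gt_set; apply: measurableT_comp => //.
  by apply: measurableT_comp => //; exact: measurable_path_coord.
apply/seteqP; split => x /=.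
  move=> /vanishingP vx m _; have [|N xN] := vx m.+1%:R^-1.
    by rewrite invr_gt0.
  by exists N => // i /xN /=; rewrite ltrN2.
move=> H; apply/vanishingP => e e0.
have [N _ xN] := H (Num.trunc e^-1) I; exists N => i /xN/=; rewrite ltrN2.
move=> /lt_trans; apply; rewrite -[ltRHS]invrK ltf_pV2 ?posrE ?ltr0n ?invr_gt0//.
exact: truncnS_gt.
Qed.

Lemma to_l0E (x : int -> R) i :
  to_l0 x i = if x \in @vanishing R then x i else 0.
Proof.
have := congr1 (fun y : int -> R => y i) (val_insubd (0 : l0 R) x).
by rewrite -/(to_l0 x) /=; case: ifP.
Qed.

Lemma measurable_to_l0 : measurable_fun setT (@to_l0 R : pathT -> l0_borel).
Proof.
apply: measurable_l0 => i.
rewrite (_ : (fun w => _) = fun x : pathT =>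
    \1_([set x : int -> R | x \in @vanishing R] : set pathT) x * (x : int -> R) i).
  apply: measurable_funM; last exact: measurable_path_coord.
  by apply: measurable_indic; exact: measurable_vanishing.
apply/funext => x; rewrite to_l0E indicE mem_setE.
by case: ifPn; rewrite ?mul1r ?mul0r.
Qed.

End l0_topology.
Arguments l0_borel : clear implicits.
Arguments pathT : clear implicits.

(** * Lipschitz envelopes and sums over exceedances *)

Section envelope.
Context {R : realType}.
Implicit Types (x y : l0 R) (f : l0 R -> R).

(** The largest k-Lipschitz minorant of min(f, k). The truncation makes it bounded
    even for an unbounded f such as a sum over exceedances. *)
Definition env (k : nat) f x : R :=
  inf [set Num.min (f y) k%:R + k%:R * `|x - y| | y in [set: l0 R]].

Lemma env_lbound k f x : (forall y, 0 <= f y) ->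
  lbound [set Num.min (f y) k%:R + k%:R * `|x - y| | y in [set: l0 R]] 0.
Proof.
by move=> f0 _ [y _ <-]; rewrite addr_ge0 ?mulr_ge0// le_min f0 ler0n.
Qed.

Lemma env_le_at k f x y : (forall y, 0 <= f y) ->
  env k f x <= Num.min (f y) k%:R + k%:R * `|x - y|.
Proof.
move=> f0; apply: ge_inf; last by exists y.
by exists 0; exact: env_lbound.
Qed.

Lemma env_ge k f x (a : R) :
  (forall y, a <= Num.min (f y) k%:R + k%:R * `|x - y|) -> a <= env k f x.
Proof.
move=> af; apply: lb_le_inf; first by exists (Num.min (f x) k%:R + k%:R * `|x - x|), x.
by move=> _ [y _ <-].
Qed.

Lemma env_ge0 k f x : (forall y, 0 <= f y) -> 0 <= env k f x.
Proof.
by move=> f0; apply: env_ge => y; rewrite addr_ge0 ?mulr_ge0// le_min f0 ler0n.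
Qed.

Lemma env_le k f x : (forall y, 0 <= f y) -> env k f x <= f x.
Proof.
move=> f0; apply: (le_trans (env_le_at k x x f0)).
by rewrite subrr normr0 mulr0 addr0 ge_min lexx.
Qed.

Lemma env_le_nat k f x : (forall y, 0 <= f y) -> env k f x <= k%:R.
Proof.
move=> f0; apply: (le_trans (env_le_at k x x f0)).
by rewrite subrr normr0 mulr0 addr0 ge_min lexx orbT.
Qed.

Lemma env_lip k f x y : (forall y, 0 <= f y) ->
  `|env k f x - env k f y| <= k%:R * `|x - y|.
Proof.
move=> f0.
have one (a b : l0 R) : env k f a - env k f b <= k%:R * `|a - b|.
  rewrite lerBlDr -lerBlDl; apply: env_ge => z; rewrite lerBlDl.
  apply: (le_trans (env_le_at k a z f0)).
  rewrite addrCA lerD2l -mulrDr ler_wpM2l//.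
  by rewrite (le_trans _ (ler_normD _ _))// addrA subrK.
by rewrite ler_norml one andbT lerNl opprB distrC one.
Qed.

Lemma continuous_env k f : (forall y, 0 <= f y) -> continuous (env k f).
Proof.
move=> f0 x; apply/l0_cvgP => e e0; exists (e / k.+1%:R); first exact: divr_gt0.
move=> y; rewrite ltr_pdivlMr// => xye.
apply: (le_lt_trans (env_lip k x y f0)); rewrite (le_lt_trans _ xye)//.
by rewrite mulrC ler_wpM2l// ler_nat.
Qed.

Lemma env_shift k f x (i : int) : shift_invariant f ->
  env k f (shift_l0 i x) = env k f x.
Proof.
move=> fi; rewrite /env; congr inf; apply/seteqP; split=> _ [y _ <-].
  exists (shift_l0 (- i) y) => //; rewrite fi.
  by rewrite -(norm_shift (- i) (_ - y)) shift_l0B shift_l0D addNr shift_l0_0.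
exists (shift_l0 i y) => //.
by rewrite fi -shift_l0B norm_shift.
Qed.

(** Only the values of [f] near [x] matter in the limit: far from [x] the
    penalty exceeds any bound. *)
Lemma env_cvg f x : (forall y, 0 <= f y) -> {for x, continuous f} ->
  env k f x @[k --> \oo] --> f x.
Proof.
move=> f0 /l0_cvgP fx; apply/cvgrPdist_le => e e0.
have [d d0 fxd] := fx _ e0.
near=> k.
rewrite ger0_norm ?subr_ge0 ?env_le// lerBlDl -lerBlDr.
apply: env_ge => y; have [xy|xy] := ltP `|x - y| d.
  have k0 : 0 <= k%:R * `|x - y| by rewrite mulr_ge0.
  rewrite -[leLHS]addr0 lerD// le_min; apply/andP; split.
    by have := fxd _ xy; rewrite ltr_norml => /andP[]; lra.
  by rewrite lerBlDr ler_wpDr ?(ltW e0)//; near: k; exact: nbhs_infty_ger.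
rewrite lerBlDr ler_wpDr ?(ltW e0)//.
rewrite -[leLHS]add0r lerD//; first by rewrite le_min f0 ler0n.
apply: (@le_trans _ _ (k%:R * d)); last by rewrite ler_wpM2l.
by rewrite -ler_pdivrMr//; near: k; exact: nbhs_infty_ger.
Unshelve. all: by end_near. Qed.

End envelope.

Section pointwise_continuity.
Context {R : realType} {T : topologicalType}.
Implicit Types (x : T) (f g : T -> R).

Lemma continuous_for_cst x (a : R) : {for x, continuous (fun _ : T => a)}.
Proof. exact: (@cvg_cst _ _ _ (nbhs x) (nbhs_filter x)). Qed.

Lemma continuous_forD f g x : {for x, continuous f} -> {for x, continuous g} ->
  {for x, continuous (fun y => f y + g y)}.
Proof. exact: (@cvgD _ R _ (nbhs x) (nbhs_filter x)). Qed.

Lemma continuous_forB f g x : {for x, continuous f} -> {for x, continuous g} ->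
  {for x, continuous (fun y => f y - g y)}.
Proof. exact: (@cvgB _ R _ (nbhs x) (nbhs_filter x)). Qed.

Lemma continuous_forM f g x : {for x, continuous f} -> {for x, continuous g} ->
  {for x, continuous (fun y => f y * g y)}.
Proof. exact: (@cvgM _ _ (nbhs x) (nbhs_filter x)). Qed.

Lemma continuous_for_norm f x : {for x, continuous f} ->
  {for x, continuous (fun y => `|f y|)}.
Proof. exact: (@cvg_norm _ R _ (nbhs x) (nbhs_filter x)). Qed.

End pointwise_continuity.

Section exceedances.
Context {R : realType}.
Implicit Types (x y : l0 R) (f g : l0 R -> R).

Lemma exceed_finite x : finite_set (exceed x).
Proof.
have /vanishingP/(_ 1 ltr01)[N xN] := l0_in x.
apply: (@sub_finite_set _ _ [set` [seq i%:Z - N%:Z | i <- iota 0 (N + N)%N]]);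
  last exact: finite_seq.
move=> i; rewrite /exceed/= => xi; apply/mapP.
have iN : (`|i| < N)%N by rewrite ltnNge; apply/negP => /xN; rewrite ltNge ltW.
by exists (absz (i + N%:Z)); [rewrite mem_iota|]; lia.
Qed.

Definition exc x : {fset int} := fset_set (exceed x).

Lemma mem_exc x i : (i \in exc x) = (1 < `|x i|).
Proof.
rewrite /exc in_fset_set; last exact: exceed_finite.
by apply/idP/idP; rewrite inE.
Qed.

Definition nexc x : R := #|` exc x|%:R.

(** Every statistic of a cluster used here has this form: a sum over the
    exceedances of the cluster seen from each of them. *)
Definition csum g x : R := \sum_(i <- exc x) g (shift_l0 i x).

Definition supp0 g : Prop := forall x, `|x 0| <= 1 -> g x = 0.

(** Under [supp0], indices that are not exceedances may be added to the sum. *)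
Lemma csum_seq g x (s : seq int) : supp0 g -> uniq s ->
  (forall i, 1 < `|x i| -> i \in s) -> csum g x = \sum_(i <- s) g (shift_l0 i x).
Proof.
move=> g0 us xs; rewrite /csum.
rewrite [RHS](bigID (fun i => 1 < `|x i|))/= [X in _ + X]big1 ?addr0 => [|i xi].
  rewrite -[RHS]big_filter; apply: perm_big; apply: uniq_perm.
  - exact: fset_uniq.
  - exact: filter_uniq.
  by move=> i; rewrite mem_exc mem_filter; case: ltP => //= /xs ->.
by apply: g0; rewrite shift_l0E add0r leNgt.
Qed.

Lemma csum_shift g x k : supp0 g -> csum g (shift_l0 k x) = csum g x.
Proof.
move=> g0; rewrite (@csum_seq g _ [seq i - k | i <- exc x]) //.
- by rewrite big_map /csum; apply: eq_bigr => i _; rewrite shift_l0D subrK.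
- by rewrite map_inj_uniq ?fset_uniq//; exact: addIr.
move=> i; rewrite shift_l0E => xi; apply/mapP; exists (i + k).
  by rewrite mem_exc.
by rewrite addrK.
Qed.

Lemma csum_ge0 g x : (forall y, 0 <= g y) -> 0 <= csum g x.
Proof. by move=> g0; apply: sumr_ge0. Qed.

Lemma nexc_ge0 x : 0 <= nexc x.
Proof. by rewrite ler0n. Qed.

Lemma csum_le g x C : (forall y, g y <= C) -> csum g x <= nexc x * C.
Proof.
move=> gC; apply: (@le_trans _ _ (\sum_(i <- exc x) C)); first exact: ler_sum.
by rewrite big_const_seq count_predT iter_addr_0 mulr_natl.
Qed.

Definition peak0 x : R := (1 < `|x 0|)%R%:R.

Lemma peak0_ge0 x : 0 <= peak0 x. Proof. by rewrite /peak0 ler0n. Qed.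
Lemma peak0_le1 x : peak0 x <= 1.
Proof. by rewrite /peak0; case: (_ < _). Qed.

Lemma supp0_peak f : supp0 (fun x => peak0 x * f x).
Proof. by move=> x x1; rewrite /peak0 ltNge x1 mul0r. Qed.

Lemma csum_peak f x :
  csum (fun x => peak0 x * f x) x = \sum_(i <- exc x) f (shift_l0 i x).
Proof.
rewrite /csum !big_seq; apply: eq_bigr => i; rewrite mem_exc => xi.
by rewrite /peak0 shift_l0E add0r xi mul1r.
Qed.

Lemma csum1 x : csum peak0 x = nexc x.
Proof.
rewrite (_ : peak0 = fun x => peak0 x * 1) ?csum_peak; last first.
  by apply/funext => y; rewrite mulr1.
by rewrite big_const_seq count_predT iter_addr_0.
Qed.

Lemma nexc_shift k x : nexc (shift_l0 k x) = nexc x.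
Proof.
rewrite -!csum1 csum_shift// => y y1.
by rewrite /peak0 ltNge y1.
Qed.

Lemma nexc_eq0 x : nexc x = 0 -> forall i, `|x i| <= 1.
Proof.
move=> /eqP; rewrite pnatr_eq0 cardfs_eq0 => /eqP x0 i; rewrite leNgt -mem_exc.
by rewrite x0.
Qed.

Lemma nexc_ge1 x i : 1 < `|x i| -> 1 <= nexc x.
Proof.
rewrite -mem_exc => xi; rewrite /nexc ler1n cardfs_gt0; apply/eqP => x0.
by rewrite x0 in xi.
Qed.

(** Shifts change neither [f] nor the number of exceedances, so the terms of the
    sum are equal. *)
Lemma csum_share f x : shift_invariant f ->
  (forall y, (forall i, `|y i| <= 1) -> f y = 0) ->
  csum (fun x => peak0 x * (f x / nexc x)) x = f x.
Proof.
move=> fi f0; rewrite csum_peak.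
rewrite (eq_bigr (fun=> f x / nexc x)) => [|i _]; last by rewrite fi nexc_shift.
rewrite big_const_seq count_predT iter_addr_0 -mulr_natl.
have [n0|n0] := eqVneq (nexc x) 0.
  by rewrite [RHS]f0 ?n0 ?invr0 ?mulr0//; exact: nexc_eq0.
by rewrite mulrC divfK.
Qed.

Definition window (N : nat) : seq int := [seq i%:Z - N%:Z | i <- iota 0 (N + N + 1)%N].

Lemma window_uniq N : uniq (window N).
Proof. by rewrite map_inj_uniq ?iota_uniq// => i j; lia. Qed.

Lemma mem_window N i : (i \in window N) = (`|i| <= N)%N.
Proof.
apply/mapP/idP => [[j]|iN]; first by rewrite mem_iota; lia.
by exists (absz (i + N%:Z)); [rewrite mem_iota|]; lia.
Qed.

Lemma measurable_csum g : supp0 g ->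
  measurable_fun setT (g : l0_borel R -> R) ->
  measurable_fun setT (csum g : l0_borel R -> R).
Proof.
move=> g0 mg.
apply: (@measurable_fun_cvg _ _ _ _
    (fun N (x : l0_borel R) => \sum_(i <- window N) g (shift_l0 i x))).
  move=> N; apply: measurable_sum => i.
  exact: (measurableT_comp mg (measurable_shift_l0 i)).
move=> x _; apply: cvg_near_cst.
have /vanishingP/(_ 1 ltr01)[N xN] := l0_in x.
exists N => // n /= Nn; rewrite [RHS](@csum_seq _ _ (window n))//.
  exact: window_uniq.
move=> i xi; rewrite mem_window leqNgt; apply/negP => ni.
by have := xN i (ltac:(lia)); rewrite ltNge ltW.
Qed.

Lemma measurable_peak0 : measurable_fun setT (peak0 : l0_borel R -> R).
Proof.
rewrite (_ : peak0 = \1_[set x : l0_borel R | 1 < `|(x : l0 R) 0|]).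
  apply: measurable_indic; apply: measurable_gt_set.
  by apply: measurableT_comp => //; exact: measurable_coord.
by apply/funext => x; rewrite indic_boolE.
Qed.

Lemma measurable_nexc : measurable_fun setT (nexc : l0_borel R -> R).
Proof.
rewrite (_ : nexc = csum peak0); last by apply/funext => x; rewrite csum1.
apply: measurable_csum; last exact: measurable_peak0.
by move=> y y1; rewrite /peak0 ltNge y1.
Qed.

Lemma measurable_inv_nexc :
  measurable_fun setT (fun x : l0_borel R => (nexc x)^-1).
Proof.
by apply: measurable_inv_ge0; [exact: measurable_nexc|exact: nexc_ge0].
Qed.

Definition no_unit x : Prop := forall i, `|x i| <> 1.

(** Far out the coordinates of [x] are below 1/2, so only finitely many of them
    bound the distance of |x_i| to 1. *)
Lemma exc_near x : no_unit x ->
  exists2 d : R, 0 < d & forall y, `|x - y| < d -> exc y = exc x.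
Proof.
move=> x1; have /vanishingP/(_ (2^-1))[|N xN] := l0_in x; first by rewrite invr_gt0.
pose d := \big[Num.min/2^-1]_(i <- window N) `| `|x i| - 1|.
have d0 : 0 < d.
  rewrite /d; elim: (window N) => [|i s IH].
    by rewrite big_nil invr_gt0.
  rewrite big_cons lt_min IH andbT normr_gt0 subr_eq0.
  by apply/eqP; exact: x1.
exists d => // y xy; apply/fsetP => i; rewrite !mem_exc.
have xyi : `| `|x i| - `|y i| | < d.
  apply: le_lt_trans xy; apply: le_trans (ler_dist_dist _ _) _.
  by rewrite -l0_coordB le_coord_norm.
have dhalf : d <= 2^-1 by rewrite /d; exact: bigmin_le_id.
have [iN|iN] := leqP `|i| N.
  have : d <= `| `|x i| - 1|.
    by rewrite /d; apply: ge_bigmin_seq => //; rewrite mem_window.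
  move: xyi; rewrite ltr_norml => /andP[h1 h2].
  case: (ltP 1 `|x i|) => xi.
    by rewrite ger0_norm ?subr_ge0 ?(ltW xi)// => h; apply/idP; lra.
  by rewrite ler0_norm ?subr_le0// => h; apply/negbTE; rewrite -leNgt; lra.
have := xN i (ltnW iN); move: xyi; rewrite ltr_norml => /andP[h1 h2] h.
have -> : (1 < `|x i|) = false by apply/negbTE; rewrite -leNgt; lra.
by apply/negbTE; rewrite -leNgt; lra.
Qed.

Lemma continuous_near_eq f g x :
  (exists2 d : R, 0 < d & forall y, `|x - y| < d -> f y = g y) ->
  {for x, continuous g} -> {for x, continuous f}.
Proof.
move=> [d' d'0 fgd] /l0_cvgP gx; apply/l0_cvgP => e /gx[d d0 gd].
exists (Num.min d d'); first by rewrite lt_min d0.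
move=> y; rewrite lt_min => /andP[xy xy'].
by rewrite !fgd//; [exact: gd|rewrite subrr normr0].
Qed.

Lemma continuous_for_shift f x i : {for shift_l0 i x, continuous f} ->
  {for x, continuous (fun y => f (shift_l0 i y))}.
Proof.
move=> /l0_cvgP fx; apply/l0_cvgP => e /fx[d d0 fd]; exists d => // y xy.
by apply: fd; rewrite -shift_l0B norm_shift.
Qed.

Lemma continuous_csum g x : no_unit x ->
  (forall i, {for shift_l0 i x, continuous g}) -> {for x, continuous (csum g)}.
Proof.
move=> x1 gx; apply: (@continuous_near_eq _
    (fun y => \sum_(i <- exc x) g (shift_l0 i y))).
  by have [d d0 xd] := exc_near x1; exists d => // y /xd; rewrite /csum => ->.
elim: (enum_fset _) => [|i s IH].
  apply: (@continuous_near_eq _ (fun=> 0)); last exact: continuous_for_cst.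
  by exists 1 => // y _; rewrite big_nil.
apply: (@continuous_near_eq _ (fun y => g (shift_l0 i y) +
    \sum_(j <- s) g (shift_l0 j y))).
  by exists 1 => // y _; rewrite big_cons.
by apply: continuous_forD; [exact: continuous_for_shift|exact: IH].
Qed.

Lemma continuous_peak x f : no_unit x -> {for x, continuous f} ->
  {for x, continuous (fun x => peak0 x * f x)}.
Proof.
move=> x1 fx; apply: (@continuous_near_eq _ (fun y => peak0 x * f y)).
  have [d d0 xd] := exc_near x1; exists d => // y /xd yx.
  by rewrite /peak0 -!mem_exc yx.
by apply: continuous_forM => //; exact: continuous_for_cst.
Qed.

Lemma continuous_share x f : no_unit x -> {for x, continuous f} ->
  {for x, continuous (fun x => f x / nexc x)}.
Proof.
move=> x1 fx; apply: (@continuous_near_eq _ (fun y => f y / nexc x)).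
  have [d d0 xd] := exc_near x1; exists d => // y /xd yx.
  by rewrite /nexc yx.
by apply: continuous_forM => //; exact: continuous_for_cst.
Qed.

End exceedances.

(** * Tail process *)

Section clamp.
Context {R : realType}.

(** The closed form of min(1, max(0, t)), whose continuity is that of the
    norm. *)
Definition clamp (t : R) : R := (`|t| - `|t - 1| + 1) / 2.

Lemma clamp_le0 t : t <= 0 -> clamp t = 0.
Proof.
move=> t0; rewrite /clamp ler0_norm// ler0_norm; first by field.
by rewrite subr_le0 (le_trans t0).
Qed.

Lemma clamp_ge1 t : 1 <= t -> clamp t = 1.
Proof.
move=> t1; rewrite /clamp ger0_norm ?(le_trans _ t1)// ger0_norm ?subr_ge0//.
by field.
Qed.

Lemma clamp_mid t : 0 <= t -> t <= 1 -> clamp t = t.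
Proof.
move=> t0 t1; rewrite /clamp ger0_norm// ler0_norm ?subr_le0//; by field.
Qed.

Lemma clamp_itv t : 0 <= clamp t <= 1.
Proof.
have [t0|t0] := leP t 0; first by rewrite clamp_le0// lexx ler01.
have [t1|t1] := leP 1 t; first by rewrite clamp_ge1// lexx ler01.
by rewrite clamp_mid ?(ltW t0) ?(ltW t1).
Qed.

Lemma continuous_clamp : continuous clamp.
Proof.
move=> t; apply: (@continuous_forM _ _ (fun t : R => `|t| - `|t - 1| + 1) (fun=> 2^-1));
  last exact: continuous_for_cst.
apply: continuous_forD; last exact: continuous_for_cst.
apply: continuous_forB; first exact: norm_continuous.
apply: continuous_for_norm.
by apply: continuous_forB; [exact: cvg_id|exact: continuous_for_cst].
Qed.

End clamp.

Section embedding.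
Context {R : realType}.

Definition cwin (m : nat) (x : int -> R) : l0 R := clip (- m%:Z - 1) m%:Z x.

Lemma cwinE m (x : int -> R) i : cwin m x i = if (`|i| <= m)%N then x i else 0.
Proof.
rewrite /cwin clipE; case: ifPn => h1; case: ifPn => h2 //; exfalso; lia.
Qed.

Definition emb (m : nat) (v : 'rV[R]_(m.*2.+1)) : l0 R :=
  cwin m (fun i => v 0 (inord (absz (i + m%:Z)))).

Lemma emb_row m (x : int -> R) :
  emb (\row_(i < m.*2.+1) x (i%:Z - m%:Z)) = cwin m x.
Proof.
apply: l0_ext => i; rewrite /emb !cwinE; case: ifPn => // im.
rewrite mxE inordK; last by lia.
by congr x; lia.
Qed.

Lemma continuous_emb m : continuous (@emb m).
Proof.
move=> v; apply: (iffRL (@cvgrPdist_le _ _ _ (nbhs v) _ _ (emb v))) => e e0.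
apply/nbhs_ballP; exists e => //= v' vv'.
apply: norm_le_coord => i; rewrite l0_coordB /emb !cwinE.
case: ifPn => _; last by rewrite subrr normr0 ltW.
by have [_ h] := vv'; rewrite ltW//; exact: h.
Qed.

End embedding.

Section path_law.
Context {R : realType} d (T : measurableType d) (P : probability T R).
Variable X : int -> {RV P >-> R}.

Lemma measurable_path_of : measurable_fun setT (path_of X : T -> pathT R).
Proof. by apply: measurable_path => i; exact: (measurable_funPT (X i)). Qed.

Lemma measurable_shift k : measurable_fun setT (Defs.shift k : pathT R -> pathT R).
Proof. by apply: measurable_path => i; exact: (measurable_path_coord (i + k)). Qed.

Lemma bmeas_path (F : pathT R -> R) : bmeas F -> bmeas (fun w => F (path_of X w)).
Proof.
move=> [mF [M FM]]; split; last by exists M.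
exact: (measurableT_comp mF measurable_path_of).
Qed.

Hypothesis X_stationary : stationary X.

Lemma stationary_mean (F : pathT R -> R) k : bmeas F ->
  mean P (fun w => F (Defs.shift k (path_of X w))) = mean P (fun w => F (path_of X w)).
Proof.
move=> bF; have [mF [M FM]] := bF.
have mFs : measurable_fun setT (fun x : pathT R => F (Defs.shift k x)).
  exact: (measurableT_comp mF (measurable_shift k)).
have bFs : bmeas (fun x : pathT R => F (Defs.shift k x)) by split => //; exists M.
have M0 : 0 <= M by exact: le_trans (FM (fun=> 0)).
have H (x : pathT R) : 0 <= F x + M <= M + M.
  by have := FM x; rewrite ler_norml => /andP[h1 h2]; apply/andP; split; lra.
have bs : bmeas (fun w => F (Defs.shift k (path_of X w))) by exact: (bmeas_path bFs).
have b0 : bmeas (fun w => F (path_of X w)) by exact: bmeas_path.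
have E (f : T -> R) : bmeas f -> mean P f = mean P (fun w => f w + M) - M.
  by move=> bf; rewrite meanD ?mean_cst ?addrK//; exact: bmeas_cst.
rewrite E// [RHS]E//; congr (_ - _).
apply: (@eq_mean_law _ _ _ _ _ _ _ _ _ (M + M + 1)).
- by rewrite ltr_wpDl// addr_ge0.
- by apply: measurable_funD; [case: bs|exact: measurable_cst].
- by move=> w; have /andP[-> h] := H (Defs.shift k (path_of X w)); rewrite (le_trans h)// lerDl.
- by apply: measurable_funD; [case: b0|exact: measurable_cst].
- by move=> w; have /andP[-> h] := H (path_of X w); rewrite (le_trans h)// lerDl.
move=> t; rewrite /prob; congr fine.
have := @X_stationary k [set x | t <= F x + M]; apply.
apply: (@measurable_ge_set _ _ (pathT R) (fun x => F x + M)).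
by apply: measurable_funD => //; exact: measurable_cst.
Qed.

Definition tailp (u : R) : R := prob P [set w | u < `|X 0 w|].

(** Conditional mean of a function of the path given |X_0| > u. *)
Definition cmean (u : R) (F : (int -> R) -> R) : R :=
  mean P (fun w => (u < `|X 0 w|)%R%:R * F (path_of X w)) / tailp u.

Lemma bmeas_level u i : bmeas (fun x : pathT R => (u < `|(x : int -> R) i|)%R%:R : R).
Proof.
rewrite (_ : (fun _ => _) = \1_[set x : pathT R | u < `|(x : int -> R) i|]).
  apply: bmeas_indic; apply: measurable_gt_set; apply: measurableT_comp => //.
  exact: measurable_path_coord.
by apply/funext => x; rewrite indic_boolE.
Qed.

Lemma measurable_level u i : measurable [set w | u < `|X i w|].
Proof.
by apply: measurable_gt_set; apply: measurableT_comp.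
Qed.

Lemma tailp_ge0 u : 0 <= tailp u. Proof. exact: prob_ge0. Qed.

Lemma mean_level u i : mean P (fun w => (u < `|X i w|)%R%:R) = tailp u.
Proof.
have := stationary_mean (- i) (bmeas_level u i).
rewrite /Defs.shift addrN /path_of => <-.
rewrite /tailp -mean_indic; last exact: measurable_level.
by congr (mean P _); apply/funext => w; rewrite indic_boolE.
Qed.

Lemma tailp_le u v : u <= v -> tailp v <= tailp u.
Proof.
move=> uv; apply: le_prob; try exact: measurable_level.
by move=> w /=; exact: le_lt_trans.
Qed.

End path_law.

Section tail_process_theory.
Context {R : realType} d (T : measurableType d) (P : probability T R).
Variable X : int -> {RV P >-> R}.
Context d' (T' : measurableType d') (Q : probability T' R).
Variable Y : int -> {RV Q >-> R}.
Hypothesis X_stationary : stationary X.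
Hypothesis Y_tail : tail_process X Y.

(** The tail process is defined through row vectors, which [emb] maps
    continuously to [l0]. *)
Lemma tail_cwin m (f : l0 R -> R) : continuous f -> (exists M, forall x, `|f x| <= M) ->
  cmean X u (fun x => f (u^-1 *: cwin m x)) @[u --> +oo]
    --> mean Q (fun w => f (cwin m (path_of Y w))).
Proof.
move=> cf [M fM].
have [_ /(_ m (f \o @emb R m))] := Y_tail.
have cfe : continuous (f \o @emb R m).
  by move=> v; apply: continuous_comp; [exact: continuous_emb|exact: cf].
move=> /(_ cfe) /(_ (ex_intro _ M (fun x => fM _))).
rewrite (_ : mean Q _ = mean Q (fun w => f (cwin m (path_of Y w)))); last first.
  congr (mean Q _); apply/funext => w /=; congr f.
  by rewrite -[RHS]emb_row.
rewrite (_ : (fun u : R => _) = fun u => cmean X u (fun x => f (u^-1 *: cwin m x)))//.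
apply/funext => u; rewrite /cmean; congr (_ / _).
rewrite meanE Rintegral_mkcond; apply: eq_Rintegral => w _.
rewrite patchE (_ : (w \in _) = (u < `|X 0 w|)); last first.
  by apply/idP/idP; rewrite inE.
case: ifP => _; rewrite ?mul0r// mul1r /=; congr f.
have -> := emb_row m (fun j => u^-1 * X j w).
by apply: l0_ext => i; rewrite l0_coordZ !cwinE; case: ifP; rewrite ?mulr0.
Qed.

Lemma tailp_gt0 u : 0 < tailp X u.
Proof.
have c1 : continuous (fun _ : l0 R => 1 : R).
  by move=> x; exact: continuous_for_cst.
have b1 : exists M : R, forall x : l0 R, `|1 : R| <= M by exists `|1|.
have := @tail_cwin 0 _ c1 b1.
rewrite mean_cst => /cvgrPdist_lt /(_ 1 ltr01) H.
have {H} [v [uv vp]] : exists v, u <= v /\ `|1 - cmean X v (fun=> 1)| < 1.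
  have : \forall v \near +oo, u <= v /\ `|1 - cmean X v (fun=> 1)| < 1.
    near=> v; split; first by near: v; apply: nbhs_pinfty_ge; exact: num_real.
    by near: v; exact: H.
  by move=> /filter_ex.
apply: (lt_le_trans _ (tailp_le X uv)); rewrite lt_neqAle tailp_ge0 andbT.
apply/eqP => v0; move: vp; rewrite /cmean -v0 invr0 mulr0 subr0 normr1.
by rewrite ltxx.
Unshelve. all: by end_near. Qed.

Lemma Y0_gt1 : {ae Q, forall w, 1 < `|Y 0 w|}.
Proof.
have [Y1 _] := Y_tail; exists (~` [set w | 1 < `|Y 0 w|]); split.
- apply: measurableC; exact: measurable_level.
- rewrite probability_setC; last exact: measurable_level.
  by rewrite Y1 subee.
- by apply: subsetC.
Qed.

(** The form of regular variation that is needed: since |Y_0| > 1 almost surely,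
    most exceedances of a high level exceed it by some fixed factor. *)
Lemma tailp_level (e : R) : 0 < e ->
  exists2 a : R, 1 < a & \forall u \near +oo, (1 - e) * tailp X u <= tailp X (u * a).
Proof.
move=> e0.
pose f (k : nat) (t : R) := clamp (k%:R * (`|t| - 1) - 1).
have f_itv k t : 0 <= f k t <= 1 by exact: clamp_itv.
have cf k : continuous (f k).
  move=> t; rewrite /f; apply: (@continuous_comp _ _ _
    (fun t : R => k%:R * (`|t| - 1) - 1) clamp); last exact: continuous_clamp.
  apply: continuous_forB; last exact: continuous_for_cst.
  apply: continuous_forM; first exact: continuous_for_cst.
  by apply: continuous_forB; [exact: norm_continuous|exact: continuous_for_cst].
have : mean Q (fun w => f k (Y 0 w)) @[k --> \oo] --> mean Q (fun=> 1).
  apply: (@mean_dct _ _ _ _ _ _ 1).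
  - move=> k; apply: measurableT_comp; last exact: measurable_funPT.
    exact: continuous_measurable_fun.
  - exact: measurable_cst.
  - by move=> k w; have /andP[h1 h2] := f_itv k (Y 0 w); rewrite ger0_norm.
  apply: filterS Y0_gt1 => w Y1; apply: cvg_near_cst.
  near=> k; apply: clamp_ge1.
  rewrite lerBrDr -ler_pdivrMr ?subr_gt0//.
  by near: k; exact: nbhs_infty_ger.
rewrite mean_cst => /cvgrPdist_lt /(_ (e / 2) (divr_gt0 e0 (ltr0n _ 2))).
move=> /(filterI (nbhs_infty_gt 0)) /filter_ex [k [/= k0 fk]].
have k0' : 0 < k%:R :> R by rewrite ltr0n.
exists (1 + k%:R^-1); first by rewrite ltrDl invr_gt0.
have cg : continuous (fun x : l0 R => f k (x 0)).
  move=> x; apply: (@continuous_comp _ _ _ (fun x : l0 R => x 0) (f k)); last exact: cf.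
  exact: continuous_coord.
have := @tail_cwin 0 _ cg (ex_intro _ 1 _).
move=> /(_ (fun x => ltac:(by have /andP[h1 h2] := f_itv k (x 0); rewrite ger0_norm))).
rewrite (_ : (fun w => f k (cwin 0 (path_of Y w) 0)) = fun w => f k (Y 0 w)); last first.
  by apply/funext => w; rewrite cwinE.
move=> /cvgrPdist_lt /(_ (e / 2) (divr_gt0 e0 (ltr0n _ 2))) H.
near=> u.
have u0 : 0 < u by near: u; apply: nbhs_pinfty_gt; exact: num_real.
have : `|mean Q (fun w => f k (Y 0 w)) -
   cmean X u (fun x => f k ((u^-1 *: cwin 0 x) 0))| < e / 2 by near: u; exact: H.
move: fk; rewrite !ltr_norml => /andP[_ h1] /andP[_ h2].
have h3 : 1 - e < cmean X u (fun x => f k ((u^-1 *: cwin 0 x) 0)) by lra.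
rewrite -ler_pdivlMr ?tailp_gt0//; apply: (le_trans (ltW h3)).
rewrite /cmean ler_pM2r ?invr_gt0 ?tailp_gt0//.
rewrite -(mean_level X_stationary _ 0).
have bl v : bmeas (fun w => (v < `|X 0 w|)%R%:R : R).
  exact: (bmeas_path X (bmeas_level v 0)).
apply: mean_le => //.
  apply: bmeasM; first exact: bl.
  apply: (@bmeas_itv _ _ _ _ 0 1) => [|w]; last exact: f_itv.
  apply: measurableT_comp; first exact: continuous_measurable_fun.
  under eq_fun do rewrite l0_coordZ cwinE/=.
  by apply: measurable_funM; [exact: measurable_cst|exact: measurable_funPT].
move=> w; rewrite l0_coordZ cwinE/=.
have [uX|uX] := ltP u `|X 0 w|; last by rewrite mul0r.
rewrite mul1r; case: (ltP (u * (1 + k%:R^-1)) `|X 0 w|) => h.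
  by have /andP[] := f_itv k (u^-1 * path_of X w 0).
rewrite /f clamp_le0// subr_le0 /path_of normrM gtr0_norm ?invr_gt0//.
rewrite -ler_pdivlMl// mulr1 lerBlDl -ler_pdivlMl ?invr_gt0//.
by rewrite invrK mulrDr mulr1 -[u in u + _]mulr1 -mulrDr.
Unshelve. all: by end_near. Qed.

(** By stationarity the conditional probability that |X_i| / u is within a factor
    b of 1 is at most (p(u / b) - p(u b)) / p(u), with p = [tailp X]; by
    [tailp_level] this is small for b close to 1. *)
Lemma Y_no_unit i : Q [set w | `|Y i w| = 1] = 0%E.
Proof.
have mY : measurable [set w | `|Y i w| = 1].
  rewrite (_ : [set _ | _] = setT `&` (fun w => `|Y i w|) @^-1` [set 1]).
    have : measurable_fun setT (fun w => `|Y i w|) by apply: measurableT_comp.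
    by apply.
  by rewrite setTI.
rewrite -probK//; congr (_%:E).
suff H (e : R) : 0 < e -> e <= 2^-1 -> prob Q [set w | `|Y i w| = 1] <= 2 * e.
  apply/eqP; rewrite eq_le prob_ge0 andbT; apply/ler_addgt0Pl => e e0.
  rewrite addr0; pose e' := Num.min (e / 2) 2^-1.
  apply: (le_trans (H e' _ _)).
  - by rewrite lt_min divr_gt0//= invr_gt0.
  - by rewrite ge_min lexx orbT.
  - by rewrite mulrC -ler_pdivlMr// ge_min lexx.
move=> e0 e2.
have [a a1 Ha] := tailp_level e0.
(* Any b > 1 with b ^ 2 <= a works: u / b, u and u b are then levels between u / b
   and u / b * a. *)
pose b := 1 + Num.min ((a - 1) / 4) 1.
have b1 : 1 < b by rewrite ltrDl lt_min ltr01 divr_gt0// subr_gt0.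
have b0 : 0 < b by exact: lt_trans b1.
have bb : b * b <= a.
  have h1 : Num.min ((a - 1) / 4) 1 <= (a - 1) / 4 by rewrite ge_min lexx.
  have h2 : Num.min ((a - 1) / 4) 1 <= 1 by rewrite ge_min lexx orbT.
  have h3 : 0 <= Num.min ((a - 1) / 4) 1 by rewrite le_min ler01 divr_ge0// subr_ge0 ltW.
  rewrite /b; move: h1 h2 h3; set s := Num.min _ _ => h1 h2 h3; nra.
(* A bump that is 1 at |t| = 1 and vanishes outside 1 / b < |t| < b. *)
pose f (t : R) := 1 - clamp (b / (b - 1) * `| `|t| - 1|).
have f_itv t : 0 <= f t <= 1.
  by rewrite /f; have := clamp_itv (b / (b - 1) * `| `|t| - 1|) ; lra.
have cf : continuous f.
  move=> t; apply: (@continuous_forB _ _ (fun=> 1)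
    (fun t : R => clamp (b / (b - 1) * `| `|t| - 1|))); first exact: continuous_for_cst.
  apply: (@continuous_comp _ _ _ (fun t : R => b / (b - 1) * `| `|t| - 1|) clamp);
    last exact: continuous_clamp.
  apply: continuous_forM; first exact: continuous_for_cst.
  apply: continuous_for_norm.
  by apply: continuous_forB; [exact: norm_continuous|exact: continuous_for_cst].
have f_supp t : ~ (b^-1 < `|t| < b) -> f t = 0.
  move=> H; rewrite /f clamp_ge1 ?subrr//.
  have bm0 : 0 < b - 1 by rewrite subr_gt0.
  rewrite -ler_pdivrMl ?divr_gt0// mulr1 invf_div.
  have [h|h] := leP `|t| b^-1.
    rewrite distrC ger0_norm; last first.
      by rewrite subr_ge0 (le_trans h)// invf_le1 ?ltW.
    have -> : (b - 1) / b = 1 - b^-1 by rewrite mulrBl divff ?gt_eqF// mul1r.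
    lra.
  have {H} h' : b <= `|t| by rewrite leNgt; apply/negP => h'; apply: H; rewrite h h'.
  rewrite ger0_norm ?subr_ge0 ?(le_trans (ltW b1))//.
  apply: (@le_trans _ _ (b - 1)); last by rewrite lerD2r.
  by rewrite ler_pdivrMr// ler_peMr ?(ltW b1)// ltW.
have cg : continuous (fun x : l0 R => f (x i)).
  move=> x; apply: (@continuous_comp _ _ _ (fun x : l0 R => x i) f); last exact: cf.
  exact: continuous_coord.
have := @tail_cwin `|i|%N _ cg (ex_intro _ 1 _).
move=> /(_ (fun x => ltac:(by have /andP[h1 h2] := f_itv (x i); rewrite ger0_norm))).
rewrite (_ : (fun w => f (cwin `|i| (path_of Y w) i)) = fun w => f (Y i w)); last first.
  by apply/funext => w; rewrite cwinE leqnn.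
move=> H.
have bfY : bmeas (fun w => f (Y i w)).
  apply: (@bmeas_itv _ _ _ _ 0 1) => [|w]; last exact: f_itv.
  by apply: measurableT_comp; [exact: continuous_measurable_fun|exact: measurable_funPT].
apply: (@le_trans _ _ (mean Q (fun w => f (Y i w)))).
  rewrite -mean_indic//; apply: mean_le => //; first exact: bmeas_indic.
  move=> w; rewrite indicE; case: (boolP (w \in _)) => [|_]; last first.
    by have /andP[] := f_itv (Y i w).
  by rewrite inE /f /= => ->; rewrite subrr normr0 mulr0 clamp_le0// subr0.
apply: (cvgr_to_le H); near=> u.
have u0 : 0 < u by near: u; apply: nbhs_pinfty_gt; exact: num_real.
have Hu : (1 - e) * tailp X (u / b) <= tailp X (u / b * a).
  near: u.
  have ub : u / b @[u --> +oo] --> +oo.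
    by apply/cvgryPge => A; near=> u; rewrite ler_pdivlMr//; near: u; apply: nbhs_pinfty_ge; exact: num_real.
  exact: (ub _ Ha).
have p0 v := tailp_gt0 v.
have ub2 : tailp X (u * b) >= (1 - e) * tailp X (u / b).
  apply: (le_trans Hu); apply: tailp_le.
  by rewrite -mulrA ler_pM2l// ler_pdivlMl.
have ub1 : (1 - e) * tailp X (u / b) <= tailp X u.
  apply: (le_trans ub2); apply: tailp_le.
  by rewrite ler_peMr ?(ltW b1)// ltW.
rewrite /cmean ler_pdivrMr//.
have bl v j : bmeas (fun w => (v < `|X j w|)%R%:R : R).
  exact: (bmeas_path X (bmeas_level v j)).
apply: (@le_trans _ _ (mean P (fun w => (u / b < `|X i w|)%R%:R - (u * b < `|X i w|)%R%:R))).
  apply: mean_le.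
  - apply: bmeasM; first exact: bl.
    apply: (@bmeas_itv _ _ _ _ 0 1) => [|w]; last exact: f_itv.
    apply: measurableT_comp; first exact: continuous_measurable_fun.
    under eq_fun do rewrite l0_coordZ cwinE leqnn.
    by apply: measurable_funM; [exact: measurable_cst|exact: measurable_funPT].
  - by apply: bmeasB; exact: bl.
  move=> w; rewrite l0_coordZ cwinE leqnn.
  have [/andP[h1 h2]|h] := boolP (b^-1 < `|u^-1 * path_of X w i| < b).
    move: h1 h2; rewrite normrM gtr0_norm ?invr_gt0// ltr_pdivlMl// => h1.
    rewrite ltr_pdivrMl// => h2; rewrite h1 [u * b < _]ltNge (ltW h2)/= subr0.
    have /andP[h3 h4] := f_itv (u^-1 * path_of X w i).
    by case: (u < _); rewrite ?mul0r ?mul1r.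
  rewrite f_supp; last exact/negP.
  rewrite mulr0 subr_ge0.
  case: (ltP (u * b)) => //= ubX; first rewrite (_ : (u / b < _))//.
  apply: le_lt_trans ubX; rewrite ler_pdivrMr// -mulrA ler_peMr ?(ltW u0)//.
  by rewrite mulr_ege1 ?ltW.
rewrite meanB// !(mean_level X_stationary).
move: (p0 (u / b)) ub1 ub2; set p' := tailp X (u / b) => p'0 ub1 ub2.
have h : p' <= 2 * tailp X u by nra.
have : e * p' <= e * (2 * tailp X u) by rewrite ler_wpM2l// ltW.
lra.
Unshelve. all: by end_near. Qed.

End tail_process_theory.

(** * Mean of sums over clusters *)

Lemma limn_esup_lt {R : realType} (u : nat -> \bar R) (e : \bar R) :
  (limn_esup u < e)%E -> \forall n \near \oo, (u n < e)%E.
Proof.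
move=> /ereal_inf_lt[_ [V FV <-]] ue; apply: filterS FV => n Vn.
by apply: le_lt_trans ue; apply: ereal_sup_ubound; exists n.
Qed.

Lemma sum_bad_indices (r m : nat) :
  (\sum_(1 <= i < r.+1) ((i <= m) || (r < i + m)) <= m + m)%N.
Proof.
have H k : (\sum_(1 <= i < k.+1) (i <= m) <= minn k m)%N.
  elim: k => [|k IH]; first by rewrite big_geq.
  rewrite big_nat_recr//=; apply: (leq_trans (leq_add IH (leqnn _))).
  by case: leqP; lia.
apply: (@leq_trans (\sum_(1 <= i < r.+1) (i <= m) + \sum_(1 <= i < r.+1) (r < i + m))%N).
  by rewrite -big_split /=; apply: leq_sum => i _;
    case: (i <= m)%N; case: (r < i + m)%N.
apply: leq_add; first by rewrite (leq_trans (H r))// geq_minr.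
rewrite big_nat_rev/= big_nat_cond (eq_bigr (fun i => (i <= m) : nat)).
  by rewrite -big_nat_cond (leq_trans (H r))// geq_minr.
by move=> i /andP[/andP[i1 ir] _]; congr nat_of_bool; apply/idP/idP; lia.
Qed.

Lemma outer_index (i m r : nat) (l : int) : (- i%:Z < l <= r%:Z - i%:Z)%R ->
  ~~ (- m%:Z - 1 < l <= m%:Z)%R -> (1 <= i < r.+1)%N ->
  (m <= `|l|)%N && (`|l| <= r)%N.
Proof. lia. Qed.

Lemma inner_index (i m r : nat) (l : int) : (- m%:Z - 1 < l <= m%:Z)%R ->
  (m < i)%N -> (i + m <= r)%N -> (- i%:Z < l <= r%:Z - i%:Z)%R.
Proof. lia. Qed.

Definition anticlustering_condition {R : realType} d (T : measurableType d)
    (P : probability T R) (X : int -> {RV P >-> R}) (c : nat -> R)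
    (r : nat -> nat) : Prop :=
  forall x y : R, 0 < x -> 0 < y ->
    limn_esup (fun n => (cprob P
        [set w | c n * x < \big[Num.max/0]_(m <= i < (r n).+1)
                             Num.max `|X i%:Z w| `|X (- i%:Z) w|]
        [set w | c n * y < `|X 0 w|])%:E)
      @[m --> \oo] --> 0%E.

Definition mixing_condition {R : realType} d (T : measurableType d)
    (P : probability T R) (X : int -> {RV P >-> R}) (c : nat -> R)
    (r : nat -> nat) : Prop :=
  forall h : l0 R -> R,
    (forall x, 0 <= h x) ->
    (exists M : R, forall x, h x <= M) ->
    shift_invariant h ->
    lipschitz (h : l0 R -> R^o) ->
    (exists2 e : R, 0 < e &
       closure [set x | h x != 0] `<=` [set x | e < `|x|]) ->
    let a n := (n%:R * prob P [set w | c n < `|X 0 w|])^-1 in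
    let H n j w := h ((c n)^-1 *: block (r n) j (path_of X w)) in
    (mean P (fun w => expR (- (a n * \sum_(1 <= j < (n %/ r n).+1) H n j w)))
     - mean P (fun w => expR (- (a n * H n 1%N w))) ^+ (n %/ r n))
      @[n --> \oo] --> (0 : R).

Section vanishing_paths.
Context {R : realType}.

Lemma tail_partE m (x : l0 R) i :
  (x - cwin m x) i = if (`|i| <= m)%N then 0 else x i.
Proof. by rewrite l0_coordB cwinE; case: ifP; rewrite ?subrr ?subr0. Qed.

Lemma continuous_tail_norm m : continuous (fun x : l0 R => `|x - cwin m x|).
Proof.
move=> x; apply/l0_cvgP => e e0; exists e => // y xy.
apply: le_lt_trans (ler_dist_dist _ _) _.
apply: le_lt_trans xy; apply: norm_le_coord => i.
rewrite l0_coordB !tail_partE; case: ifP => _; first by rewrite subrr normr0.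
by rewrite -l0_coordB le_coord_norm.
Qed.

Lemma cwin_cvg (x : l0 R) (e : R) : 0 < e ->
  \forall m \near \oo, `|x - cwin m x| < e.
Proof.
move=> e0; have /vanishingP vx := l0_in x.
have [N xN] := vx _ (divr_gt0 e0 (ltr0n _ 2)); exists N => // m /= Nm.
apply: (@le_lt_trans _ _ (e / 2)); last by rewrite ltr_pdivrMr// ltr_pMr// ltr1n.
apply: norm_le_coord => i; rewrite tail_partE.
case: ifPn => im; first by rewrite normr0 divr_ge0 ?ltW.
by rewrite ltW// xN//; lia.
Qed.

Lemma to_l0K (x : int -> R) i : x \in @vanishing R -> to_l0 x i = x i.
Proof. by move=> vx; rewrite to_l0E vx. Qed.

Lemma cwin_to_l0 m (x : int -> R) : x \in @vanishing R ->
  cwin m (to_l0 x) = cwin m x.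
Proof. by move=> vx; apply: l0_ext => i; rewrite !cwinE to_l0K. Qed.

End vanishing_paths.

Section cluster_means.
Context {R : realType} d (T : measurableType d) (P : probability T R).
Variable X : int -> {RV P >-> R}.
Context d' (T' : measurableType d') (Q : probability T' R).
Variable Y : int -> {RV Q >-> R}.
Hypothesis X_stationary : stationary X.
Hypothesis Y_tail : tail_process X Y.
Variables (c : nat -> R) (r : nat -> nat).
Hypothesis c_gt0 : forall n, 0 < c n.
Hypothesis c_oo : c n @[n --> \oo] --> +oo.
Hypothesis r_oo : r n @[n --> \oo] --> \oo.
Hypothesis anticlustering : anticlustering_condition X c r.

(** The event of the anticlustering condition. *)
Definition far (m n : nat) (eta : R) (w : T) : bool :=
  c n * eta < \big[Num.max/0]_(m <= i < (r n).+1)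
                 Num.max `|X i%:Z w| `|X (- i%:Z) w|.

Lemma measurable_far m n eta : measurable [set w | far m n eta w].
Proof.
apply: measurable_gt_set; elim: (index_iota _ _) => [|i s IH].
  under eq_fun do rewrite big_nil; exact: measurable_cst.
under eq_fun do rewrite big_cons; apply: measurable_maxr => //.
by apply: measurable_maxr; apply: measurableT_comp.
Qed.

Lemma bmeas_far m n eta : bmeas (fun w => (far m n eta w)%:R : R).
Proof.
rewrite (_ : (fun _ => _) = \1_[set w | far m n eta w]).
  by apply: bmeas_indic; exact: measurable_far.
by apply/funext => w; rewrite indic_boolE.
Qed.

Lemma bmeas_peak u i : bmeas (fun w => (u < `|X i w|)%R%:R : R).
Proof. exact: (bmeas_path X (bmeas_level u i)). Qed.

Lemma farP m n eta w i : (m <= `|i|)%N -> (`|i| <= r n)%N ->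
  c n * eta < `|X i w| -> far m n eta w.
Proof.
move=> mi ir h; apply: (lt_le_trans h).
apply: (@le_trans _ _ (Num.max `|X (`|i|%N)%:Z w| `|X (- (`|i|%N)%:Z) w|)).
  rewrite le_max; apply/orP; have [i0|i0] := leP 0 i; [left|right].
    by rewrite (_ : (`|i|%N)%:Z = i) ?lexx//; lia.
  by rewrite (_ : - (`|i|%N)%:Z = i) ?lexx//; lia.
apply: (@le_bigmax_seq _ _ _ _ _ (`|i|%N) xpredT
  (fun i : nat => Num.max `|X i%:Z w| `|X (- i%:Z) w|)) => //.
by rewrite mem_index_iota mi.
Qed.

Lemma far_small (eta e : R) : 0 < eta -> 0 < e ->
  \forall m \near \oo, \forall n \near \oo,
    mean P (fun w => (c n < `|X 0 w|)%R%:R * (far m n eta w)%:R) / tailp X (c n) < e.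
Proof.
move=> eta0 e0; have e0' : (0 < e%:E)%E by rewrite lte_fin.
have H := anticlustering eta0 ltr01 (open_ereal_lt' e0').
have {}H : \forall m \near \oo, (limn_esup (fun n => (cprob P
    [set w | far m n eta w] [set w | c n * 1 < `|X 0 w|])%:E) < e%:E)%E by exact: H.
apply: filterS H => m /limn_esup_lt; apply: filterS => n; rewrite lte_fin.
apply: le_lt_trans.
rewrite /cprob mulr1 ler_pM2r ?invr_gt0 ?(tailp_gt0 Y_tail)//.
rewrite -mean_indic; last first.
  by apply: measurableI; [exact: measurable_far|exact: measurable_level].
apply: mean_le.
- by apply: bmeasM; [exact: bmeas_peak|exact: bmeas_far].
- by apply: bmeas_indic; apply: measurableI; [exact: measurable_far|exact: measurable_level].
move=> w; rewrite indicE; case: (boolP (w \in _)) => [_|].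
  by case: (_ < _); case: (far _ _ _ _); rewrite ?mulr1 ?mul0r ?mulr0.
move=> /negP wN; have [h1|_] := boolP (c n < `|X 0 w|); last by rewrite mul0r.
have [h2|_] := boolP (far m n eta w); last by rewrite mulr0.
by exfalso; apply: wN; rewrite inE; split.
Qed.

Lemma cvg_tail m (f : l0 R -> R) : continuous f -> (exists M, forall x, `|f x| <= M) ->
  cmean X (c n) (fun x => f ((c n)^-1 *: cwin m x)) @[n --> \oo]
    --> mean Q (fun w => f (cwin m (path_of Y w))).
Proof.
move=> cf bf; have H := tail_cwin Y_tail (m := m) cf bf.
exact: (cvg_comp _ _ c_oo H).
Qed.

Lemma bmeas_cwin_path d0 (T0 : measurableType d0) (V : T0 -> int -> R) (u : R) a b
    (f : l0 R -> R) : measurable_fun setT (V : T0 -> pathT R) ->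
  measurable_fun setT (f : l0_borel R -> R) ->
  (exists M, forall x, `|f x| <= M) ->
  bmeas (fun w => f (u *: clip a b (V w))).
Proof.
move=> mV mf [M fM]; split; last by exists M.
apply: (measurableT_comp mf).
apply: (measurableT_comp (measurable_scale u)).
exact: (measurableT_comp (measurable_clip a b) mV).
Qed.

Lemma bmeas_cwin d0 (T0 : measurableType d0) (V : T0 -> int -> R) m
    (f : l0 R -> R) : measurable_fun setT (V : T0 -> pathT R) ->
  measurable_fun setT (f : l0_borel R -> R) ->
  (exists M, forall x, `|f x| <= M) ->
  bmeas (fun w => f (cwin m (V w))).
Proof.
move=> mV mf bf; have := bmeas_cwin_path 1 (- m%:Z - 1) m%:Z mV mf bf.
by under eq_fun do rewrite scale1r.
Qed.

(** The anticlustering bound is uniform in the length of the window, so it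
    passes to [Y] through the windows [-M, M] and then to their union. *)
Lemma Y_vanishing : {ae Q, forall w, path_of Y w \in @vanishing R}.
Proof.
pose B (eta : R) := \bigcap_(m in [set: nat]) \bigcup_(i in [set i : int | (m < `|i|)%N])
  [set w | eta < `|Y i w|].
have mB eta : measurable (B eta).
  apply: bigcapT_measurable => m; apply: bigcup_countable_measurable => i _.
  exact: measurable_level.
suff B0 eta : 0 < eta -> Q (B eta) = 0%E.
  apply: (@negligibleS _ _ _ _ (\bigcup_k B k.+1%:R^-1)).
    move=> w /= wv; apply: contrapT => wB; apply: wv.
    apply/vanishingP => e e0.
    pose k := Num.trunc e^-1.
    have ke : k.+1%:R^-1 < e.
      by rewrite -[ltRHS]invrK ltf_pV2 ?posrE ?ltr0n ?invr_gt0// truncnS_gt.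
    have : ~ B k.+1%:R^-1 w by move=> Bk; apply: wB; exists k.
    move=> /existsNP[m] /not_implyP[_ Bm]; exists m.+1 => i mi.
    apply: le_lt_trans ke; rewrite leNgt; apply/negP => h; apply: Bm.
    by exists i.
  apply: negligible_bigcup => k; apply/negligibleP => //; apply: B0.
  by rewrite invr_gt0.
move=> eta0; rewrite -probK//; congr (_%:E); apply/eqP.
rewrite eq_le prob_ge0 andbT; apply/ler_addgt0Pl => e e0; rewrite addr0.
have eta2 : 0 < eta / 2 by rewrite divr_gt0.
have /filter_ex[m Hm] := far_small eta2 e0.
pose f (x : l0 R) : R := clamp ((eta / 2)^-1 * `|x - cwin m x| - 1).
have f_itv x : 0 <= f x <= 1 by exact: clamp_itv.
have bf : exists M : R, forall x, `|f x| <= M.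
  by exists 1 => x; have /andP[h1 h2] := f_itv x; rewrite ger0_norm.
have cf : continuous f.
  move=> x; apply: (@continuous_comp (l0 R) R R
    (fun x : l0 R => (eta / 2)^-1 * `|x - cwin m x| - 1) clamp); last exact: continuous_clamp.
  apply: continuous_forB; last exact: continuous_for_cst.
  apply: continuous_forM; first exact: continuous_for_cst.
  exact: continuous_tail_norm.
have mYp := measurable_path_of Y.
have mf := continuous_measurable_l0 cf.
have fe M : mean Q (fun w => f (cwin M (path_of Y w))) <= e.
  have H := @cvg_tail M _ cf bf; apply: (cvgr_to_le H); near=> n.
  have rM : (M <= r n)%N by near: n; exact: (r_oo (nbhs_infty_ge M)).
  apply: (@le_trans _ _ (mean P (fun w => (c n < `|X 0 w|)%R%:R *
      (far m n (eta / 2) w)%:R) / tailp X (c n))); last by apply/ltW; near: n.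
  rewrite /cmean ler_pM2r ?invr_gt0 ?(tailp_gt0 Y_tail)//; apply: mean_le.
  - apply: bmeasM; first exact: bmeas_peak.
    exact: (bmeas_cwin_path _ _ _ (measurable_path_of X) mf bf).
  - by apply: bmeasM; [exact: bmeas_peak|exact: bmeas_far].
  move=> w; rewrite ler_wpM2l ?ler0n//.
  have [_|/negP h] := boolP (far m n (eta / 2) w); first by have /andP[] := f_itv ((c n)^-1 *: cwin M (path_of X w)).
  rewrite /f clamp_le0// subr_le0 -ler_pdivlMl ?invr_gt0// invrK mulr1.
  apply: norm_le_coord => i; rewrite tail_partE; case: ifPn => im.
    by rewrite normr0 ltW.
  rewrite l0_coordZ cwinE; case: ifPn => iM; last by rewrite mulr0 normr0 ltW.
  rewrite leNgt; apply/negP => hi; apply: h; apply: (@farP _ _ _ _ i).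
  - by rewrite ltnW// ltnNge.
  - exact: leq_trans rM.
  by move: hi; rewrite normrM gtr0_norm ?invr_gt0// ltr_pdivlMl.
pose A (M : nat) := \bigcup_(i in [set i : int | (m < `|i| <= M)%N])
  [set w | eta < `|Y i w|].
have mA M : measurable (A M).
  by apply: bigcup_countable_measurable => i _; exact: measurable_level.
have AM M : (Q (A M) <= e%:E)%E.
  rewrite -probK// lee_fin -(mean_indic _ (mA M)); apply: le_trans (fe M).
  apply: mean_le; first exact: bmeas_indic.
    exact: bmeas_cwin.
  move=> w; rewrite indicE; case: (boolP (w \in A M)) => [|_]; last first.
    by have /andP[] := f_itv (cwin M (path_of Y w)).
  rewrite inE => -[i /= /andP[mi iM] Yi].
  rewrite /f clamp_ge1//.
  have := le_coord_norm (cwin M (path_of Y w) - cwin m (cwin M (path_of Y w))) i.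
  rewrite tail_partE cwinE iM leqNgt mi/= => h.
  rewrite lerBrDr (_ : 1 + 1 = (eta / 2)^-1 * eta); last by field; rewrite gt_eqF.
  by rewrite ler_pM2l ?invr_gt0// (le_trans _ h)// ltW.
rewrite -lee_fin probK//.
apply: (@le_trans _ _ (Q (\bigcup_M A M))).
  apply: le_measure; rewrite ?inE//; first exact: bigcupT_measurable.
  by move=> w /(_ m I) [i /= mi Yi]; exists `|i|%N => //; exists i => //=; rewrite mi/=.
have : Q (A M) @[M --> \oo] --> Q (\bigcup_M A M).
  apply: nondecreasing_cvg_mu => //; first exact: bigcupT_measurable.
  move=> M M' MM'; apply/subsetPset => w [i /= /andP[mi iM] Yi].
  by exists i => //=; rewrite mi (leq_trans iM).
move=> H; apply: (cvge_to_le H); exact: nearW.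
Unshelve. all: by end_near. Qed.

Lemma to_l0_measurable : measurable_fun setT (fun w => to_l0 (path_of Y w) : l0_borel R).
Proof. exact: (measurableT_comp (@measurable_to_l0 R) (measurable_path_of Y)). Qed.

Lemma bmeas_Y (f : l0 R -> R) : measurable_fun setT (f : l0_borel R -> R) ->
  (exists M, forall x, `|f x| <= M) -> bmeas (fun w => f (to_l0 (path_of Y w))).
Proof.
move=> mf [M fM]; split; last by exists M.
exact: (measurableT_comp mf to_l0_measurable).
Qed.

Lemma mean_cwin_cvg (f : l0 R -> R) : continuous f -> (exists M, forall x, `|f x| <= M) ->
  mean Q (fun w => f (cwin m (path_of Y w))) @[m --> \oo] -->
  mean Q (fun w => f (to_l0 (path_of Y w))).
Proof.
move=> cf [M fM]; have mf := continuous_measurable_l0 cf.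
apply: (@mean_dct _ _ _ _ _ _ M) => //.
- move=> m; have [] // := bmeas_cwin m (measurable_path_of Y) mf.
  by exists M.
- by have [] // := bmeas_Y mf; exists M.
apply: filterS Y_vanishing => w vY.
apply/cvgrPdist_lt => e e0.
have /l0_cvgP/(_ _ e0)[d0 d00 fd] := cf (to_l0 (path_of Y w)).
near=> m; apply: fd; rewrite -cwin_to_l0//.
by near: m; exact: cwin_cvg.
Unshelve. all: by end_near. Qed.

(** Law, as a mean functional, of the first block seen from one of its
    exceedances: by stationarity index [i] of the block may be moved to 0, which
    turns the block into the window ]-i, r - i]. *)
Definition mu (n : nat) (f : l0 R -> R) : R :=
  (\sum_(1 <= i < (r n).+1)
    cmean X (c n) (fun x => f ((c n)^-1 *: clip (- i%:Z) ((r n)%:Z - i%:Z) x)))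
  / (r n)%:R.

Definition itvfun (C : R) (f : l0 R -> R) : Prop := forall x, 0 <= f x <= C.

Lemma itvfun_bounded C f : itvfun C f -> exists M, forall x, `|f x| <= M.
Proof. by move=> fC; exists C => x; have /andP[h1 h2] := fC x; rewrite ger0_norm. Qed.

Lemma bmeas_cmean n a b (f : l0 R -> R) :
  measurable_fun setT (f : l0_borel R -> R) -> (exists M, forall x, `|f x| <= M) ->
  bmeas (fun w => (c n < `|X 0 w|)%R%:R * f ((c n)^-1 *: clip a b (path_of X w))).
Proof.
move=> mf bf; apply: bmeasM; first exact: bmeas_peak.
exact: (bmeas_cwin_path _ _ _ (measurable_path_of X) mf bf).
Qed.

Lemma le_cmean n a b a' b' (f g : l0 R -> R) C C' :
  measurable_fun setT (f : l0_borel R -> R) -> itvfun C f ->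
  measurable_fun setT (g : l0_borel R -> R) -> itvfun C' g ->
  (forall x, f ((c n)^-1 *: clip a b x) <= g ((c n)^-1 *: clip a' b' x)) ->
  cmean X (c n) (fun x => f ((c n)^-1 *: clip a b x)) <=
  cmean X (c n) (fun x => g ((c n)^-1 *: clip a' b' x)).
Proof.
move=> mf fC mg gC fg; rewrite /cmean ler_pM2r ?invr_gt0 ?(tailp_gt0 Y_tail)//.
apply: mean_le; [exact/bmeas_cmean/itvfun_bounded/fC|exact/bmeas_cmean/itvfun_bounded/gC|].
by move=> w; rewrite ler_wpM2l ?ler0n.
Qed.

Lemma cmean_cst n (a : R) : cmean X (c n) (fun=> a) = a.
Proof.
rewrite /cmean; under [in mean _ _]eq_fun do rewrite mulrC.
rewrite meanZ; last exact: bmeas_peak.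
by rewrite (mean_level X_stationary) mulfK// gt_eqF// (tailp_gt0 Y_tail).
Qed.

Lemma cmean_itv n a b (f : l0 R -> R) C :
  measurable_fun setT (f : l0_borel R -> R) -> itvfun C f ->
  0 <= cmean X (c n) (fun x => f ((c n)^-1 *: clip a b x)) <= C.
Proof.
move=> mf fC; have C0 : 0 <= C by have /andP[] := fC 0; exact: le_trans.
apply/andP; split.
  rewrite divr_ge0 ?tailp_ge0//; apply: mean_ge0 => w.
  by rewrite mulr_ge0//; have /andP[] := fC ((c n)^-1 *: clip a b (path_of X w)).
rewrite -[leRHS](cmean_cst n).
apply: (@le_cmean n a b a b f (fun=> C) C C) => //.
- by move=> x; rewrite C0 lexx.
- by move=> x; have /andP[] := fC ((c n)^-1 *: clip a b x).
Qed.

(** If [m < i] and [i + m <= r n], the window ]-i, r - i] contains [-m, m], and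
    by anticlustering what it contains outside [-m, m] is uniformly small except
    on an event of small conditional probability; the window [-m, m] converges
    by the definition of the tail process. At most [m + m] indices are left,
    which do not count as [r n] grows. *)
Lemma mu_cvg_lip (f : l0 R -> R) (C L : R) : itvfun C f -> 0 <= L ->
  (forall x y, `|f x - f y| <= L * `|x - y|) ->
  mu n f @[n --> \oo] --> mean Q (fun w => f (to_l0 (path_of Y w))).
Proof.
move=> fC L0 fL.
have C0 : 0 <= C by have /andP[] := fC 0; exact: le_trans.
have bf := itvfun_bounded fC.
have cf : continuous f.
  move=> x; apply/l0_cvgP => e e0; exists (e / (L + 1)).
    by rewrite divr_gt0// ltr_wpDl.
  move=> y; rewrite ltr_pdivlMr ?ltr_wpDl// => h.
  apply: le_lt_trans (fL _ _) _; apply: le_lt_trans h.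
  by rewrite mulrC ler_wpM2l// lerDl.
have mf := continuous_measurable_l0 cf.
set E := mean Q _.
have E_itv : 0 <= E <= C.
  rewrite /E; apply/andP; split.
    by apply: mean_ge0 => w; have /andP[] := fC (to_l0 (path_of Y w)).
  rewrite -[leRHS](mean_cst Q C); apply: mean_le; [exact: bmeas_Y|exact: bmeas_cst|].
  by move=> w; have /andP[] := fC (to_l0 (path_of Y w)).
apply/cvgrPdist_le => e e0.
(* One fifth each for the Lipschitz error, the far event, the convergence of the
   window law in n, the window length m, and the boundary indices. *)
have e5 : 0 < e / 5 by rewrite divr_gt0.
pose eta := e / 5 / (L + 1).
have eta0 : 0 < eta by rewrite divr_gt0// ltr_wpDl.
have Leta : L * eta <= e / 5.
  rewrite /eta mulrCA ler_piMr ?(ltW e5)//.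
  by rewrite ler_pdivrMr ?ltr_wpDl// mul1r lerDl.
clearbody eta.
have Le0 : 0 <= L * eta by rewrite mulr_ge0// ltW.
have eC : 0 < e / 5 / (C + 1) by rewrite divr_gt0// ltr_wpDl.
have Hm : \forall m \near \oo, `|E - mean Q (fun w => f (cwin m (path_of Y w)))| <= e / 5.
  by have /cvgrPdist_le/(_ _ e5) := mean_cwin_cvg cf bf.
have [m [{}Hm Hfar]] := filter_ex (filterI Hm (far_small eta0 eC)).
have Hn : \forall n \near \oo, `|mean Q (fun w => f (cwin m (path_of Y w))) -
    cmean X (c n) (fun x => f ((c n)^-1 *: cwin m x))| <= e / 5.
  by have /cvgrPdist_le/(_ _ e5) := @cvg_tail m f cf bf.
have Hr : \forall n \near \oo, ((m + m)%:R * C / (e / 5) < (r n)%:R :> R).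
  near=> n; have : (Num.trunc ((m + m)%:R * C / (e / 5)) < r n)%N.
    by near: n; exact: (r_oo (nbhs_infty_gt _)).
  by rewrite -(ler_nat R); apply: lt_le_trans; exact: truncnS_gt.
near=> n.
have rn : (m + m)%:R * C / (e / 5) < (r n)%:R :> R by near: n.
have h4 : `|mean Q (fun w => f (cwin m (path_of Y w))) -
    cmean X (c n) (fun x => f ((c n)^-1 *: cwin m x))| <= e / 5 by near: n.
have r0 : 0 < (r n)%:R :> R.
  by apply: le_lt_trans rn; rewrite divr_ge0 ?(ltW e5)// mulr_ge0.
set b := mean P (fun w => (c n < `|X 0 w|)%R%:R * (far m n eta w)%:R) / tailp X (c n).
have bC : C * b <= e / 5.
  have : b < e / 5 / (C + 1) by rewrite /b; near: n.
  rewrite ltr_pdivlMr ?ltr_wpDl// => h; apply: le_trans (ltW h).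
  rewrite mulrC ler_wpM2l// ?lerDl//.
  by rewrite divr_ge0 ?tailp_ge0//; apply: mean_ge0 => w; rewrite mulr_ge0.
have good i : (m < i)%N -> (i + m <= r n)%N ->
    `|cmean X (c n) (fun x => f ((c n)^-1 *: clip (- i%:Z) ((r n)%:Z - i%:Z) x))
     - cmean X (c n) (fun x => f ((c n)^-1 *: cwin m x))| <= L * eta + C * b.
  move=> mi ir.
  rewrite /cmean -mulrBl normrM [X in _ * X]gtr0_norm ?invr_gt0 ?(tailp_gt0 Y_tail)//.
  rewrite ler_pdivrMr ?(tailp_gt0 Y_tail)// mulrDl /b mulrA divfK ?gt_eqF ?(tailp_gt0 Y_tail)//.
  rewrite -(mean_level X_stationary _ 0) -[L * eta * _]meanZ; last exact: bmeas_peak.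
  rewrite -[C * _]meanZ; last by apply: bmeasM; [exact: bmeas_peak|exact: bmeas_far].
  have b1 := bmeas_cmean n (- i%:Z) ((r n)%:Z - i%:Z) mf bf.
  have b2 := bmeas_cmean n (- m%:Z - 1) m%:Z mf bf.
  have b3 : bmeas (fun w => L * eta * (c n < `|X 0 w|)%R%:R) by apply: bmeasZ; exact: bmeas_peak.
  have b4 : bmeas (fun w => C * ((c n < `|X 0 w|)%R%:R * (far m n eta w)%:R)).
    by apply: bmeasZ; apply: bmeasM; [exact: bmeas_peak|exact: bmeas_far].
  rewrite -meanB// -meanD//.
  apply: le_trans (mean_norm _ (bmeasB b1 b2)) _.
  apply: mean_le; [exact/bmeas_norm/bmeasB|exact: bmeasD|].
  move=> w; rewrite -mulrBr; case: (c n < `|X 0 w|); last first.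
    by rewrite !mul0r !mulr0 normr0 addr0.
  rewrite !mul1r mulr1.
  set x1 := _ *: clip _ _ _; set x2 := _ *: clip _ _ _.
  have /andP[f10 f1C] := fC x1; have /andP[f20 f2C] := fC x2.
  have [_|/negP h] := boolP (far m n eta w).
    rewrite mulr1 (@le_trans _ _ C) ?lerDr//.
    by rewrite ler_norml; lra.
  rewrite mulr0 addr0; apply: le_trans (fL _ _) _; rewrite ler_wpM2l//.
  apply: norm_le_coord => l; rewrite l0_coordB !l0_coordZ !clipE.
  case: ifPn => l1; case: ifPn => l2; rewrite ?subrr ?normr0 ?(ltW eta0)//.
    rewrite mulr0 subr0 normrM gtr0_norm ?invr_gt0// ler_pdivrMl//.
    rewrite leNgt; apply/negP => h1; apply: h.
    have i1 : (1 <= i < (r n).+1)%N.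
      by rewrite (leq_ltn_trans (leq0n m) mi) ltnS (leq_trans (leq_addr m i)).
    by have /andP[h2 h3] := outer_index l1 l2 i1; exact: (@farP _ _ _ _ l).
  by rewrite (inner_index l2 mi ir) in l1.
have all i : (1 <= i < (r n).+1)%N ->
  `|E - cmean X (c n) (fun x => f ((c n)^-1 *: clip (- i%:Z) ((r n)%:Z - i%:Z) x))|
   <= (L * eta + C * b + e / 5 + e / 5) + C * ((i <= m) || (r n < i + m))%N%:R.
  move=> ir; have [_|] := boolP ((i <= m) || (r n < i + m))%N.
    have b0 : 0 <= C * b.
      rewrite mulr_ge0// divr_ge0 ?tailp_ge0//; apply: mean_ge0 => w.
      by rewrite mulr_ge0.
    rewrite mulr1 ler_wpDl//; first by rewrite !addr_ge0// ltW.
    have := cmean_itv n (- i%:Z) ((r n)%:Z - i%:Z) mf fC.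
    by move: E_itv => /andP[? ?] /andP[? ?]; rewrite ler_norml; lra.
  rewrite negb_or -!ltnNge ltnS => /andP[h1 h2]; rewrite mulr0 addr0.
  have h3 := good i h1 h2; move: h3 h4 Hm; set D := cmean _ _ _; set D' := cmean _ _ _.
  set M' := mean _ _; rewrite !ler_norml; lra.
rewrite /mu (_ : E = (\sum_(1 <= i < (r n).+1) E) / (r n)%:R); last first.
  by rewrite big_const_nat subSS subn0 iter_addr_0 -[E *+ _]mulr_natr mulfK// gt_eqF.
rewrite -mulrBl -sumrB normrM [X in _ * X]gtr0_norm ?invr_gt0// ler_pdivrMr//.
apply: le_trans (ler_norm_sum _ _ _) _.
rewrite big_nat; apply: le_trans (ler_sum _ all) _; rewrite -big_nat.
set B := L * eta + C * b + e / 5 + e / 5.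
have cstB : \sum_(1 <= i < (r n).+1) B = B * (r n)%:R.
  by rewrite big_const_nat subSS subn0 iter_addr_0 -[LHS]mulr_natr.
rewrite big_split/= cstB -mulr_sumr.
have bad : C * \sum_(1 <= i < (r n).+1) ((i <= m) || (r n < i + m))%N%:R <= e / 5 * (r n)%:R.
  apply: (@le_trans _ _ (C * (m + m)%:R)).
    by rewrite ler_wpM2l// -natr_sum ler_nat sum_bad_indices.
  by move: rn; rewrite ltr_pdivrMr// => /ltW; rewrite mulrC [_ * (e / 5)]mulrC.
apply: le_trans (lerD (lexx _) bad) _; rewrite -mulrDl ler_wpM2r ?(ltW r0)// /B.
lra.
Unshelve. all: by end_near. Qed.

End cluster_means.

Lemma shift_clip {R : realType} (a : R) (u v k : int) (x : int -> R) :
  shift_l0 k (a *: clip u v x) = a *: clip (u - k) (v - k) (Defs.shift k x).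
Proof.
apply: l0_ext => i; rewrite shift_l0E !l0_coordZ !clipE.
by rewrite ltrBlDr lerBrDr.
Qed.

Lemma shift_block {R : realType} (rho j : nat) (x : int -> R) :
  block rho j x = shift_l0 (- (j.-1 * rho)%N%:Z)
    (clip 0 ((j * rho)%N%:Z - (j.-1 * rho)%N%:Z) (Defs.shift (j.-1 * rho)%N%:Z x)).
Proof.
apply: l0_ext => i; rewrite shift_l0E clipE /Defs.shift subrK /=.
by rewrite subr_gt0 lerD2r.
Qed.

Lemma block1E {R : realType} (rho : nat) (x : int -> R) :
  block rho 1 x = clip 0 rho%:Z x.
Proof. by apply: l0_ext => i; rewrite clipE /= mul0n mul1n. Qed.

Lemma block_csum {R : realType} (g : l0 R -> R) (a : R) (rho j : nat) (x : int -> R) :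
  supp0 g ->
  csum g (a *: block rho j x) =
  \sum_((j.-1 * rho).+1 <= i < (j * rho).+1) g (shift_l0 i%:Z (a *: block rho j x)).
Proof.
move=> g0; rewrite (@csum_seq _ g _ [seq i%:Z | i <- index_iota (j.-1 * rho).+1 (j * rho).+1]) //.
- by rewrite big_map.
- by rewrite map_inj_uniq ?iota_uniq// => i1 i2 [].
move=> i; rewrite l0_coordZ /=; case: ifPn => [/andP[i1 i2] _|_]; last first.
  by rewrite mulr0 normr0 ltr10.
move: i1 i2; move: (j.-1 * rho)%N (j * rho)%N => A B iA iB.
apply/mapP; exists `|i|%N; last by move: iA; clear; lia.
by rewrite mem_index_iota; move: iA iB; clear; lia.
Qed.

Section cluster_sums.
Context {R : realType} d (T : measurableType d) (P : probability T R).
Variable X : int -> {RV P >-> R}.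
Context d' (T' : measurableType d') (Q : probability T' R).
Variable Y : int -> {RV Q >-> R}.
Hypothesis X_stationary : stationary X.
Hypothesis Y_tail : tail_process X Y.
Variables (c : nat -> R) (r : nat -> nat).
Hypothesis c_gt0 : forall n, 0 < c n.
Hypothesis c_oo : c n @[n --> \oo] --> +oo.
Hypothesis r_oo : r n @[n --> \oo] --> \oo.
Hypothesis anticlustering : anticlustering_condition X c r.

Local Notation mun := (mu X c r).
Local Notation Ybar w := (to_l0 (path_of Y w)).

Lemma mu_le n (f g : l0 R -> R) C C' :
  measurable_fun setT (f : l0_borel R -> R) -> itvfun C f ->
  measurable_fun setT (g : l0_borel R -> R) -> itvfun C' g ->
  (forall x, f x <= g x) -> mun n f <= mun n g.
Proof.
move=> mf fC mg gC fg; rewrite /mu ler_wpM2r// ?invr_ge0//.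
by apply: ler_sum => i _; apply: (le_cmean Y_tail mf fC mg gC).
Qed.

(** Lower half of the portmanteau theorem, through the Lipschitz minorants. *)
Lemma mu_lower (f : l0 R -> R) C (e : R) :
  measurable_fun setT (f : l0_borel R -> R) -> itvfun C f ->
  {ae Q, forall w, {for Ybar w, continuous f}} -> 0 < e ->
  \forall n \near \oo, mean Q (fun w => f (Ybar w)) - e < mun n f.
Proof.
move=> mf fC cf e0; have f0 x : 0 <= f x by have /andP[] := fC x.
have e2 : 0 < e / 2 by rewrite divr_gt0.
have envC k x : 0 <= env k f x <= C.
  by rewrite env_ge0//= (le_trans (env_le _ _ f0))//; have /andP[] := fC x.
have menv k := continuous_measurable_l0 (@continuous_env _ k _ f0).
have : mean Q (fun w => env k f (Ybar w)) @[k --> \oo] --> mean Q (fun w => f (Ybar w)).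
  apply: (@mean_dct _ _ _ _ _ _ C).
  - by move=> k; have [] := bmeas_Y Y (menv k) (itvfun_bounded (envC k)).
  - by have [] := bmeas_Y Y mf (itvfun_bounded fC).
  - by move=> k w; have /andP[h1 h2] := envC k (Ybar w); rewrite ger0_norm.
  by apply: filterS cf => w cfw; exact: env_cvg.
move=> /cvgrPdist_lt /(_ _ e2) /filter_ex [k Hk].
have Hmu : mun n (env k f) @[n --> \oo] --> mean Q (fun w => env k f (Ybar w)).
  apply: (mu_cvg_lip X_stationary Y_tail c_gt0 c_oo r_oo anticlustering
    (envC k) (ler0n _ k)) => x y.
  exact: env_lip.
have /cvgrPdist_lt /(_ _ e2) := Hmu.
apply: filterS => n Hn.
apply: (lt_le_trans _ (mu_le n (menv k) (envC k) mf fC _)); last first.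
  by move=> x; exact: env_le.
by move: Hk Hn; rewrite !ltr_norml; lra.
Qed.

Lemma mu_compl n (f : l0 R -> R) C : (0 < r n)%N ->
  measurable_fun setT (f : l0_borel R -> R) -> itvfun C f ->
  mun n (fun x => C - f x) = C - mun n f.
Proof.
move=> r0 mf fC.
have rn : (r n)%:R != 0 :> R by rewrite pnatr_eq0 -lt0n.
rewrite {2}(_ : C = (\sum_(1 <= i < (r n).+1) C) / (r n)%:R); last first.
  by rewrite big_const_nat subSS subn0 iter_addr_0 -[C *+ _]mulr_natr mulfK.
rewrite /mu -mulrBl -sumrB; congr (_ / _); apply: eq_bigr => i _.
rewrite -[C in RHS](cmean_cst X_stationary Y_tail c n) /cmean -mulrBl -meanB; last 2 first.
- by apply: bmeasM; [exact: bmeas_peak|exact: bmeas_cst].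
- by apply: bmeas_cmean => //; exact: itvfun_bounded fC.
by congr (mean P _ / _); apply/funext => w; rewrite mulrBr.
Qed.

(** Upper half of the portmanteau theorem: the lower half for [C - f]. *)
Lemma mu_cvg (f : l0 R -> R) C :
  measurable_fun setT (f : l0_borel R -> R) -> itvfun C f ->
  {ae Q, forall w, {for Ybar w, continuous f}} ->
  mun n f @[n --> \oo] --> mean Q (fun w => f (Ybar w)).
Proof.
move=> mf fC cf; apply/cvgrPdist_lt => e e0.
have H1 := mu_lower mf fC cf e0.
have mf' : measurable_fun setT ((fun x => C - f x) : l0_borel R -> R).
  by apply: measurable_funB => //; exact: measurable_cst.
have fC' : itvfun C (fun x => C - f x).
  by move=> x; have /andP[h1 h2] := fC x; rewrite subr_ge0 h2 lerBlDr lerDl.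
have H2 : \forall n \near \oo,
    mean Q (fun w => C - f (Ybar w)) - e < mun n (fun x => C - f x).
  apply: mu_lower mf' fC' _ e0; apply: filterS cf => w cf.
  by apply: continuous_forB => //; exact: continuous_for_cst.
near=> n.
have h1 : mean Q (fun w => f (Ybar w)) - e < mun n f by near: n.
have : mean Q (fun w => C - f (Ybar w)) - e < mun n (fun x => C - f x) by near: n.
rewrite meanB; [|exact: bmeas_cst|exact: (bmeas_Y Y mf (itvfun_bounded fC))].
rewrite mean_cst mu_compl//; last first.
  by near: n; exact: (r_oo (nbhs_infty_gt 0)).
by rewrite ltr_norml; lra.
Unshelve. all: by end_near. Qed.

Lemma bmeas_block_csum a rho j (g : l0 R -> R) : supp0 g ->
  measurable_fun setT (g : l0_borel R -> R) -> (exists M, forall x, `|g x| <= M) ->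
  bmeas (fun x : pathT R => csum g (a *: block rho j x)).
Proof.
move=> g0 mg [M gM].
rewrite (_ : (fun _ => _) = fun x : pathT R =>
  \sum_((j.-1 * rho).+1 <= i < (j * rho).+1) g (shift_l0 i%:Z (a *: block rho j x))).
  apply: bmeas_sum => i; split; last by exists M.
  apply: (measurableT_comp mg); apply: (measurableT_comp (measurable_shift_l0 i%:Z)).
  apply: (measurableT_comp (measurable_scale a)).
  exact: (measurable_clip (j.-1 * rho)%N%:Z (j * rho)%N%:Z).
by apply/funext => x; rewrite block_csum.
Qed.

Lemma mean_block_eq a rho j (G : l0 R -> R) : (0 < j)%N -> shift_invariant G ->
  bmeas (fun x : pathT R => G (a *: block rho 1 x)) ->
  mean P (fun w => G (a *: block rho j (path_of X w))) =
  mean P (fun w => G (a *: block rho 1 (path_of X w))).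
Proof.
move=> j0 Ginv bG; rewrite -(stationary_mean X_stationary (j.-1 * rho)%N%:Z bG).
congr (mean P _); apply/funext => w.
rewrite shift_block -shift_l0Z Ginv block1E; congr (G (_ *: clip _ _ _)).
case: j j0 => // j _; by rewrite mulSn PoszD addrK.
Qed.

(** Each exceedance of the block contributes, after a shift, one term of
    [mu]. *)
Lemma mean_block_csum n (g : l0 R -> R) C : supp0 g ->
  measurable_fun setT (g : l0_borel R -> R) -> itvfun C g ->
  mean P (fun w => csum g ((c n)^-1 *: block (r n) 1 (path_of X w))) =
  (r n)%:R * tailp X (c n) * mun n g.
Proof.
move=> g0 mg gC; have bg := itvfun_bounded gC.
have p0 : tailp X (c n) != 0 by rewrite gt_eqF// (tailp_gt0 Y_tail).
have E i : (1 <= i < (r n).+1)%N ->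
   mean P (fun w => g (shift_l0 i%:Z ((c n)^-1 *: block (r n) 1 (path_of X w)))) =
   tailp X (c n) * cmean X (c n)
     (fun x => g ((c n)^-1 *: clip (- i%:Z) ((r n)%:Z - i%:Z) x)).
  move=> ir; rewrite /cmean mulrC divfK//.
  have bF : bmeas (fun x : pathT R => g ((c n)^-1 *: clip (- i%:Z) ((r n)%:Z - i%:Z) x)).
    exact: (bmeas_cwin_path _ _ _ (@measurable_id _ _ _) mg bg).
  transitivity (mean P (fun w =>
      g ((c n)^-1 *: clip (- i%:Z) ((r n)%:Z - i%:Z) (path_of X w)))).
    rewrite -(stationary_mean X_stationary i%:Z bF).
    by congr (mean P _); apply/funext => w; rewrite block1E shift_clip sub0r.
  congr (mean P _); apply/funext => w.
  have [_|h] := ltP (c n) `|X 0 w|; first by rewrite mul1r.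
  rewrite mul0r g0// l0_coordZ clipE; case: ifP => _; last by rewrite mulr0 normr0.
  by rewrite normrM gtr0_norm ?invr_gt0// ler_pdivrMl// mulr1.
rewrite (_ : (fun w => _) = fun w => \sum_(1 <= i < (r n).+1)
    g (shift_l0 i%:Z ((c n)^-1 *: block (r n) 1 (path_of X w)))); last first.
  by apply/funext => w; rewrite block_csum// mul0n mul1n.
rewrite mean_sum => [|i]; last first.
  split; last by have [M gM] := bg; exists M.
  apply: (measurableT_comp mg); apply: (measurableT_comp (measurable_shift_l0 i%:Z)).
  apply: (measurableT_comp (measurable_scale _)).
  exact: (measurableT_comp (measurable_clip _ _) (measurable_path_of X)).
rewrite /mu big_nat (eq_bigr _ E) -big_nat -mulr_sumr.
have [r0|r0] := posnP (r n); first by rewrite r0 big_geq// !mulr0 !mul0r.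
rewrite [(r n)%:R * _]mulrC -mulrA; congr (_ * _).
by rewrite mulrC divfK// pnatr_eq0 -lt0n.
Qed.

Hypothesis nP_oo : n%:R * tailp X (c n) @[n --> \oo] --> +oo.
Hypothesis rP_0 : (r n)%:R * tailp X (c n) @[n --> \oo] --> 0.

(** [r n / n] is the quotient of [r n * p n], which vanishes, by [n * p n], which
    explodes; so the indices outside the full blocks are negligible. *)
Lemma kr_cvg : (n %/ r n)%:R * (r n)%:R / n%:R @[n --> \oo] --> (1 : R).
Proof.
have rn : (r n)%:R / n%:R @[n --> \oo] --> (0 : R).
  apply/cvgrPdist_le => e e0.
  have /cvgrPdist_le/(_ _ e0) H1 := rP_0.
  have /cvgryPge/(_ 1) H2 := nP_oo.
  near=> n; have h1 : `|0 - (r n)%:R * tailp X (c n)| <= e by near: n.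
  have h2 : 1 <= n%:R * tailp X (c n) by near: n.
  have n0 : (0 < n)%N by near: n; exact: nbhs_infty_gt.
  have n0' : 0 < n%:R :> R by rewrite ltr0n.
  move: h1; rewrite !sub0r !normrN ger0_norm ?mulr_ge0 ?tailp_ge0// => h1.
  rewrite ger0_norm ?divr_ge0// ler_pdivrMr//.
  have p0 := tailp_gt0 Y_tail (c n).
  rewrite -(ler_pM2r p0); apply: (le_trans h1).
  by rewrite -mulrA ler_peMr// ltW.
apply/cvgrPdist_le => e e0; have /cvgrPdist_le/(_ _ e0) H1 := rn.
near=> n; have h1 : `|0 - (r n)%:R / n%:R| <= e :> R by near: n.
have n0 : (0 < n)%N by near: n; exact: nbhs_infty_gt.
have r0 : (0 < r n)%N by near: n; exact: (r_oo (nbhs_infty_gt 0)).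
have n0' : 0 < n%:R :> R by rewrite ltr0n.
apply: le_trans h1; rewrite sub0r normrN [leRHS]ger0_norm ?divr_ge0//.
have kr1 : (n %/ r n * r n <= n)%N by rewrite leq_divM.
have kr2 : (n <= n %/ r n * r n + r n)%N by rewrite -mulSnr ltnW// ltn_ceil.
rewrite -natrM ger0_norm; last by rewrite subr_ge0 ler_pdivrMr// mul1r ler_nat.
rewrite lerBlDr -mulrDl ler_pdivlMr// mul1r -natrD ler_nat.
by rewrite addnC.
Unshelve. all: by end_near. Qed.

(** The normalisation is the mean number of exceedances among n observations. *)
Definition clsum n (G : l0 R -> R) w : R := (n%:R * tailp X (c n))^-1 *
  \sum_(1 <= j < (n %/ r n).+1) G ((c n)^-1 *: block (r n) j (path_of X w)).

Lemma bmeas_clsum n G :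
  (forall j, bmeas (fun x : pathT R => G ((c n)^-1 *: block (r n) j x))) ->
  bmeas (clsum n G).
Proof.
by move=> bG; apply: bmeasZ; apply: bmeas_sum => j; exact: (bmeas_path X (bG j)).
Qed.

Lemma mean_clsum n G : shift_invariant G ->
  (forall j, bmeas (fun x : pathT R => G ((c n)^-1 *: block (r n) j x))) ->
  mean P (clsum n G) = (n%:R * tailp X (c n))^-1 * ((n %/ r n)%:R *
    mean P (fun w => G ((c n)^-1 *: block (r n) 1 (path_of X w)))).
Proof.
move=> Ginv bG; have bGX j := bmeas_path X (bG j).
rewrite /clsum meanZ; last exact: bmeas_sum.
congr (_ * _); rewrite mean_sum// big_nat.
rewrite (eq_bigr (fun=> mean P (fun w => G ((c n)^-1 *: block (r n) 1 (path_of X w))))).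
  by rewrite -big_nat big_const_nat subSS subn0 iter_addr_0 -[LHS]mulr_natl.
by move=> j /andP[j0 _]; exact: mean_block_eq.
Qed.

Lemma mean_clsum_csum (g : l0 R -> R) C : supp0 g ->
  measurable_fun setT (g : l0_borel R -> R) -> itvfun C g ->
  {ae Q, forall w, {for Ybar w, continuous g}} ->
  mean P (clsum n (csum g)) @[n --> \oo] --> mean Q (fun w => g (Ybar w)).
Proof.
move=> g0 mg gC cg.
rewrite -[X in _ --> X]mul1r.
have H : (n %/ r n)%:R * (r n)%:R / n%:R * mun n g @[n --> \oo]
    --> 1 * mean Q (fun w => g (Ybar w)).
  by apply: cvgM; [exact: kr_cvg|exact: (mu_cvg mg gC cg)].
apply: cvg_trans H; apply: near_eq_cvg; near=> n.
have p0 : tailp X (c n) != 0 by rewrite gt_eqF// (tailp_gt0 Y_tail).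
rewrite mean_clsum; last 2 first.
- by move=> x k; exact: csum_shift.
- by move=> j; exact: (bmeas_block_csum _ _ _ g0 mg (itvfun_bounded gC)).
rewrite (mean_block_csum _ g0 mg gC) /=.
rewrite invfM; set p := tailp X _ in p0 *; set m := mun n g.
rewrite [RHS](_ : _ = (p^-1 * p) * ((n %/ r n)%:R * (r n)%:R / n%:R * m)); last by ring.
by rewrite mulVf// mul1r.
Unshelve. all: by end_near. Qed.

End cluster_sums.

(** * Law of large numbers for clusters *)

Section exponential_bounds.
Context {R : realType}.

Lemma expRN_le_quad (z : R) : 0 <= z -> expR (- z) <= 1 - z + z ^+ 2.
Proof.
move=> z0; rewrite expRN; have h : 0 < 1 + z by rewrite ltr_wpDr.
apply: (@le_trans _ _ (1 + z)^-1).
  by rewrite lef_pV2 ?posrE ?expR_gt0// expR_ge1Dx.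
rewrite -[leLHS]mul1r ler_pdivrMr// (_ : _ * _ = 1 + z ^+ 3); last by ring.
by rewrite lerDl exprn_ge0.
Qed.

Lemma one_sub_ge_exp (t : R) : t < 1 -> expR (- (t / (1 - t))) <= 1 - t.
Proof.
move=> t1; have h : 0 < 1 - t by rewrite subr_gt0.
rewrite expRN -[leRHS]invrK lef_pV2 ?posrE ?invr_gt0 ?expR_gt0//.
rewrite [leLHS](_ : _ = 1 + t / (1 - t)); first exact: expR_ge1Dx.
by field; rewrite gt_eqF.
Qed.

(** Sandwich [1 - t] between exp(- t / (1 - t)) and exp(- t). *)
Lemma one_sub_pow_cvg (k : nat -> nat) (t : nat -> R) (nu : R) :
  (forall n, 0 <= t n) -> t n @[n --> \oo] --> 0 ->
  (k n)%:R * t n @[n --> \oo] --> nu ->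
  (1 - t n) ^+ (k n) @[n --> \oo] --> expR (- nu).
Proof.
move=> t0 tn ktn.
have cexp : continuous (fun x : R => expR (- x)).
  by move=> x; apply: continuous_comp; [exact: opp_continuous|exact: continuous_expR].
have lower : expR (- ((k n)%:R * t n * (1 - t n)^-1)) @[n --> \oo] --> expR (- nu).
  have H : (k n)%:R * t n * (1 - t n)^-1 @[n --> \oo] --> nu * (1 - 0)^-1.
    apply: cvgM => //; apply: cvgV; first by rewrite subr0 oner_neq0.
    by apply: cvgB => //; exact: cvg_cst.
  rewrite subr0 invr1 mulr1 in H.
  exact: (cvg_comp _ _ H (cexp nu)).
have upper : expR (- ((k n)%:R * t n)) @[n --> \oo] --> expR (- nu).
  exact: (cvg_comp _ _ ktn (cexp nu)).
apply: (squeeze_cvgr _ lower upper).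
have /cvgrPdist_lt/(_ _ ltr01) t1 := tn.
near=> n; have h1 : t n < 1.
  have : `|0 - t n| < 1 by near: n.
  by rewrite sub0r normrN ger0_norm.
have h2 : 0 <= 1 - t n by rewrite subr_ge0 ltW.
rewrite -!mulrN -mulrA !expRM_natl; apply/andP; split.
  by rewrite lerXn2r ?nnegrE ?expR_ge0// mulrN one_sub_ge_exp.
by rewrite lerXn2r ?nnegrE ?expR_ge0//; have := expR_ge1Dx (- t n).
Unshelve. all: by end_near. Qed.

(** |s - nu| is s - nu plus twice the positive part of nu - s, and the latter is
    controlled by exp(-s) because it is bounded: convergence of means and of
    exp(-S) in mean gives convergence of S in mean. *)
Lemma dist_le_exp (s nu : R) :
  `|s - nu| <= 2 * expR nu * `|expR (- s) - expR (- nu)| + (s - nu).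
Proof.
have [h|h] := leP nu s.
  by rewrite ger0_norm ?subr_ge0// lerDr !mulr_ge0// expR_ge0.
rewrite ltr0_norm ?subr_lt0// ger0_norm; last first.
  by rewrite subr_ge0 ler_expR lerN2 ltW.
rewrite -mulrA mulrBr -!expRD subrr expR0.
have := expR_ge1Dx (nu - s); lra.
Qed.

Lemma norm_le_sq (z e : R) : 0 < e -> `|z| <= e + e^-1 * z ^+ 2.
Proof.
move=> e0; have [h|h] := leP `|z| e.
  by rewrite (le_trans h)// lerDl mulr_ge0 ?sqr_ge0// invr_ge0 ltW.
rewrite ler_wpDl ?(ltW e0)// -real_normK ?num_real// expr2 mulrA.
by rewrite ler_peMl// mulrC ler_pdivlMr// mul1r ltW.
Qed.

End exponential_bounds.

Section law_of_large_numbers.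
Context {R : realType} d (T : measurableType d) (P : probability T R).
Variable X : int -> {RV P >-> R}.
Context d' (T' : measurableType d') (Q : probability T' R).
Variable Y : int -> {RV Q >-> R}.
Hypothesis X_stationary : stationary X.
Hypothesis Y_tail : tail_process X Y.
Variables (c : nat -> R) (r : nat -> nat).
Hypothesis c_gt0 : forall n, 0 < c n.
Hypothesis c_oo : c n @[n --> \oo] --> +oo.
Hypothesis r_oo : r n @[n --> \oo] --> \oo.
Hypothesis nP_oo : n%:R * tailp X (c n) @[n --> \oo] --> +oo.
Hypothesis rP_0 : (r n)%:R * tailp X (c n) @[n --> \oo] --> 0.
Hypothesis anticlustering : anticlustering_condition X c r.
Hypothesis mixing : mixing_condition X c r.

Local Notation Ybar w := (to_l0 (path_of Y w)).
Local Notation Sn := (clsum X c r).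

Let mean_Sn_csum := mean_clsum_csum X_stationary Y_tail c_gt0 c_oo r_oo
  anticlustering nP_oo rP_0.

(** So almost surely the set of exceedances does not change near [Y]. *)
Lemma Y_nounit : {ae Q, forall w, no_unit (Ybar w)}.
Proof.
have H : {ae Q, forall w, forall i, `|Y i w| <> 1}.
  suff : Q.-negligible (\bigcup_(k in [set: nat])
     (if @choice.unpickle int k is Some i then [set w | `|Y i w| = 1] else set0)).
    apply: negligibleS => w /= /existsNP[i /contrapT Yi].
    by exists (choice.pickle i) => //; rewrite choice.pickleK.
  apply: negligible_bigcup => k; case: choice.unpickle => [i|]; last exact: negligible_set0.
  apply/negligibleP; last exact: (Y_no_unit X_stationary Y_tail).
  rewrite (_ : [set _ | _] = setT `&` (fun w => `|Y i w|) @^-1` [set 1]).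
    have : measurable_fun setT (fun w => `|Y i w|) by apply: measurableT_comp.
    by apply.
  by rewrite setTI.
move: H (Y_vanishing Y_tail c_gt0 c_oo r_oo anticlustering).
apply: filterS2 => w Yw vY i.
by rewrite to_l0K; [exact: Yw|exact: vY].
Qed.

Lemma share_itv C (h : l0 R -> R) : itvfun C h -> itvfun C (fun x => peak0 x * (h x / nexc x)).
Proof.
move=> hC x; have /andP[h0 hC'] := hC x.
have C0 : 0 <= C by exact: le_trans hC'.
rewrite mulr_ge0 ?peak0_ge0 ?divr_ge0 ?nexc_ge0//=.
rewrite /peak0; case: ltP => [x1|_]; last by rewrite mul0r.
rewrite mul1r (le_trans _ hC')// ler_piMr// invf_le1 ?(lt_le_trans ltr01)//;
  exact: nexc_ge1 x1.
Qed.

Lemma measurable_share (h : l0 R -> R) : measurable_fun setT (h : l0_borel R -> R) ->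
  measurable_fun setT ((fun x => peak0 x * (h x / nexc x)) : l0_borel R -> R).
Proof.
move=> mh; apply: measurable_funM; first exact: measurable_peak0.
by apply: measurable_funM => //; exact: measurable_inv_nexc.
Qed.

(** The limit measure of clusters, on shift-invariant functions: each cluster is
    counted at every exceedance, with weight one over their number. *)
Definition nu (h : l0 R -> R) : R :=
  mean Q (fun w => peak0 (Ybar w) * (h (Ybar w) / nexc (Ybar w))).

Lemma mean_clsum_share (h : l0 R -> R) C : shift_invariant h ->
  measurable_fun setT (h : l0_borel R -> R) ->
  itvfun C (fun x => peak0 x * (h x / nexc x)) ->
  (forall y : l0 R, (forall i, `|y i| <= 1) -> h y = 0) ->
  {ae Q, forall w, {for Ybar w, continuous h}} ->
  mean P (Sn n h) @[n --> \oo] --> nu h.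
Proof.
move=> hinv mh hC h0 ch.
have := @mean_Sn_csum (fun x => peak0 x * (h x / nexc x)) C _ (measurable_share mh) hC.
rewrite (_ : csum _ = h); last by apply/funext => x; exact: csum_share.
apply; first by move=> x x1; rewrite /peak0 ltNge x1 mul0r.
move: Y_nounit ch; apply: filterS2 => w Y1 chw.
by apply: continuous_peak => //; exact: continuous_share.
Qed.

(** Test functions to which the mixing condition applies; they live on the
    clusters with an exceedance of level 1. *)
Record test_function (h : l0 R -> R) (C L : R) : Prop := TestFunction {
  test_itv : itvfun C h;
  test_inv : shift_invariant h;
  test_lip : forall x y : l0 R, `|h x - h y| <= L * `|x - y|;
  test_supp : forall y : l0 R, (forall i, `|y i| <= 1) -> h y = 0 }.

Lemma test_continuous h C L : test_function h C L -> continuous h.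
Proof.
move=> [_ _ hL _] x; apply/l0_cvgP => e e0; exists (e / (`|L| + 1)).
  by rewrite divr_gt0// ltr_wpDl.
move=> y; rewrite ltr_pdivlMr ?ltr_wpDl// => h1.
apply: le_lt_trans (hL _ _) _; apply: le_lt_trans h1.
by rewrite mulrC ler_wpM2l// (le_trans (ler_norm _))// lerDl.
Qed.

Lemma bmeas_test_block h C L a rho j : test_function h C L ->
  bmeas (fun x : pathT R => h (a *: block rho j x)).
Proof.
move=> th; have mh := continuous_measurable_l0 (test_continuous th).
exact: (bmeas_cwin_path a _ _ (@measurable_id _ _ setT) mh (itvfun_bounded (test_itv th))).
Qed.

Lemma bmeas_expN d0 (T0 : measurableType d0) (f : T0 -> R) :
  measurable_fun setT f -> (forall w, 0 <= f w) -> bmeas (fun w => expR (- f w)).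
Proof.
move=> mf f0; apply: (@bmeas_itv _ _ _ _ 0 1) => [|w].
  by apply: measurable_fun_expR; exact: measurableT_comp.
by rewrite expR_ge0 -expR0 ler_expR oppr_le0 f0.
Qed.

Lemma clsum_ge0 n h w : (forall x, 0 <= h x) -> 0 <= Sn n h w.
Proof.
by move=> h0; rewrite mulr_ge0 ?invr_ge0 ?mulr_ge0 ?tailp_ge0// sumr_ge0.
Qed.

(** By mixing the Laplace transform is close to the power [k] of [1 - t], where
    [t] is the mean of [1 - exp(- a H)], [a] vanishes and [H] is bounded. Hence [t]
    is equivalent to [a] times the mean of [H], and [k * t] has the limit of the
    mean of [clsum], which is [nu h]. *)
Lemma exp_clsum_cvg h C L : test_function h C L ->
  mean P (fun w => expR (- Sn n h w)) @[n --> \oo] --> expR (- nu h).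
Proof.
move=> th; have [hC hinv hL hsupp] := th.
have h0 x : 0 <= h x by have /andP[] := hC x.
have C0 : 0 <= C by have /andP[] := hC 0; exact: le_trans.
have ch := test_continuous th.
have mh := continuous_measurable_l0 ch.
have bh n j : bmeas (fun x : pathT R => h ((c n)^-1 *: block (r n) j x)).
  exact: bmeas_test_block th.
pose a n := (n%:R * tailp X (c n))^-1.
have a0 n : 0 <= a n by rewrite invr_ge0 mulr_ge0 ?tailp_ge0.
pose H n w := h ((c n)^-1 *: block (r n) 1 (path_of X w)).
have bH n : bmeas (H n) by exact: (bmeas_path X (bh n 1%N)).
have H0 n w : 0 <= H n w by exact: h0.
have HC n w : H n w <= C by have /andP[] := hC ((c n)^-1 *: block (r n) 1 (path_of X w)).
pose t n := 1 - mean P (fun w => expR (- (a n * H n w))).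
have an0 : a n @[n --> \oo] --> 0.
  apply/cvgrPdist_le => e e0; have /cvgryPge/(_ e^-1) H1 := nP_oo.
  near=> n; rewrite sub0r normrN ger0_norm// -[leRHS]invrK.
  have h1 : e^-1 <= n%:R * tailp X (c n) by near: n.
  by rewrite lef_pV2 ?posrE ?invr_gt0// (lt_le_trans _ h1)// invr_gt0.
have be n : bmeas (fun w => expR (- (a n * H n w))).
  apply: bmeas_expN; last by move=> w; rewrite mulr_ge0.
  by have [] := bmeasZ (a n) (bH n).
have t_le n : t n <= a n * mean P (H n).
  rewrite /t lerBlDl -lerBlDr -(mean_cst P 1) -meanZ// -meanB; [|exact: bmeas_cst|exact: bmeasZ].
  apply: mean_le => //; first by apply: bmeasB; [exact: bmeas_cst|exact: bmeasZ].
  by move=> w; have := expR_ge1Dx (- (a n * H n w)).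
have t_ge n : a n * mean P (H n) * (1 - a n * C) <= t n.
  rewrite mulrAC -meanZ// /t lerBrDr -lerBrDl -{1}(mean_cst P 1) -meanB; [|exact: bmeas_cst|exact: bmeasZ].
  apply: mean_le => //; first by apply: bmeasB; [exact: bmeas_cst|exact: bmeasZ].
  move=> w; apply: (le_trans (expRN_le_quad _)); first by rewrite mulr_ge0.
  have : a n * H n w * (a n * H n w) <= a n * H n w * (a n * C).
    by rewrite ler_wpM2l ?mulr_ge0// ler_wpM2l.
  by rewrite expr2; lra.
have t0 n : 0 <= t n.
  rewrite subr_ge0 -[leRHS](mean_cst P 1); apply: mean_le => //; first exact: bmeas_cst.
  by move=> w; rewrite -expR0 ler_expR oppr_le0 mulr_ge0.
have mH n : mean P (H n) <= C.
  by rewrite -[leRHS](mean_cst P C); apply: mean_le => //; exact: bmeas_cst.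
have aC0 : a n * C @[n --> \oo] --> 0.
  by rewrite -[X in _ --> X](mul0r C); apply: cvgM => //; exact: cvg_cst.
have tn0 : t n @[n --> \oo] --> 0.
  apply: (squeeze_cvgr _ (cvg_cst 0) aC0); apply: nearW => n.
  by rewrite t0 (le_trans (t_le n))// ler_wpM2l.
have clE : (n %/ r n)%:R * (a n * mean P (H n)) @[n --> \oo] --> nu h.
  have := mean_clsum_share hinv mh (share_itv hC) hsupp (aeW _ (fun w => ch _)).
  rewrite (_ : (fun n => mean P (Sn n h)) = fun n => (n %/ r n)%:R * (a n * mean P (H n)))//.
  by apply/funext => n; rewrite (mean_clsum X_stationary)// mulrCA.
have ktn : (n %/ r n)%:R * t n @[n --> \oo] --> nu h.
  have low : (n %/ r n)%:R * (a n * mean P (H n)) * (1 - a n * C) @[n --> \oo] --> nu h * (1 - 0).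
    by apply: cvgM => //; apply: cvgB => //; exact: cvg_cst.
  rewrite subr0 mulr1 in low.
  apply: (squeeze_cvgr _ low clE); apply: nearW => n.
  by rewrite -mulrA !ler_wpM2l ?ler0n.
have pow := one_sub_pow_cvg t0 tn0 ktn.
have hlip : lipschitz (h : l0 R -> R^o).
  exists (`|L| + 1); split; first exact: num_real.
  move=> M LM [x y] _ /=; apply: (le_trans (hL x y)); rewrite ler_wpM2r//.
  apply: (le_trans (ler_norm _)); apply: ltW; apply: le_lt_trans LM.
  by rewrite lerDl.
have hclosed : exists2 e : R, 0 < e & closure [set x | h x != 0] `<=` [set x | e < `|x|].
  (* The closure can only reach norm 1, so any level below 1 will do. *)
  exists 2^-1; first by rewrite invr_gt0.
  move=> x cx /=.
  have [|y [/= hy xy]] := cx [set y | `|x - y| < 2^-1].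
    by apply/l0_nbhsP; exists 2^-1 => //; rewrite invr_gt0.
  have [i yi] : exists i, 1 < `|y i|.
    apply: contrapT => /forallNP ny; move/eqP: hy; apply; apply: hsupp => i.
    by rewrite leNgt; exact/negP.
  have h1 := le_coord_norm y i.
  have h2 : `|y| <= `|x| + `|x - y|.
    by rewrite -[y in leLHS](subKr x) (le_trans (ler_normB _ _)).
  lra.
pose u n := mean P (fun w => expR (- Sn n h w)).
have mix : u n - (1 - t n) ^+ (n %/ r n) @[n --> \oo] --> 0.
  under eq_fun do rewrite /t subKr.
  exact: (mixing h0 (ex_intro _ C (fun x => proj2 (andP (hC x)))) hinv hlip hclosed).
rewrite (_ : (fun n => mean P _) = fun n => u n - (1 - t n) ^+ (n %/ r n) +
  (1 - t n) ^+ (n %/ r n)); last by apply/funext => n; rewrite subrK.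
by rewrite -[X in _ --> X]add0r; exact: cvgD.
Unshelve. all: by end_near. Qed.

Lemma test2 h C L : test_function h C L ->
  test_function (fun x => 2 * h x) (2 * C) (2 * L).
Proof.
move=> [hC hinv hL hs]; split.
- by move=> x; have /andP[h1 h2] := hC x; rewrite mulr_ge0//= ler_pM2l.
- by move=> x k; rewrite hinv.
- by move=> x y; rewrite -mulrBr normrM gtr0_norm// -mulrA ler_pM2l.
- by move=> y /hs ->; rewrite mulr0.
Qed.

(** Convergence of the Laplace transforms at 1 and 2 makes the variance of
    exp(-S) vanish; with convergence of the means this gives convergence in
    mean. *)
Lemma test_L1_cvg h C L : test_function h C L ->
  mean P (fun w => `|Sn n h w - nu h|) @[n --> \oo] --> 0.
Proof.
move=> th; have [hC hinv hL hsupp] := th.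
have h0 x : 0 <= h x by have /andP[] := hC x.
have ch := test_continuous th.
have mh := continuous_measurable_l0 ch.
have bh n j : bmeas (fun x : pathT R => h ((c n)^-1 *: block (r n) j x)).
  exact: bmeas_test_block th.
have bS n : bmeas (Sn n h) by exact: bmeas_clsum.
have S0 n w : 0 <= Sn n h w by exact: clsum_ge0.
have be n : bmeas (fun w => expR (- Sn n h w)).
  by apply: bmeas_expN => //; case: (bS n).
have H1 := exp_clsum_cvg th.
have H2 := exp_clsum_cvg (test2 th).
have HS : mean P (Sn n h) @[n --> \oo] --> nu h.
  exact: (mean_clsum_share hinv mh (share_itv hC) hsupp (aeW _ (fun w => ch _))).
set v := nu h in H1 HS *.
have nu2 : nu (fun x => 2 * h x) = 2 * v.
  rewrite /v /nu -meanZ; last first.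
    exact: (bmeas_Y Y (measurable_share mh) (itvfun_bounded (share_itv hC))).
  by congr (mean Q _); apply/funext => w; rewrite -mulrA mulrCA.
rewrite nu2 in H2.
have sq : mean P (fun w => (expR (- Sn n h w) - expR (- v)) ^+ 2) @[n --> \oo] --> 0.
  have E n : mean P (fun w => (expR (- Sn n h w) - expR (- v)) ^+ 2) =
    mean P (fun w => expR (- Sn n (fun x => 2 * h x) w))
    - 2 * expR (- v) * mean P (fun w => expR (- Sn n h w)) + expR (- v) ^+ 2.
    rewrite -meanZ// -[X in _ + X](mean_cst P) -meanB; last 2 first.
    - rewrite (_ : (fun w => _) = fun w => expR (- Sn n h w) * expR (- Sn n h w)).
        exact: bmeasM.
      apply/funext => w; rewrite -expRD -opprD /clsum -mulr_sumr mulrCA mulr2n.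
      by rewrite mulrDl mul1r.
    - exact: bmeasZ.
    rewrite -meanD; last 2 first.
    - apply: bmeasB; last exact: bmeasZ.
      rewrite (_ : (fun w => _) = fun w => expR (- Sn n h w) * expR (- Sn n h w)).
        exact: bmeasM.
      apply/funext => w; rewrite -expRD -opprD /clsum -mulr_sumr mulrCA mulr2n.
      by rewrite mulrDl mul1r.
    - exact: bmeas_cst.
    congr (mean P _); apply/funext => w.
    rewrite (_ : expR (- Sn n (fun x => 2 * h x) w) =
      expR (- Sn n h w) * expR (- Sn n h w)); first by ring.
    rewrite -expRD -opprD /clsum -mulr_sumr mulrCA mulr2n.
    by rewrite mulrDl mul1r.
  under eq_fun do rewrite E.
  have L0 : expR (- (2 * v)) - 2 * expR (- v) * expR (- v) + expR (- v) ^+ 2 = 0.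
    rewrite (_ : - (2 * v) = - v + - v); last by ring.
    by rewrite expRD; ring.
  rewrite -L0; apply: cvgD; last exact: cvg_cst.
  apply: cvgB => //; apply: cvgM => //; exact: cvg_cst.
apply/cvgrPdist_le => e e0.
pose A := 2 * expR v.
have A0 : 0 < A by rewrite mulr_gt0 ?expR_gt0.
pose dl := e / 3 / A.
have dl0 : 0 < dl by rewrite !divr_gt0.
have dl2 : 0 < dl * dl by rewrite mulr_gt0.
have /cvgrPdist_le/(_ _ dl2) Hsq := sq.
have e3 : 0 < e / 3 by rewrite divr_gt0.
have /cvgrPdist_le/(_ _ e3) HS' := HS.
near=> n.
have h1 : `|0 - mean P (fun w => (expR (- Sn n h w) - expR (- v)) ^+ 2)| <= dl * dl by near: n.
have h2 : `|v - mean P (Sn n h)| <= e / 3 by near: n.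
rewrite sub0r normrN ger0_norm; last by apply: mean_ge0.
have bz : bmeas (fun w => expR (- Sn n h w) - expR (- v)).
  by apply: bmeasB => //; exact: bmeas_cst.
have bz2 : bmeas (fun w => (expR (- Sn n h w) - expR (- v)) ^+ 2).
  by under eq_fun do rewrite expr2; exact: bmeasM.
have bSv : bmeas (fun w => Sn n h w - v) by apply: bmeasB => //; exact: bmeas_cst.
apply: (@le_trans _ _ (mean P (fun w => A * (dl + dl^-1 *
    (expR (- Sn n h w) - expR (- v)) ^+ 2) + (Sn n h w - v)))).
  apply: mean_le.
  - exact: bmeas_norm.
  - apply: bmeasD => //; apply: bmeasZ; apply: bmeasD; [exact: bmeas_cst|exact: bmeasZ].
  move=> w; apply: (le_trans (dist_le_exp _ _)); rewrite lerD2r ler_pM2l//.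
  exact: norm_le_sq.
rewrite meanD//; last by apply: bmeasZ; apply: bmeasD; [exact: bmeas_cst|exact: bmeasZ].
rewrite meanB//; last exact: bmeas_cst.
rewrite meanZ; last by apply: bmeasD; [exact: bmeas_cst|exact: bmeasZ].
rewrite meanD; [|exact: bmeas_cst|exact: bmeasZ].
rewrite [mean P (fun w => dl^-1 * _)]meanZ// !mean_cst.
have h3 : dl^-1 * mean P (fun w => (expR (- Sn n h w) - expR (- v)) ^+ 2) <= dl.
  rewrite ler_pdivrMl//; apply: le_trans h1.
  by rewrite sub0r normrN ler_norm.
have h4 : A * dl = e / 3 by rewrite /dl mulrC divfK// gt_eqF.
have h5 : A * (dl + dl^-1 * mean P (fun w => (expR (- Sn n h w) - expR (- v)) ^+ 2))
    <= e / 3 + e / 3.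
  by rewrite -h4 -mulrDr ler_pM2l// lerD2l.
by move: h2; rewrite ler_norml; lra.
Unshelve. all: by end_near. Qed.

(** Law of large numbers in mean. The cluster sum G of g is unbounded and
    discontinuous, but its envelopes are test functions. They lie below G, so the
    mean distance between their normalised sums and those of G is a difference
    of means, and these are known: the mean for G is computed with g itself and
    again with G shared out equally among the exceedances, which identifies the
    limit with nu(G); and nu of the envelopes increases to nu(G) because G is
    continuous at almost every path of [Y]. *)
Lemma clsum_L1_cvg (g : l0 R -> R) C : supp0 g ->
  measurable_fun setT (g : l0_borel R -> R) -> itvfun C g ->
  {ae Q, forall w, forall i, {for shift_l0 i (Ybar w), continuous g}} ->
  mean P (fun w => `|Sn n (csum g) w - mean Q (fun w => g (Ybar w))|)
    @[n --> \oo] --> 0.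
Proof.
move=> g0 mg gC cg.
have gp x : 0 <= g x by have /andP[] := gC x.
have C0 : 0 <= C by have /andP[] := gC 0; exact: le_trans.
set G := csum g.
have Gp x : 0 <= G x by exact: csum_ge0.
have Ginv : shift_invariant G by move=> x k; exact: csum_shift.
have mG : measurable_fun setT (G : l0_borel R -> R) by exact: measurable_csum.
have Gsupp (y : l0 R) : (forall i, `|y i| <= 1) -> G y = 0.
  move=> y1; rewrite /G (@csum_seq _ _ _ [::])// ?big_nil// => i.
  by rewrite ltNge y1.
have cG : {ae Q, forall w, {for Ybar w, continuous G}}.
  by move: Y_nounit cg; apply: filterS2 => w Y1 cgw; exact: continuous_csum.
have cg0 : {ae Q, forall w, {for Ybar w, continuous g}}.
  by move: cg; apply: filterS => w /(_ 0); rewrite shift_l0_0.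
have GN x : peak0 x * (G x / nexc x) <= C.
  have := csum_le x (fun y => proj2 (andP (gC y))); rewrite -/(G x) => h.
  rewrite /peak0; case: ltP => [x1|_]; last by rewrite mul0r.
  have n1 := nexc_ge1 x1.
  by rewrite mul1r ler_pdivrMr ?(lt_le_trans ltr01)// mulrC.
have GNp x : 0 <= peak0 x * (G x / nexc x).
  by rewrite mulr_ge0 ?peak0_ge0 ?divr_ge0 ?nexc_ge0.
have GC : itvfun C (fun x => peak0 x * (G x / nexc x)).
  by move=> x; rewrite GNp GN.
have bG n j : bmeas (fun x : pathT R => G ((c n)^-1 *: block (r n) j x)).
  exact: (bmeas_block_csum _ _ _ g0 mg (itvfun_bounded gC)).
have bSG n : bmeas (Sn n G) by exact: bmeas_clsum.
have M1 : mean P (Sn n G) @[n --> \oo] --> mean Q (fun w => g (Ybar w)).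
  exact: mean_Sn_csum.
have M2 : mean P (Sn n G) @[n --> \oo] --> nu G.
  exact: (mean_clsum_share Ginv mG GC Gsupp cG).
have EG : mean Q (fun w => g (Ybar w)) = nu G by exact: (cvg_unique _ M1 M2).
rewrite EG in M1 *; clear M2.
pose h k := env k G.
have tf k : test_function (h k) k%:R k%:R.
  split.
  - by move=> x; rewrite env_ge0//= env_le_nat.
  - by move=> x i; exact: env_shift.
  - by move=> x y; exact: env_lip.
  - move=> y /Gsupp Gy; apply/eqP; rewrite eq_le env_ge0// andbT -Gy.
    exact: env_le.
have hG k x : h k x <= G x by exact: env_le.
have hp k x : 0 <= h k x by exact: env_ge0.
have bh k n j : bmeas (fun x : pathT R => h k ((c n)^-1 *: block (r n) j x)).
  exact: bmeas_test_block (tf k).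
have bSh k n : bmeas (Sn n (h k)) by exact: bmeas_clsum.
have Mh k : mean P (Sn n (h k)) @[n --> \oo] --> nu (h k).
  have ch := test_continuous (tf k).
  apply: (mean_clsum_share (test_inv (tf k)) (continuous_measurable_l0 ch)
    (share_itv (test_itv (tf k))) (test_supp (tf k))).
  by apply: aeW => w; exact: ch.
have nuh : nu (h k) @[k --> \oo] --> nu G.
  apply: (@mean_dct _ _ _ _ _ _ C).
  - move=> k; have ch := test_continuous (tf k).
    by have [] := bmeas_Y Y (measurable_share (continuous_measurable_l0 ch))
      (itvfun_bounded (share_itv (test_itv (tf k)))).
  - by have [] := bmeas_Y Y (measurable_share mG) (itvfun_bounded GC).
  - move=> k w; rewrite ger0_norm; last first.
      by rewrite mulr_ge0 ?peak0_ge0 ?divr_ge0 ?nexc_ge0.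
    apply: le_trans (GN (Ybar w)).
    by rewrite ler_wpM2l ?peak0_ge0// ler_wpM2r ?invr_ge0 ?nexc_ge0.
  apply: filterS cG => w cGw.
  apply: cvgM; first exact: cvg_cst.
  apply: cvgM; last exact: cvg_cst.
  exact: env_cvg.
apply/cvgrPdist_le => e e0.
have e5 : 0 < e / 5 by rewrite divr_gt0.
have /cvgrPdist_le/(_ _ e5)/filter_ex[k Hk] := nuh.
have /cvgrPdist_le/(_ _ e5) H1 := M1.
have /cvgrPdist_le/(_ _ e5) H2 := Mh k.
have /cvgrPdist_le/(_ _ e5) H3 := test_L1_cvg (tf k).
near=> n.
have h1 : `|nu G - mean P (Sn n G)| <= e / 5 by near: n.
have h2 : `|nu (h k) - mean P (Sn n (h k))| <= e / 5 by near: n.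
have h3 : `|0 - mean P (fun w => `|Sn n (h k) w - nu (h k)|)| <= e / 5 by near: n.
rewrite sub0r normrN ger0_norm; last by apply: mean_ge0.
have b1 : bmeas (fun w => `|Sn n (h k) w - nu (h k)|).
  by apply: bmeas_norm; apply: bmeasB => //; exact: bmeas_cst.
have b2 : bmeas (fun w => Sn n G w - Sn n (h k) w) by exact: bmeasB.
apply: (@le_trans _ _ (mean P (fun w => Sn n G w - Sn n (h k) w +
    (`|Sn n (h k) w - nu (h k)| + `|nu (h k) - nu G|)))).
  apply: mean_le.
  - by apply: bmeas_norm; apply: bmeasB => //; exact: bmeas_cst.
  - by apply: bmeasD => //; apply: bmeasD => //; exact: bmeas_cst.
  move=> w.
  have sh : Sn n (h k) w <= Sn n G w.
    rewrite ler_wpM2l ?invr_ge0 ?mulr_ge0 ?tailp_ge0//.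
    by apply: ler_sum => j _; exact: hG.
  rewrite -[Sn n G w - Sn n (h k) w]ger0_norm ?subr_ge0//.
  rewrite (_ : Sn n G w - nu G = (Sn n G w - Sn n (h k) w) +
    ((Sn n (h k) w - nu (h k)) + (nu (h k) - nu G))); last by ring.
  apply: (le_trans (ler_normD _ _)); rewrite lerD2l; exact: ler_normD.
rewrite meanD//; last by apply: bmeasD => //; exact: bmeas_cst.
rewrite meanB// meanD//; last exact: bmeas_cst.
rewrite mean_cst.
move: h3; rewrite sub0r normrN ger0_norm; last by apply: mean_ge0.
have Hk' : `|nu (h k) - nu G| <= e / 5 by rewrite distrC.
move: Hk h1 h2; rewrite !ler_norml => /andP[? ?] /andP[? ?] /andP[? ?] h3.
move: Hk' h3; lra.
Unshelve. all: by end_near. Qed.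

End law_of_large_numbers.

(** * Uniform selection from random index sets *)

Section mean_limits.
Context {R : realType} d (T : measurableType d) (P : probability T R).

Lemma L1_limit_unique (S : nat -> T -> R) (a b : R) : (forall n, bmeas (S n)) ->
  mean P (fun w => `|S n w - a|) @[n --> \oo] --> 0 ->
  mean P (fun w => `|S n w - b|) @[n --> \oo] --> 0 -> a = b.
Proof.
move=> bS Sa Sb; apply/eqP; rewrite -subr_eq0 -normr_le0.
have H : mean P (fun w => `|S n w - a|) + mean P (fun w => `|S n w - b|) @[n --> \oo] --> 0 + 0.
  exact: cvgD.
rewrite addr0 in H; apply: (cvgr_to_ge H); apply: nearW => n.
have b0 c : bmeas (fun w => `|S n w - c|).
  by apply: bmeas_norm; apply: bmeasB => //; exact: bmeas_cst.
rewrite -meanD// -[leLHS](mean_cst P); apply: mean_le; [exact: bmeas_cst|exact: bmeasD|].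
move=> w; rewrite [X in _ <= X + _]distrC.
by rewrite (le_trans _ (ler_normD _ _))// addrA subrK.
Qed.

(** Markov's inequality turns convergence in mean into the three forms that are
    used. *)
Lemma counting_cvg (sz : nat -> T -> nat) (v : nat -> R) (th : R) : 0 < th ->
  v n @[n --> \oo] --> +oo ->
  (forall n, bmeas (fun w => (sz n w)%:R / v n)) ->
  mean P (fun w => `|(sz n w)%:R / v n - th|) @[n --> \oo] --> 0 ->
  [/\ cvg_in_prob P (fun n w => (sz n w)%:R / (th * v n)) 1,
      cvg_in_prob_pinfty P (fun n w => (sz n w)%:R) &
      prob P [set w | sz n w = 0%N] @[n --> \oo] --> (0 : R)].
Proof.
move=> th0 voo bW W1.
have bWd n : bmeas (fun w => `|(sz n w)%:R / v n - th|).
  by apply: bmeas_norm; apply: bmeasB => //; exact: bmeas_cst.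
have mW n : measurable_fun setT (fun w => (sz n w)%:R / v n) by case: (bW n).
have markov n e : 0 < e -> prob P [set w | e < `|(sz n w)%:R / v n - th|] <=
    mean P (fun w => `|(sz n w)%:R / v n - th|) / e.
  move=> e0; apply: markov_mean => //; last by move=> w /ltW.
  by apply: measurable_gt_set; case: (bWd n).
have pth e : 0 < e ->
    prob P [set w | e < `|(sz n w)%:R / v n - th|] @[n --> \oo] --> (0 : R).
  move=> e0.
  have up : mean P (fun w => `|(sz n w)%:R / v n - th|) / e @[n --> \oo] --> 0.
    by rewrite -[X in _ --> X](mul0r e^-1); apply: cvgM => //; exact: cvg_cst.
  apply: (squeeze_cvgr _ (cvg_cst 0) up); apply: nearW => n.
  by rewrite prob_ge0 markov.
have th2 : 0 < th / 2 by rewrite divr_gt0.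
have lowlim : 1 - prob P [set w | th / 2 < `|(sz n w)%:R / v n - th|] @[n --> \oo] --> (1 : R).
  by rewrite -[X in _ --> X]subr0; apply: cvgB; [exact: cvg_cst|exact: pth].
split.
- move=> e e0; have := pth (e * th) (mulr_gt0 e0 th0).
  rewrite (_ : (fun n => prob P [set w | e * th < _]) =
    fun n => prob P [set w | e < `|(sz n w)%:R / (th * v n) - 1|])//.
  apply/funext => n; congr (prob P _); apply/funext => w /=; congr (is_true _).
  rewrite -ltr_pdivlMr//; congr (_ < _).
  rewrite -{2}(gtr0_norm th0) -normfV -normrM; congr `|_|.
  by rewrite mulrBl divff ?gt_eqF// invfM mulrA mulrAC.
- move=> M; have c1 : (fun _ : nat => 1 : R) n @[n --> \oo] --> (1 : R) by exact: cvg_cst.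
  apply: (squeeze_cvgr _ lowlim c1).
  have /cvgryPgt/(_ (`|M| / (th / 2))) Mv := voo.
  near=> n; have Mn : `|M| / (th / 2) < v n by near: n.
  have v0 : 0 < v n by apply: le_lt_trans Mn; rewrite divr_ge0// ltW.
  have mM : measurable [set w | M < (sz n w)%:R :> R].
    rewrite (_ : [set _ | _] = [set w | M / v n < (sz n w)%:R / v n]).
      exact: measurable_gt_set.
    by apply/seteqP; split => w /=; rewrite ltr_pM2r// invr_gt0.
  have mD : measurable [set w | th / 2 < `|(sz n w)%:R / v n - th|].
    by apply: measurable_gt_set; case: (bWd n).
  rewrite /= prob_le1// andbT -(mean_indic P mD) -[X in X - _ <= _](mean_cst P) -meanB;
    [|exact: bmeas_cst|exact: bmeas_indic].
  rewrite -(mean_indic P mM); apply: mean_le; [|exact: bmeas_indic|].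
    by apply: bmeasB; [exact: bmeas_cst|exact: bmeas_indic].
  move=> w; rewrite !indic_boolE.
  have [|h] := boolP (M < (sz n w)%:R); first by rewrite lerBlDr lerDl ler0n.
  rewrite (_ : (th / 2 < _) = true) ?subrr//; apply/negbNE/negP.
  rewrite -leNgt => h2; move/negP: h; apply.
  apply: (le_lt_trans (ler_norm M)).
  move: Mn; rewrite ltr_pdivrMr// => /lt_le_trans; apply.
  rewrite mulrC -ler_pdivlMr//.
  by move: h2; rewrite ler_norml; lra.
- have := pth _ th2; apply: (squeeze_cvgr _ (cvg_cst 0)).
  have /cvgryPgt/(_ 0) v1 := voo.
  near=> n; have v0 : 0 < v n by near: n.
  rewrite prob_ge0/=; apply: le_prob.
  - rewrite (_ : [set _ | _] = ~` [set w | 0 < (sz n w)%:R / v n]).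
      by apply: measurableC; exact: measurable_gt_set.
    apply/seteqP; split => w /=; first by move=> ->; rewrite mul0r ltxx.
    move/negP; rewrite -leNgt pmulr_lle0 ?invr_gt0// => h.
    by apply/eqP; rewrite -(pnatr_eq0 R) eq_le h ler0n.
  - by apply: measurable_gt_set; case: (bWd n).
  move=> w /= ->; rewrite mul0r sub0r normrN gtr0_norm//.
  by rewrite ltr_pdivrMr// ltr_pMr// ltr1n.
Unshelve. all: by end_near. Qed.

(** As U <= C W, the error of U / W is at most (C |W - th| + |U - q|) / th, however
    small W is. *)
Lemma mean_ratio_cvg (U W : nat -> T -> R) (C q th : R) : 0 <= C -> 0 < th ->
  (forall n, bmeas (U n)) -> (forall n, bmeas (W n)) ->
  (forall n w, 0 <= U n w <= C * W n w) -> (forall n w, 0 <= W n w) ->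
  mean P (fun w => `|U n w - q|) @[n --> \oo] --> 0 ->
  mean P (fun w => `|W n w - th|) @[n --> \oo] --> 0 ->
  mean P (fun w => U n w / W n w) @[n --> \oo] --> q / th.
Proof.
move=> C0 th0 bU bW UC W0 U1 W1.
have UW n w : 0 <= U n w / W n w <= C.
  have /andP[u0 uC] := UC n w; rewrite divr_ge0//=.
  have := W0 n w; rewrite le_eqVlt => /predU1P[<-|w0]; first by rewrite invr0 mulr0.
  by rewrite ler_pdivrMr.
have bUW n : bmeas (fun w => U n w / W n w).
  apply: (@bmeas_itv _ _ _ _ 0 C) => //; apply: measurable_funM; first by case: (bU n).
  by apply: measurable_inv_ge0; [case: (bW n)|exact: W0].
have bUd n : bmeas (fun w => `|U n w - q|).
  by apply: bmeas_norm; apply: bmeasB => //; exact: bmeas_cst.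
have bWd n : bmeas (fun w => `|W n w - th|).
  by apply: bmeas_norm; apply: bmeasB => //; exact: bmeas_cst.
(* The bound at W = 0, where U / W is 0, needs q <= C th. *)
have qC : q <= C * th.
  have H : mean P (fun w => `|U n w - q|) + C * mean P (fun w => `|W n w - th|)
      @[n --> \oo] --> 0 + C * 0.
    by apply: cvgD => //; apply: cvgM => //; exact: cvg_cst.
  rewrite mulr0 addr0 in H.
  rewrite -subr_le0; apply: (cvgr_to_ge H); apply: nearW => n.
  rewrite -meanZ// -meanD//; last exact: bmeasZ.
  rewrite -[leLHS](mean_cst P); apply: mean_le; [exact: bmeas_cst| |].
    by apply: bmeasD => //; exact: bmeasZ.
  move=> w; have /andP[u0 uC] := UC n w.
  have h1 : q - U n w <= `|U n w - q| by rewrite distrC ler_norm.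
  have h2 : C * (W n w - th) <= C * `|W n w - th| by rewrite ler_wpM2l// ler_norm.
  lra.
have q0 : 0 <= q.
  have H : - mean P (fun w => `|U n w - q|) @[n --> \oo] --> - 0 by exact: cvgN.
  rewrite oppr0 in H; apply: (cvgr_to_le H); apply: nearW => n.
  rewrite lerNl -[leLHS](mean_cst P); apply: mean_le => //; first exact: bmeas_cst.
  move=> w; have /andP[u0 _] := UC n w.
  by have := ler_norm (U n w - q); lra.
apply/cvgrPdist_le => e e0.
have H : (mean P (fun w => `|U n w - q|) + C * mean P (fun w => `|W n w - th|)) / th
    @[n --> \oo] --> (0 + C * 0) / th.
  apply: cvgM; last exact: cvg_cst.
  by apply: cvgD => //; apply: cvgM => //; exact: cvg_cst.
rewrite mulr0 addr0 mul0r in H.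
have /cvgrPdist_le/(_ _ e0) := H; apply: filterS => n.
rewrite sub0r normrN => h.
apply: le_trans (le_trans (ler_norm _) h).
rewrite distrC -(mean_cst P (q / th)) -meanB//; last exact: bmeas_cst.
have bD : bmeas (fun w => U n w / W n w - q / th) by apply: bmeasB => //; exact: bmeas_cst.
apply: (le_trans (mean_norm _ bD)).
rewrite -meanZ// -meanD//; last exact: bmeasZ.
rewrite [leRHS]mulrC -meanZ; last by apply: bmeasD => //; exact: bmeasZ.
apply: mean_le; [exact: bmeas_norm|by apply: bmeasZ; apply: bmeasD => //; exact: bmeasZ|].
move=> w; rewrite [leRHS]mulrC ler_pdivlMr// -{2}(gtr0_norm th0) -normrM mulrBl divfK ?gt_eqF//.
have /andP[u0 uC] := UC n w; have := W0 n w; rewrite le_eqVlt => /predU1P[w0|w0].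
  rewrite -w0 invr0 mulr0 mul0r !sub0r !normrN (gtr0_norm th0) ger0_norm//.
  by rewrite ler_wpDl.
rewrite (_ : U n w / W n w * th - q = (U n w - q) + U n w / W n w * (th - W n w)); last first.
  by rewrite mulrBr divfK ?gt_eqF//; ring.
apply: (le_trans (ler_normD _ _)); rewrite lerD2l normrM (distrC th) ler_wpM2r//.
by have /andP[h1 h2] := UW n w; rewrite ger0_norm.
Qed.

End mean_limits.

Section selection.
Context {R : realType} d (T : measurableType d) (P : probability T R).

Lemma measurable_select (K : {RV P >-> nat}) (phi : nat -> T -> R) :
  (forall j, measurable_fun setT (phi j)) ->
  measurable_fun setT (fun w => phi (K w) w).
Proof.
move=> mphi _ B mB; rewrite setTI.
rewrite (_ : _ @^-1` _ = \bigcup_j ((K @^-1` [set j]) `&` (phi j @^-1` B))).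
  apply: bigcupT_measurable => j; apply: measurableI.
    by rewrite -[X in measurable X]setTI; exact: measurable_funPT.
  by rewrite -[X in measurable X]setTI; exact: mphi.
apply/seteqP; split => w /=; first by move=> BK; exists (K w).
by move=> [j _ [/= -> ]].
Qed.

Variables (F : set (set T)) (N : T -> seq nat) (K : {RV P >-> nat}) (m : nat).
Hypothesis NK : cond_uniform P F N K.
Hypothesis N_uniq : forall w, uniq (N w).
Hypothesis N_sub : forall w j, j \in N w -> (1 <= j < m.+1)%N.
Hypothesis mN : forall j, measurable [set w | j \in N w].
Hypothesis FT : F setT.

Let weight j w : R := (j \in N w)%:R / (size (N w))%:R.
Let chosen j w : R := ((N w != [::]) && (K w == j))%:R.

Lemma sum_select (g : nat -> R) w :
  \sum_(j <- N w) g j = \sum_(1 <= j < m.+1) (j \in N w)%:R * g j.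
Proof.
rewrite [RHS](bigID (fun j => j \in N w))/= [X in _ + X]big1 ?addr0; last first.
  by move=> j /negbTE ->; rewrite mul0r.
rewrite -[RHS]big_filter (perm_big (seq.filter (fun j => j \in N w) (index_iota 1 m.+1))).
  rewrite !big_filter; apply: eq_bigr => j jN.
  by rewrite jN mul1r.
apply: uniq_perm.
- exact: N_uniq.
- by rewrite filter_uniq// iota_uniq.
move=> j; rewrite mem_filter mem_index_iota.
by case: (boolP (j \in N w)) => //= /N_sub ->.
Qed.

Lemma size_sum w : (size (N w))%:R = \sum_(1 <= j < m.+1) (j \in N w)%:R :> R.
Proof.
rewrite -sum1_size natr_sum sum_select.
by apply: eq_bigr => j _; rewrite mulr1.
Qed.

Lemma bmeas_mem j : bmeas (fun w => (j \in N w)%:R : R).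
Proof.
rewrite (_ : (fun _ => _) = \1_[set w | j \in N w]); first exact: bmeas_indic.
by apply/funext => w; rewrite indic_boolE.
Qed.

Lemma measurable_size : measurable_fun setT (fun w => (size (N w))%:R : R).
Proof.
rewrite (_ : (fun _ => _) = fun w => \sum_(1 <= j < m.+1) (j \in N w)%:R).
  by have [] := bmeas_sum (index_iota 1 m.+1) bmeas_mem.
by apply/funext => w; rewrite size_sum.
Qed.

Lemma weight_itv j w : 0 <= weight j w <= 1.
Proof.
rewrite /weight divr_ge0//=; case: (boolP (j \in N w)) => jN; last by rewrite mul0r.
have s0 : (0 < size (N w))%N by case: (N w) jN.
by rewrite mul1r invf_le1 ?ltr0n// ler1n.
Qed.

Lemma bmeas_weight j : bmeas (weight j).
Proof.
apply: (@bmeas_itv _ _ _ _ 0 1) => [|w]; last exact: weight_itv.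
apply: measurable_funM; first by have [] := bmeas_mem j.
by apply: measurable_inv_ge0; [exact: measurable_size|move=> w; exact: ler0n].
Qed.

Lemma measurable_nonempty : measurable [set w | N w != [::]].
Proof.
rewrite (_ : [set _ | _] = \bigcup_j [set w | j \in N w]).
  exact: bigcupT_measurable.
apply/seteqP; split => w /=.
  by case E : (N w) => [//|j s] _; exists j => //=; rewrite E mem_head.
by move=> [j _ /=]; case: (N w).
Qed.

Lemma measurable_chosen j : measurable [set w | (N w != [::]) && (K w == j)].
Proof.
rewrite (_ : [set _ | _] = [set w | N w != [::]] `&` K @^-1` [set j]).
  apply: measurableI; first exact: measurable_nonempty.
  by rewrite -[X in measurable X]setTI; exact: measurable_funPT.
by apply/seteqP; split => w /=; [move=> /andP[-> /eqP]|move=> [-> /eqP ->]].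
Qed.

Lemma bmeas_chosen j : bmeas (chosen j).
Proof.
rewrite (_ : chosen j = \1_[set w | (N w != [::]) && (K w == j)]).
  by apply: bmeas_indic; exact: measurable_chosen.
by apply/funext => w; rewrite indic_boolE.
Qed.

Lemma mean_chosen_on (G : set T) j : measurable G -> F G ->
  mean P (fun w => chosen j w * \1_G w) = mean P (fun w => weight j w * \1_G w).
Proof.
move=> mG FG; have := NK j FG.
rewrite (_ : [set w | [/\ _, _ & _]] = G `&` [set w | (N w != [::]) && (K w == j)]); last first.
  apply/seteqP; split => w /=; first by move=> [h1 h2 h3]; rewrite h2 h3 eqxx.
  by move=> [h1 /andP[h2 /eqP]].
move=> /(congr1 fine); rewrite -/(prob P _).
rewrite -mean_indic; last by apply: measurableI => //; exact: measurable_chosen.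
move=> h; transitivity (mean P (\1_(G `&` [set w | (N w != [::]) && (K w == j)]) : T -> R)).
  by congr (mean P _); apply/funext => w; rewrite indicI /= mulrC indic_boolE.
rewrite h meanE [LHS](_ : _ = \int[P]_(w in G) weight j w)//.
rewrite Rintegral_mkcond; apply: eq_Rintegral => w _; rewrite patchE indicE.
by case: ifP; rewrite ?mulr1 ?mulr0.
Qed.

Lemma mean_chosen (phi : T -> R) (C : R) j : 0 < C ->
  measurable_fun setT phi -> (forall w, 0 <= phi w <= C) ->
  (forall t : R, F [set w | t <= phi w]) ->
  mean P (fun w => chosen j w * phi w) = mean P (fun w => weight j w * phi w).
Proof.
move=> C0 mphi phiC Fphi; apply: (eq_mean_layers C0) => //.
- exact: bmeas_chosen.
- exact: bmeas_weight.
- by move=> w; have /andP[] := weight_itv j w.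
by move=> t; apply: mean_chosen_on => //; exact: measurable_ge_set.
Qed.

(** Given F, the selected index has the law [weight]; only where N is empty is it
    arbitrary. *)
Lemma mean_select (phi : nat -> T -> R) (C : R) : 0 < C ->
  (forall j, measurable_fun setT (phi j)) -> (forall j w, 0 <= phi j w <= C) ->
  (forall j, (1 <= j < m.+1)%N -> forall t : R, F [set w | t <= phi j w]) ->
  `|mean P (fun w => phi (K w) w) -
    mean P (fun w => (\sum_(j <- N w) phi j w) / (size (N w))%:R)|
  <= C * prob P [set w | N w = [::]].
Proof.
move=> C0 mphi phiC Fphi.
have bphi j : bmeas (phi j) by exact: bmeas_itv.
have bchp j : bmeas (fun w => chosen j w * phi j w).
  by apply: bmeasM => //; exact: bmeas_chosen.
have bwp j : bmeas (fun w => weight j w * phi j w).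
  by apply: bmeasM => //; exact: bmeas_weight.
have bsel : bmeas (fun w => phi (K w) w).
  by apply: bmeas_itv; [exact: measurable_select|move=> w; exact: phiC].
have avg : (fun w => (\sum_(j <- N w) phi j w) / (size (N w))%:R) =
    fun w => \sum_(1 <= j < m.+1) weight j w * phi j w.
  apply/funext => w; rewrite sum_select mulr_suml.
  by apply: eq_bigr => j _; rewrite /weight mulrAC.
have sumE : mean P (fun w => \sum_(1 <= j < m.+1) weight j w * phi j w) =
    mean P (fun w => \sum_(1 <= j < m.+1) chosen j w * phi j w).
  rewrite !mean_sum// !big_nat; apply: eq_bigr => j jm.
  by rewrite (mean_chosen j C0)//; exact: Fphi.
have mass : mean P (fun w => \sum_(1 <= j < m.+1) chosen j w) =
    1 - prob P [set w | N w = [::]].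
  transitivity (mean P (fun w => \sum_(1 <= j < m.+1) weight j w)).
    rewrite !mean_sum; [|exact: bmeas_weight|exact: bmeas_chosen].
    apply: eq_bigr => j _.
    have := mean_chosen_on j measurableT FT.
    have one (u : T -> R) : (fun w => u w * \1_[set: T] w) = u.
      by apply/funext => w; rewrite indicE in_setT mulr1.
    by rewrite !one.
  have mE : measurable [set w | N w = [::]].
    rewrite (_ : [set _ | _] = ~` [set w | N w != [::]]).
      by apply: measurableC; exact: measurable_nonempty.
    by apply/seteqP; split => w /=; [move=> ->|move=> /negP/negPn/eqP].
  rewrite -(mean_indic P mE) -[X in _ = X - _](mean_cst P) -meanB; [|exact: bmeas_cst|exact: bmeas_indic].
  congr (mean P _); apply/funext => w; rewrite -mulr_suml -size_sum indicE.
  have [E|E] := eqVneq (N w) [::].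
    by rewrite mem_set// E /= mul0r subrr.
  rewrite memNset//=; last by move=> h; rewrite h in E.
  by rewrite subr0 divff// pnatr_eq0 size_eq0.
have chs w : \sum_(1 <= j < m.+1) chosen j w * phi j w =
    (\sum_(1 <= j < m.+1) chosen j w) * phi (K w) w.
  rewrite mulr_suml; apply: eq_bigr => j _; rewrite /chosen.
  by case: (K w =P j) => [->//|_]; rewrite andbF !mul0r.
have ch1 w : 0 <= \sum_(1 <= j < m.+1) chosen j w <= 1.
  rewrite sumr_ge0//=.
  have [Km|Km] := boolP (K w \in index_iota 1 m.+1).
    rewrite (bigD1_seq (K w)) ?iota_uniq//= big1 => [|j /negbTE jK].
      by rewrite addr0 /chosen; case: (_ && _).
    by rewrite /chosen [K w == _]eq_sym jK andbF.
  rewrite big_seq big1 ?ler01// => j jm; rewrite /chosen.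
  by case: (K w =P j) => [E|_]; [rewrite E jm in Km|rewrite andbF].
have bch : bmeas (fun w => \sum_(1 <= j < m.+1) chosen j w).
  by apply: bmeas_sum; exact: bmeas_chosen.
rewrite avg sumE -meanB//; last exact: bmeas_sum.
rewrite (_ : prob P _ = mean P (fun w => 1 - \sum_(1 <= j < m.+1) chosen j w)); last first.
  rewrite meanB//; last exact: bmeas_cst.
  by rewrite mean_cst mass subKr.
have b1 : bmeas (fun w => 1 - \sum_(1 <= j < m.+1) chosen j w).
  by apply: bmeasB => //; exact: bmeas_cst.
rewrite -meanZ//.
have bD : bmeas (fun w => phi (K w) w - \sum_(1 <= j < m.+1) chosen j w * phi j w).
  by apply: bmeasB => //; exact: bmeas_sum.
apply: (le_trans (mean_norm _ bD)); apply: mean_le; [exact: bmeas_norm|exact: bmeasZ|].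
move=> w; rewrite chs -{1}[phi (K w) w]mul1r -mulrBl mulrC.
have /andP[h1 h2] := ch1 w; have /andP[h3 h4] := phiC (K w) w.
by rewrite ger0_norm ?mulr_ge0 ?subr_ge0// ler_wpM2r// subr_ge0.
Qed.

End selection.

(** Selecting uniformly from N is averaging over N, and both the sum over N and
    the size of N are of order v. *)
Lemma select_cvg {R : realType} d (T : measurableType d) (P : probability T R)
    (F : nat -> set (set T)) (N : nat -> T -> seq nat) (K : nat -> {RV P >-> nat})
    (m : nat -> nat) (phi : nat -> nat -> T -> R) (v : nat -> R) (C q th : R) :
  (forall n, cond_uniform P (F n) (N n) (K n)) -> (forall n w, uniq (N n w)) ->
  (forall n w j, j \in N n w -> (1 <= j < (m n).+1)%N) ->
  (forall n j, measurable [set w | j \in N n w]) -> (forall n, F n setT) ->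
  0 < C -> (forall n j, measurable_fun setT (phi n j)) ->
  (forall n j w, 0 <= phi n j w <= C) ->
  (forall n j, (1 <= j < (m n).+1)%N -> forall t : R, F n [set w | t <= phi n j w]) ->
  0 < th -> v n @[n --> \oo] --> +oo -> (forall n, 0 <= v n) ->
  mean P (fun w => `|(\sum_(j <- N n w) phi n j w) / v n - q|) @[n --> \oo] --> 0 ->
  mean P (fun w => `|(size (N n w))%:R / v n - th|) @[n --> \oo] --> 0 ->
  mean P (fun w => phi n (K n w) w) @[n --> \oo] --> q / th.
Proof.
move=> NK Nu Ns mN FT C0 mphi phiC Fphi th0 voo v0 U1 W1.
have sel n := mean_select (NK n) (Nu n) (@Ns n) (mN n) (FT n) C0 (mphi n) (phiC n) (@Fphi n).
have bphi n j : bmeas (phi n j) by exact: bmeas_itv.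
have bU n : bmeas (fun w => (\sum_(j <- N n w) phi n j w) / v n).
  under eq_fun do rewrite (sum_select (Nu n) (@Ns n)) mulrC.
  by apply: bmeasZ; apply: bmeas_sum => j; apply: bmeasM => //; exact: bmeas_mem.
have bW n : bmeas (fun w => (size (N n w))%:R / v n).
  under eq_fun do rewrite (size_sum (Nu n) (@Ns n)) mulrC.
  by apply: bmeasZ; apply: bmeas_sum => j; exact: bmeas_mem.
have [_ _ N0] := counting_cvg th0 voo bW W1.
have ratio : mean P (fun w => (\sum_(j <- N n w) phi n j w) / v n /
    ((size (N n w))%:R / v n)) @[n --> \oo] --> q / th.
  apply: (mean_ratio_cvg (ltW C0) th0 bU bW _ _ U1 W1) => n w; last by rewrite divr_ge0.
  rewrite divr_ge0//=; last by apply: sumr_ge0 => j _; have /andP[] := phiC n j w.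
  rewrite mulrA ler_wpM2r ?invr_ge0//.
  rewrite -sum1_size natr_sum mulr_sumr; apply: ler_sum => j _.
  by rewrite mulr1; have /andP[] := phiC n j w.
apply/cvgrPdist_le => e e0.
have e2 : 0 < e / 2 by rewrite divr_gt0.
have /cvgrPdist_le/(_ _ e2) H1 := ratio.
have eC : 0 < e / 2 / C by rewrite divr_gt0.
have /cvgrPdist_le/(_ _ eC) H2 := N0.
have /cvgryPgt/(_ 0) H3 := voo.
near=> n.
have vn : 0 < v n by near: n.
have h1 : `|q / th - mean P (fun w => (\sum_(j <- N n w) phi n j w) / v n /
    ((size (N n w))%:R / v n))| <= e / 2 by near: n.
have h2 : `|0 - prob P [set w | size (N n w) = 0%N]| <= e / 2 / C by near: n.
have := sel n.
rewrite (_ : [set w | N n w = [::]] = [set w | size (N n w) = 0%N]); last first.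
  by apply/seteqP; split => w /=; [move=> ->|move/size0nil].
move: h2; rewrite sub0r normrN ger0_norm ?prob_ge0// ler_pdivlMr// mulrC => h2 h3.
move: h1; rewrite (_ : (fun w => _ / ((size _)%:R / _)) = fun w =>
  (\sum_(j <- N n w) phi n j w) / (size (N n w))%:R); last first.
  by apply/funext => w; rewrite invf_div mulrA divfK// gt_eqF.
by have := le_trans h3 h2; rewrite !ler_norml; lra.
Unshelve. all: by end_near. Qed.

(** * Anchoring functions *)

Section anchoring_theory.
Context {R : realType}.
Variable A : (int -> R) -> int.
Hypothesis hA : anchoring A.
Implicit Types x : int -> R.

Lemma shiftD k l x : Defs.shift k (Defs.shift l x) = Defs.shift (k + l) x.
Proof. by apply/funext => i; rewrite /Defs.shift addrA. Qed.

Lemma exceed_shift k x i : exceed (Defs.shift k x) i <-> exceed x (i + k).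
Proof. by []. Qed.

Lemma excE_shift k x : excE x -> excE (Defs.shift k x).
Proof.
move=> [[i xi] fx]; split.
  by exists (i - k); apply/exceed_shift; rewrite subrK.
apply: (@sub_finite_set _ _ ((fun i => i - k) @` exceed x)); last exact: finite_image.
by move=> j xj; exists (j + k); [exact/exceed_shift|rewrite addrK].
Qed.

Lemma excE0_shift k x : excE x -> exceed x k -> excE0 (Defs.shift k x).
Proof. by move=> Ex xk; split; [exact: excE_shift|rewrite /Defs.shift add0r]. Qed.

(** The equivariance of A makes the choice of the exceedance immaterial. *)
Lemma anchor_extE k x : excE x -> exceed x k ->
  anchor_ext A x = A (Defs.shift k x) + k.
Proof.
move=> Ex xk; rewrite /anchor_ext asboolT//.
have := xgetPex 0 (ex_intro _ k xk); set k0 := xget _ _ => xk0.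
have [_ /(_ _ (excE0_shift Ex xk0)) [_ Hk]] := hA.
have /Hk : exceed (Defs.shift k0 x) (k - k0) by apply/exceed_shift; rewrite subrK.
by rewrite shiftD subrK => <-; rewrite -addrA subrK.
Qed.

Lemma anchor_ext_exceed x : excE x -> exceed x (anchor_ext A x).
Proof.
move=> Ex; have [[k xk] _] := Ex; rewrite (anchor_extE Ex xk).
have [_ /(_ _ (excE0_shift Ex xk)) [Hk _]] := hA.
exact/exceed_shift.
Qed.

Lemma anchor_ext_shift k x : excE x ->
  anchor_ext A (Defs.shift k x) = anchor_ext A x - k.
Proof.
move=> Ex; have [[j xj] _] := Ex.
have xjk : exceed (Defs.shift k x) (j - k) by apply/exceed_shift; rewrite subrK.
by rewrite (anchor_extE (excE_shift k Ex) xjk) (anchor_extE Ex xj) shiftD subrK addrA.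
Qed.

Definition anchored0 : set (int -> R) := [set x | excE x /\ anchor_ext A x = 0].

Lemma anchored0E : anchored0 = @excE0 R `&` A @^-1` [set 0].
Proof.
have shift0 x : Defs.shift 0 x = x by apply/funext => i; rewrite /Defs.shift addr0.
apply/seteqP; split => x /=.
  move=> [Ex Ax]; have x0 := anchor_ext_exceed Ex; rewrite Ax in x0.
  by split; [split|move: Ax; rewrite (anchor_extE Ex x0) shift0 addr0].
by move=> [[Ex x0] Ax]; split => //; rewrite (anchor_extE Ex x0) shift0 addr0.
Qed.

Lemma measurable_anchored0 : measurable (anchored0 : set (pathT R)).
Proof. by rewrite anchored0E; have [mA _] := hA; exact: mA. Qed.

Lemma excE_l0 (x : l0 R) : excE x <-> nexc x != 0.
Proof.
split.
  move=> [[i xi] _]; rewrite gt_eqF// (lt_le_trans ltr01)//; exact: nexc_ge1 xi.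
move=> /eqP n0; split; last exact: exceed_finite.
apply: contrapT => /set0P/negP/negPn/eqP x0; apply: n0.
apply/eqP; rewrite pnatr_eq0 cardfs_eq0; apply/eqP/fsetP => i.
rewrite mem_exc in_fset0; apply/negP => xi.
by have : exceed x i by []; rewrite x0.
Qed.

Definition anchored (x : l0 R) : R := \1_anchored0 (x : int -> R).

Lemma anchored_itv (x : l0 R) : 0 <= anchored x <= 1.
Proof. by rewrite /anchored indicE; case: (_ \in _); rewrite ?lexx ler01. Qed.

Lemma measurable_anchored : measurable_fun setT (anchored : l0_borel R -> R).
Proof.
have ml : measurable_fun setT ((fun x : l0_borel R => (x : l0 R) : int -> R)
    : l0_borel R -> pathT R).
  by apply: measurable_path => i; exact: measurable_coord.
apply: (@measurableT_comp _ _ _ _ _ _ (\1_anchored0 : pathT R -> R) _ _ _ ml).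
exact: measurable_indic measurable_anchored0.
Qed.

Lemma supp0_anchored (f : l0 R -> R) : supp0 (fun y : l0 R => anchored y * f y).
Proof.
move=> x x0; rewrite /anchored indicE memNset ?mul0r// => -[Ex Ax].
by have := anchor_ext_exceed Ex; rewrite Ax /exceed/= ltNge x0.
Qed.

Lemma anchored_shift i (x : l0 R) : excE x ->
  anchored (shift_l0 i x) = (anchor_ext A x == i)%:R.
Proof.
move=> Ex; rewrite /anchored indicE; congr (nat_of_bool _)%:R.
apply/idP/idP; rewrite inE.
  by move=> [_]; rewrite anchor_ext_shift// => /eqP; rewrite subr_eq0.
move=> /eqP xi; split; first exact: excE_shift.
by rewrite anchor_ext_shift// xi subrr.
Qed.

(** Exactly one exceedance of a cluster is its anchor. *)
Lemma csum_anchor (f : l0 R -> R) (x : l0 R) :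
  csum (fun y : l0 R => anchored y * f y) x = (nexc x != 0)%:R * f (anchor_shift A x).
Proof.
have [n0|n0] := eqVneq (nexc x) 0.
  rewrite mul0r (@csum_seq _ _ _ [::])// ?big_nil//; first exact: supp0_anchored.
  by move=> i; rewrite ltNge (nexc_eq0 n0).
have /excE_l0 Ex := n0; rewrite mul1r /csum.
rewrite (bigD1_seq (anchor_ext A x)) ?fset_uniq//=; last first.
  by rewrite mem_exc; exact: anchor_ext_exceed.
rewrite big1 ?addr0 => [|i ix].
  by rewrite anchored_shift// eqxx mul1r.
by rewrite anchored_shift// eq_sym (negbTE ix) mul0r.
Qed.

Lemma anchor_shift_flat (x : l0 R) : nexc x = 0 -> anchor_shift A x = x.
Proof.
move=> x0; rewrite /anchor_shift /anchor_ext asboolF ?shift_l0_0// => Ex.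
by move/excE_l0 : Ex; rewrite x0 eqxx.
Qed.

Lemma measurable_anchor_shift (f : l0 R -> R) :
  measurable_fun setT (f : l0_borel R -> R) ->
  measurable_fun setT ((fun x : l0 R => f (anchor_shift A x)) : l0_borel R -> R).
Proof.
move=> mf.
have m1 (g : l0 R -> R) : measurable_fun setT (g : l0_borel R -> R) ->
    measurable_fun setT (csum (fun y : l0 R => anchored y * g y) : l0_borel R -> R).
  move=> mg; apply: measurable_csum; first exact: supp0_anchored.
  by apply: measurable_funM => //; exact: measurable_anchored.
rewrite (_ : (fun x : l0 R => f (anchor_shift A x)) = fun x : l0 R => csum (fun y : l0 R => anchored y * f y) x +
    (1 - csum (fun y : l0 R => anchored y * 1) x) * f x).
  apply: measurable_funD; first exact: m1.
  apply: measurable_funM => //; apply: measurable_funB; first exact: measurable_cst.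
  by apply: m1; exact: measurable_cst.
apply/funext => x; rewrite !csum_anchor mulr1.
have [n0|n0] := eqVneq (nexc x) 0; last by rewrite mul1r subrr mul0r addr0.
by rewrite mul0r add0r subr0 mul1r anchor_shift_flat.
Qed.

(** A map to a discrete space is continuous at x if it is constant near x, which
    is an open condition on x; this makes [anchor_disc A] a Borel set. *)
Definition locally_anchored (k : int) (x : l0 R) : Prop :=
  exists2 e : R, 0 < e & forall z : l0 R, `|x - z| < e -> excE z -> anchor_ext A z = k.

Lemma open_locally_anchored k : open [set x | locally_anchored k x].
Proof.
rewrite openE => x [e e0 He]; apply/l0_nbhsP; exists (e / 2); first by rewrite divr_gt0.
move=> y xy; exists (e / 2); first by rewrite divr_gt0.
move=> z yz; apply: He; rewrite (_ : x - z = (x - y) + (y - z)).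
  by rewrite (le_lt_trans (ler_normD _ _))// [ltRHS]splitr ltrD.
by rewrite addrA subrK.
Qed.

Lemma not_disc_locally (x : l0 R) : excE x -> ~ anchor_disc A x ->
  locally_anchored (anchor_ext A x) x.
Proof.
move=> Ex nd.
have H : (anchor_ext A z : discrete_topology int) @[z --> within [set x : l0 R | excE x] (nbhs x)]
         --> (anchor_ext A x : discrete_topology int).
  by apply: contrapT => H; apply: nd.
have := H [set anchor_ext A x].
have : nbhs (anchor_ext A x : discrete_topology int) [set anchor_ext A x].
  by apply/open_nbhs_nbhs; split => //; exact: discrete_open.
by move=> h /(_ h) /l0_nbhsP[e e0 He]; exists e.
Qed.

Lemma disc_not_locally (x : l0 R) k : anchor_disc A x -> ~ locally_anchored k x.
Proof.
move=> [Ex nd] [e e0 He]; apply: nd => S /nbhs_singleton Sx.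
apply/l0_nbhsP; exists e => // z xz Ez /=.
rewrite (He _ xz Ez); have := He x; rewrite subrr normr0 => /(_ e0 Ex) <-.
exact: Sx.
Qed.

Lemma measurable_disc : measurable (anchor_disc A : set (l0_borel R)).
Proof.
rewrite (_ : anchor_disc A = [set x | nexc x != 0] `&`
    ~` \bigcup_k [set x | locally_anchored k x]).
  apply: measurableI.
    rewrite (_ : [set _ | _] = [set x | 0 < nexc x]).
      by apply: measurable_gt_set; exact: measurable_nexc.
    apply/seteqP; split => x /=; first by rewrite lt_neqAle nexc_ge0 eq_sym => ->.
    by move=> x0; rewrite gt_eqF.
  apply: measurableC; apply: bigcup_countable_measurable => k _.
  by apply: sub_sigma_algebra; exact: open_locally_anchored.
apply/seteqP; split => x.
  move=> dx; split; first by have [/excE_l0] := dx.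
  by move=> [k _ /=]; exact: disc_not_locally.
move=> [/excE_l0 Ex /= nl]; apply: contrapT => nd; apply: nl.
by exists (anchor_ext A x) => //; exact: not_disc_locally.
Qed.

(** Near [y] neither the exceedances nor the anchor move, and shifts are
    isometries. *)
Lemma continuous_anchored (f : l0 R -> R) (y : l0 R) i : continuous f ->
  no_unit y -> excE y -> ~ anchor_disc A y ->
  {for shift_l0 i y, continuous (fun y : l0 R => anchored y * f y)}.
Proof.
move=> cf y1 Ey nd.
have [e e0 He] := not_disc_locally Ey nd.
have [d d0 Hd] := exc_near y1.
apply: (@continuous_near_eq _ _ (fun x : l0 R => anchored (shift_l0 i y) * f x)).
  exists (Num.min e d); first by rewrite lt_min e0.
  move=> z; rewrite lt_min => /andP[ze zd].
  have zE : z = shift_l0 i (shift_l0 (- i) z) by rewrite shift_l0D addrN shift_l0_0.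
  have dist : `|y - shift_l0 (- i) z| = `|shift_l0 i y - z|.
    by rewrite {2}zE -shift_l0B norm_shift.
  rewrite -dist in ze zd.
  have Ez : excE (shift_l0 (- i) z).
    apply/excE_l0; rewrite /nexc (Hd _ zd).
    by move/excE_l0 : Ey.
  by rewrite {1}zE !anchored_shift// (He _ ze Ez).
by apply: continuous_forM; [exact: continuous_for_cst|exact: cf].
Qed.

End anchoring_theory.

Section number_of_exceedances.
Context {R : realType}.

Lemma measurable_card_exceed :
  measurable_fun setT (fun x : pathT R => (#|` fset_set (exceed (x : int -> R))|)%:R : R).
Proof.
pose quiet m := \bigcap_(i in [set i : int | (m < `|i|)%N])
  ~` [set x : pathT R | 1 < `|(x : int -> R) i|].
have mq m : measurable (quiet m).
  apply: bigcap_countable_measurable => i _; apply: measurableC.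
  apply: measurable_gt_set; apply: measurableT_comp => //; exact: measurable_path_coord.
have finP (x : int -> R) : finite_set (exceed x) <-> (\bigcup_m quiet m) x.
  split.
    move=> fx; exists (\max_(i <- fset_set (exceed x)) `|i|)%N => // i /= im xi.
    have : i \in fset_set (exceed x) by rewrite in_fset_set// inE.
    move=> xi'; have := @leq_bigmax_seq _ _ xpredT (fun i : int => `|i|%N) i xi' isT.
    by rewrite leqNgt im.
  move=> [m _ qm]; apply: (@sub_finite_set _ _ [set` window m]); last exact: finite_seq.
  move=> i xi /=; rewrite mem_window leqNgt; apply/negP => im.
  exact: (qm i im).
apply: (@measurable_fun_cvg _ _ _ _ (fun m (x : pathT R) =>
   \1_(\bigcup_m quiet m) x * \sum_(i <- window m) (1 < `|(x : int -> R) i|)%R%:R)).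
  move=> m; apply: measurable_funM.
    by apply: measurable_indic; exact: bigcupT_measurable.
  by apply: measurable_sum => i; have [] := @bmeas_level R 1 i.
move=> x _; have [fx|fx] := pselect (finite_set (exceed (x : int -> R))); last first.
  have -> : fset_set (exceed (x : int -> R)) = fset0 by rewrite /fset_set; case: pselect.
  rewrite cardfs0.
  apply: cvg_near_cst; apply: nearW => m.
  by rewrite indicE memNset ?mul0r// => /finP.
have [m0 _ qm] := (finP x).1 fx.
apply: cvg_near_cst; exists m0 => // m /= m0m.
rewrite indicE mem_set; last exact/finP.
rewrite mul1r -natr_sum; congr (_%:R).
rewrite -sum1_size [RHS](@perm_big _ _ _ _ _ (seq.filter (fun i => 1 < `|(x : int -> R) i|) (window m))).
  by rewrite big_filter [RHS]big_mkcond; apply: eq_bigr => i _; case: (1 < _).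
apply: uniq_perm; [exact: fset_uniq|by rewrite filter_uniq// window_uniq|].
move=> i; rewrite mem_filter mem_window in_fset_set//.
apply/idP/andP; rewrite inE; last by case.
move=> xi; split=> //; rewrite leqNgt; apply/negP => mi.
by apply: (qm i _ xi); exact: leq_ltn_trans mi.
Qed.

End number_of_exceedances.

(** * Blocks *)

Section block_structure.
Context {R : realType}.

Lemma nexc_scale (u : R) (x : l0 R) : 0 < u -> (u < `|x|) = (nexc (u^-1 *: x) != 0).
Proof.
move=> u0; have E i : (1 < `|(u^-1 *: x) i|) = (u < `|x i|).
  by rewrite l0_coordZ normrM gtr0_norm ?invr_gt0// ltr_pdivlMl// mulr1.
apply/idP/idP.
  move=> /lt_norm_coord[i]; rewrite -E => xi.
  by rewrite gt_eqF// (lt_le_trans ltr01)//; exact: nexc_ge1 xi.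
move=> n0; rewrite ltNge; apply/negP => xu; move/eqP: n0; apply.
apply/eqP; rewrite pnatr_eq0 cardfs_eq0; apply/eqP/fsetP => i.
rewrite mem_exc in_fset0 E; apply/negbTE; rewrite -leNgt.
exact: le_trans (le_coord_norm x i) xu.
Qed.

Lemma block_index_eq (rho j i : nat) : (j.-1 * rho < i <= j * rho)%N ->
  block_index rho i = j.
Proof.
rewrite /block_index => /andP[h1 h2].
case: j h1 h2 => [|j] /= h1 h2; first by rewrite mul0n in h2; rewrite leqNgt (leq_ltn_trans (leq0n _) h1) in h2.
case: i h1 h2 => // i h1 h2; congr S => /=.
rewrite ltnS in h1; rewrite mulSn in h2.
have r0 : (0 < rho)%N by case: rho h1 h2 => //; rewrite muln0.
rewrite -(subnKC h1) divnMDl// divn_small ?addn0//.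
by rewrite ltn_subLR// addnC.
Qed.

Lemma sum_blocks (F : nat -> nat -> R) (rho k : nat) :
  \sum_(1 <= j < k.+1) \sum_((j.-1 * rho).+1 <= i < (j * rho).+1) F j i =
  \sum_(1 <= i < (k * rho).+1) F (block_index rho i) i.
Proof.
elim: k => [|k IH]; first by rewrite mul0n !big_geq.
rewrite big_nat_recr//= IH [RHS](@big_cat_nat _ _ _ (k * rho).+1)//=; last first.
  by rewrite ?ltnS leq_mul2r leqnSn orbT.
congr (_ + _); apply: eq_big_nat => i /andP[i1 i2].
by rewrite (@block_index_eq _ k.+1)//= i1.
Qed.

(** Its cluster sum is the indicator of a cluster with an exceedance, and its mean
    at the tail process is [theta]. *)
Definition unit_share (x : l0 R) : R := peak0 x * (1 / nexc x).

Lemma unit_share_itv (x : l0 R) : 0 <= unit_share x <= 1.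
Proof.
rewrite /unit_share mulr_ge0 ?peak0_ge0 ?divr_ge0 ?nexc_ge0//=.
rewrite /peak0; case: ltP => [x1|_]; last by rewrite mul0r.
have n1 := nexc_ge1 x1.
by rewrite mul1r ler_pdivrMr ?(lt_le_trans ltr01)// mul1r.
Qed.

Lemma csum_unit_share (x : l0 R) : csum unit_share x = (nexc x != 0)%:R.
Proof.
rewrite csum_peak (eq_bigr (fun=> 1 / nexc x)); last by move=> i _; rewrite nexc_shift.
rewrite big_const_seq count_predT iter_addr_0 -[LHS]mulr_natl -/(nexc x).
have [->|n0] := eqVneq (nexc x) 0; first by rewrite mul0r.
by rewrite mul1r divff.
Qed.

End block_structure.

Section past_measurability.
Context {R : realType} d (T : measurableType d) (P : probability T R).
Variable X : int -> {RV P >-> R}.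

(** A block within 1, ..., n depends on X_1, ..., X_n only. *)
Lemma block_sigma_upto n (rho j : nat) (a : R) (i : int) (f : l0 R -> R) (t : R) :
  (j * rho <= n)%N -> measurable_fun setT (f : l0_borel R -> R) ->
  sigma_upto X n [set w | t <= f (a *: shift_l0 i (block rho j (path_of X w)))].
Proof.
move=> jn mf.
pose Tn := g_sigma_algebraType (\bigcup_(i in [set i : int | 1 <= i <= n%:Z])
        preimage_set_system setT (X i) measurable).
have mX l : 1 <= l <= n%:Z -> measurable_fun setT (X l : Tn -> R).
  move=> ln _ B mB; apply: sub_sigma_algebra; exists l => //.
  by exists B.
have mV : measurable_fun setT
    ((fun w => a *: shift_l0 i (block rho j (path_of X w))) : Tn -> l0_borel R).
  apply: measurable_l0 => l.
  have [/andP[h1 h2]|h] := boolP ((j.-1 * rho)%N%:Z < l + i <= (j * rho)%N%:Z).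
    rewrite (_ : (fun w => _) = fun w : Tn => a * X (l + i) w); last first.
      by apply/funext => w; rewrite l0_coordZ shift_l0E /= h1 h2.
    apply: measurable_funM; first exact: measurable_cst.
    apply: mX; move: h1 h2 jn.
    by move: (j.-1 * rho)%N (j * rho)%N => p q; clear; lia.
  rewrite (_ : (fun w => _) = cst 0); first exact: measurable_cst.
  by apply/funext => w; rewrite l0_coordZ shift_l0E /= (negbTE h) mulr0.
exact: (measurable_ge_set t (measurableT_comp mf mV)).
Qed.

End past_measurability.

Section limits.
Context {R : realType} d (T : measurableType d) (P : probability T R).
Variable X : int -> {RV P >-> R}.
Context d' (T' : measurableType d') (Q : probability T' R).
Variable Y : int -> {RV Q >-> R}.
Hypothesis X_stationary : stationary X.
Hypothesis Y_tail : tail_process X Y.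
Variables (c : nat -> R) (r : nat -> nat).
Hypothesis c_gt0 : forall n, 0 < c n.
Hypothesis c_oo : c n @[n --> \oo] --> +oo.
Hypothesis r_oo : r n @[n --> \oo] --> \oo.
Hypothesis nP_oo : n%:R * tailp X (c n) @[n --> \oo] --> +oo.
Hypothesis rP_0 : (r n)%:R * tailp X (c n) @[n --> \oo] --> 0.
Hypothesis anticlustering : anticlustering_condition X c r.
Hypothesis mixing : mixing_condition X c r.

Local Notation Ybar w := (to_l0 (path_of Y w)).
Local Notation Sn := (clsum X c r).

Let LLN := clsum_L1_cvg X_stationary Y_tail c_gt0 c_oo r_oo nP_oo rP_0
  anticlustering mixing.
Let nounit := Y_nounit X_stationary Y_tail c_gt0 c_oo r_oo anticlustering.
Let Yv := Y_vanishing Y_tail c_gt0 c_oo r_oo anticlustering.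

Definition rate n : R := n%:R * tailp X (c n).

Lemma rate_ge0 n : 0 <= rate n.
Proof. by rewrite mulr_ge0 ?tailp_ge0. Qed.

Lemma rate_gt0 : \forall n \near \oo, 0 < rate n.
Proof. by have /cvgryPgt/(_ 0) := nP_oo. Qed.

Lemma Ybar_peak : {ae Q, forall w, 1 < `|Ybar w 0|}.
Proof.
move: (Y0_gt1 Y_tail) Yv; apply: filterS2 => w Y1 vY.
by rewrite to_l0K.
Qed.

Lemma good_peak (f : l0 R -> R) : continuous f ->
  {ae Q, forall w, forall i,
    {for shift_l0 i (Ybar w), continuous (fun x => peak0 x * f x)}}.
Proof.
move=> cf; apply: filterS nounit => w Y1 i; apply: continuous_peak; last exact: cf.
by move=> l; rewrite shift_l0E.
Qed.

Lemma good_share : {ae Q, forall w, forall i,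
  {for shift_l0 i (Ybar w), continuous (@unit_share R)}}.
Proof.
apply: filterS nounit => w Y1 i.
have Y1i : no_unit (shift_l0 i (Ybar w)) by move=> l; rewrite shift_l0E.
apply: continuous_peak => //; apply: continuous_share => //.
exact: continuous_for_cst.
Qed.

Lemma measurable_unit_share : measurable_fun setT (@unit_share R : l0_borel R -> R).
Proof. by apply: measurable_share; exact: measurable_cst. Qed.

Lemma supp0_unit_share : supp0 (@unit_share R).
Proof. exact: supp0_peak. Qed.

(** * Number of clusters *)

Lemma count_clusters n w :
  (size (Nc X c r n w))%:R / rate n = Sn n (csum (@unit_share R)) w.
Proof.
rewrite /clsum mulrC; congr (_ * _).
rewrite /Nc size_filter -sum1_count big_mkcond/= natr_sum.
by apply: eq_bigr => j _; rewrite csum_unit_share nexc_scale.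
Qed.

Lemma bmeas_Sn_csum n (g : l0 R -> R) C : supp0 g ->
  measurable_fun setT (g : l0_borel R -> R) -> itvfun C g -> bmeas (Sn n (csum g)).
Proof.
move=> g0 mg gC; apply: bmeas_clsum => j.
exact: (bmeas_block_csum _ _ _ g0 mg (itvfun_bounded gC)).
Qed.

(** [theta Y], read off the path in [l0]. *)
Definition extremal_mean : R := mean Q (fun w => unit_share (Ybar w)).

Lemma clusters_L1 :
  mean P (fun w => `|(size (Nc X c r n w))%:R / rate n - extremal_mean|)
    @[n --> \oo] --> 0.
Proof.
have := LLN supp0_unit_share measurable_unit_share unit_share_itv good_share.
by under [in X in _ -> X]eq_fun do under [in mean _ _]eq_fun do rewrite count_clusters.
Qed.

Lemma bmeas_unit_share_Y : bmeas (fun w => unit_share (Ybar w)).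
Proof. exact: (bmeas_Y Y measurable_unit_share (itvfun_bounded unit_share_itv)). Qed.

(** [unit_share] is positive at almost every path of [Y]. *)
Lemma extremal_mean_gt0 : 0 < extremal_mean.
Proof.
have b := bmeas_unit_share_Y.
pose G k := [set w | 1 <= k%:R * unit_share (Ybar w)].
have mG k : measurable (G k) by apply: measurable_ge_set; have [] := bmeasZ k%:R b.
have : mean Q (\1_(G k) : T' -> R) @[k --> \oo] --> mean Q (fun=> 1).
  apply: (@mean_dct _ _ _ _ _ _ 1).
  - by move=> k; exact: measurable_indic.
  - exact: measurable_cst.
  - by move=> k w; rewrite indicE; case: (_ \in _); rewrite ?normr1 ?normr0.
  apply: filterS Ybar_peak => w Y1.
  have u0 : 0 < unit_share (Ybar w).
    rewrite /unit_share /peak0 Y1 mul1r divr_gt0//.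
    by rewrite (lt_le_trans ltr01)//; exact: nexc_ge1 Y1.
  apply: cvg_near_cst; near=> k; rewrite indicE mem_set//= /G/=.
  by rewrite -ler_pdivrMr//; near: k; exact: nbhs_infty_ger.
rewrite mean_cst => /cvgrPdist_lt/(_ _ ltr01)/filter_ex[k Hk].
have Gk : 0 < prob Q (G k).
  rewrite -mean_indic//; move: Hk; rewrite ltr_norml => /andP[_].
  by rewrite ltrBlDr ltrDl.
have : prob Q (G k) <= mean Q (fun w => k%:R * unit_share (Ybar w)) / 1.
  apply: markov_mean => //; first exact: bmeasZ.
  by move=> w; rewrite mulr_ge0//; have /andP[] := unit_share_itv (Ybar w).
rewrite divr1 meanZ// => h; have := lt_le_trans Gk h.
rewrite /extremal_mean; set E := mean _ _ => kE.
have E0 : 0 <= E by apply: mean_ge0 => w; have /andP[] := unit_share_itv (Ybar w).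
by rewrite lt_neqAle E0 andbT; apply: contraTneq kE => <-; rewrite mulr0 ltxx.
Unshelve. all: by end_near. Qed.

Lemma extremal_meanE : theta Y = extremal_mean.
Proof.
rewrite /theta /extremal_mean; apply: mean_ae_eq.
- apply: (@bmeas_itv _ _ _ _ 0 1) => [|w].
    apply: measurable_inv_ge0; last by move=> w; exact: ler0n.
    exact: (measurableT_comp (@measurable_card_exceed R) (measurable_path_of Y)).
  rewrite invr_ge0 ler0n/=; have [->|n0] := eqVneq (#|` fset_set (exceed (path_of Y w))|) 0%N.
    by rewrite invr0.
  by rewrite invf_le1 ?ltr0n ?lt0n// ler1n lt0n.
- exact: bmeas_unit_share_Y.
move: Yv Ybar_peak; apply: filterS2 => w vY Y1.
rewrite /unit_share /peak0 Y1 mul1r div1r /nexc /exc; congr ((#|` fset_set _|)%:R^-1).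
by apply/seteqP; split => i; rewrite /exceed/= to_l0K.
Qed.

(** * Number of exceedances *)

(** Fewer than [r n] indices lie behind the last full block. They are negligible,
    but their block depends on observations after time n, so that it is not
    measurable for the information of the selection; they are set apart. *)
Definition kept n i : bool := (i <= n %/ r n * r n)%N.

Definition seen n (i : nat) w : l0 R :=
  (c n)^-1 *: shift_l0 i%:Z (block (r n) (block_index (r n) i) (path_of X w)).

Lemma sum_exceedances n (f : l0 R -> R) w :
  (\sum_(i <- Ne X c n w) (if kept n i then f (seen n i w) else 0)) / rate n =
  Sn n (csum (fun x => peak0 x * f x)) w.
Proof.
rewrite /clsum mulrC; congr (_ * _).
transitivity (\sum_(1 <= j < (n %/ r n).+1)
    \sum_((j.-1 * r n).+1 <= i < (j * r n).+1)
      peak0 (shift_l0 i%:Z ((c n)^-1 *: block (r n) j (path_of X w))) *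
      f (shift_l0 i%:Z ((c n)^-1 *: block (r n) j (path_of X w)))); last first.
  by apply: eq_bigr => j _; rewrite block_csum//; exact: supp0_peak.
rewrite (sum_blocks (fun j i =>
  peak0 (shift_l0 i%:Z ((c n)^-1 *: block (r n) j (path_of X w))) *
      f (shift_l0 i%:Z ((c n)^-1 *: block (r n) j (path_of X w))))).
rewrite /Ne big_filter.
rewrite [LHS](@big_cat_nat _ _ _ (n %/ r n * r n).+1)//=; last by rewrite ?ltnS leq_divM.
rewrite [X in _ + X]big1_seq ?addr0; last first.
  move=> i /andP[_]; rewrite mem_index_iota => /andP[i1 _].
  by rewrite /kept leqNgt i1.
rewrite big_mkcond/= !big_nat; apply: eq_bigr => i /andP[i1 i2].
rewrite /kept -ltnS i2 /seen shift_l0Z.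
set j := block_index (r n) i.
have ij : (j.-1 * r n < i <= j * r n)%N.
  have r0 : (0 < r n)%N by case: (r n) i2 => //; rewrite muln0 ltnS leqNgt i1.
  rewrite /j /block_index /=; case: i i1 i2 {j} => // i _ i2 /=.
  by rewrite ltnS leq_divM/= ltn_ceil.
have -> : peak0 ((c n)^-1 *: shift_l0 i%:Z (block (r n) j (path_of X w))) =
    (c n < `|X i%:Z w|)%R%:R.
  rewrite /peak0 l0_coordZ shift_l0E add0r /= -[X i w]/(X i%:Z w).
  rewrite !ltz_nat !lez_nat ij normrM gtr0_norm ?invr_gt0//.
  by rewrite ltr_pdivlMl// mulr1.
by case: (c n < _); rewrite ?mul1r ?mul0r.
Qed.

Lemma one_share_itv C (f : l0 R -> R) : itvfun C f -> itvfun C (fun x => peak0 x * f x).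
Proof.
move=> fC x; have /andP[f0 fc] := fC x; rewrite mulr_ge0 ?peak0_ge0//=.
by rewrite (le_trans _ fc)// ler_piMl// peak0_le1.
Qed.

Lemma exceedances_sum_L1 (f : l0 R -> R) C : continuous f -> itvfun C f ->
  mean P (fun w => `|(\sum_(i <- Ne X c n w) (if kept n i then f (seen n i w) else 0))
     / rate n - mean Q (fun w => f (Ybar w))|) @[n --> \oo] --> 0.
Proof.
move=> cf fC; have mf := continuous_measurable_l0 cf.
have mpf : measurable_fun setT ((fun x => peak0 x * f x) : l0_borel R -> R).
  by apply: measurable_funM => //; exact: measurable_peak0.
have pfC := one_share_itv fC.
have -> : mean Q (fun w => f (Ybar w)) = mean Q (fun w => peak0 (Ybar w) * f (Ybar w)).
  apply: mean_ae_eq.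
  - exact: (bmeas_Y Y mf (itvfun_bounded fC)).
  - exact: (bmeas_Y Y mpf (itvfun_bounded pfC)).
  by apply: filterS Ybar_peak => w Y1; rewrite /peak0 Y1 mul1r.
have := LLN (@supp0_peak _ f) mpf pfC (good_peak cf).
by under [in X in _ -> X]eq_fun do under [in mean _ _]eq_fun do rewrite sum_exceedances.
Qed.

Lemma size_Ne n w : (size (Ne X c n w))%:R =
  \sum_(1 <= i < n.+1) (c n < `|X i%:Z w|)%R%:R :> R.
Proof.
rewrite /Ne size_filter -sum1_count big_mkcond/= natr_sum.
by apply: eq_bigr => i _; case: (c n < _).
Qed.

Lemma bmeas_size_Ne n : bmeas (fun w => (size (Ne X c n w))%:R / rate n).
Proof.
under eq_fun do rewrite size_Ne mulrC.
by apply: bmeasZ; apply: bmeas_sum => i; exact: bmeas_peak.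
Qed.

Lemma exceedances_L1 :
  mean P (fun w => `|(size (Ne X c n w))%:R / rate n - 1|) @[n --> \oo] --> 0.
Proof.
have c1 : continuous (fun _ : l0 R => 1 : R) by move=> x; exact: continuous_for_cst.
have i1 : itvfun 1 (fun _ : l0 R => 1 : R) by move=> x; rewrite ler01 lexx.
have H1 := exceedances_sum_L1 c1 i1; rewrite mean_cst in H1.
pose S n w : R := (\sum_(i <- Ne X c n w) (if kept n i then 1 else 0)) / rate n.
have bS n : bmeas (S n).
  have := bmeas_Sn_csum n (@supp0_peak _ (fun=> 1)) _ (one_share_itv i1).
  rewrite (_ : Sn n _ = S n); last by apply/funext => w; rewrite -sum_exceedances.
  by apply; apply: measurable_funM; [exact: measurable_peak0|exact: measurable_cst].
have bW n := bmeas_size_Ne n.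
have SW n w : S n w <= (size (Ne X c n w))%:R / rate n.
  rewrite ler_wpM2r ?invr_ge0 ?rate_ge0// -sum1_size natr_sum.
  by apply: ler_sum => i _; case: (kept n i).
have rest n : 0 < rate n -> mean P (fun w => (size (Ne X c n w))%:R / rate n - S n w) =
    1 - (n %/ r n)%:R * (r n)%:R / n%:R.
  move=> r0; have n0 : n%:R != 0 :> R.
    by apply: contraTneq r0 => n0; rewrite /rate n0 mul0r ltxx.
  have p0 : tailp X (c n) != 0 by rewrite gt_eqF// (tailp_gt0 Y_tail).
  have E a : mean P (fun w => \sum_(1 <= i < a.+1) (c n < `|X i%:Z w|)%R%:R) =
      a%:R * tailp X (c n).
    rewrite mean_sum => [|i]; last exact: bmeas_peak.
    under eq_bigr do rewrite (mean_level X_stationary).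
    by rewrite big_const_nat subSS subn0 iter_addr_0 -[LHS]mulr_natl.
  rewrite (_ : (fun w => _) = fun w => (rate n)^-1 *
    (\sum_(1 <= i < n.+1) (c n < `|X i%:Z w|)%R%:R -
     \sum_(1 <= i < (n %/ r n * r n).+1) (c n < `|X i%:Z w|)%R%:R)); last first.
    apply/funext => w; rewrite mulrBr -size_Ne mulrC; congr (_ - _).
    rewrite /S mulrC; congr (_ * _).
    rewrite /Ne big_filter.
    rewrite [LHS](@big_cat_nat _ _ _ (n %/ r n * r n).+1)//=; last by rewrite ?ltnS leq_divM.
    rewrite [X in _ + X]big1_seq ?addr0; last first.
      move=> i /andP[_]; rewrite mem_index_iota => /andP[h1 _].
      by rewrite /kept leqNgt h1.
    rewrite big_mkcond/= !big_nat; apply: eq_bigr => i /andP[h1 h2].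
    by rewrite /kept -ltnS h2; case: (c n < _).
  rewrite meanZ; last by apply: bmeasB; apply: bmeas_sum => i; exact: bmeas_peak.
  rewrite meanB; [|by apply: bmeas_sum => i; exact: bmeas_peak|by apply: bmeas_sum => i; exact: bmeas_peak].
  rewrite !E natrM /rate; field.
  by rewrite n0.
have up : mean P (fun w => `|S n w - 1|) + (1 - (n %/ r n)%:R * (r n)%:R / n%:R)
    @[n --> \oo] --> (0 + (1 - 1) : R).
  apply: cvgD; first exact: H1.
  by apply: cvgB; [exact: cvg_cst|exact: (kr_cvg Y_tail r_oo nP_oo rP_0)].
rewrite subrr addr0 in up.
apply: (squeeze_cvgr _ (cvg_cst 0) up).
have r0 := rate_gt0; near=> n.
rewrite mean_ge0//=.
have rn : 0 < rate n by near: n.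
rewrite -rest// -meanD; last 2 first.
- by apply: bmeas_norm; apply: bmeasB => //; exact: bmeas_cst.
- exact: bmeasB.
apply: mean_le.
- by apply: bmeas_norm; apply: bmeasB => //; exact: bmeas_cst.
- apply: bmeasD; last exact: bmeasB.
  by apply: bmeas_norm; apply: bmeasB => //; exact: bmeas_cst.
move=> w; rewrite -[X in _ <= _ + X]ger0_norm ?subr_ge0//.
rewrite (_ : (size _)%:R / rate n - 1 = (S n w - 1) + ((size (Ne X c n w))%:R / rate n - S n w)).
  exact: ler_normD.
by ring.
Unshelve. all: by end_near. Qed.

(** * Weak limits of chosen clusters and exceedances *)

Lemma uniq_Nc n w : uniq (Nc X c r n w).
Proof. by rewrite filter_uniq// iota_uniq. Qed.

Lemma uniq_Ne n w : uniq (Ne X c n w).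
Proof. by rewrite filter_uniq// iota_uniq. Qed.

Lemma sigma_uptoT n : sigma_upto X n setT.
Proof.
have := @sigma_algebra0 _ setT (\bigcup_(i in [set i : int | 1 <= i <= n%:Z])
  preimage_set_system setT (X i) measurable).
by move/(@sigma_algebraC _ _ _); rewrite setC0.
Qed.

Lemma measurable_scaled_block n j i :
  measurable_fun setT (fun w => (c n)^-1 *: shift_l0 i (block (r n) j (path_of X w)) : l0_borel R).
Proof.
apply: (measurableT_comp (measurable_scale _)).
apply: (measurableT_comp (measurable_shift_l0 i)).
exact: (measurableT_comp (measurable_clip _ _) (measurable_path_of X)).
Qed.

Lemma measurable_in_Nc n j : measurable [set w | j \in Nc X c r n w].
Proof.
pose G w : R := if (1 <= j < (n %/ r n).+1)%N then
    csum (@unit_share R) ((c n)^-1 *: shift_l0 0 (block (r n) j (path_of X w))) else 0.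
rewrite (_ : [set _ | _] = [set w | 0 < G w]).
  apply: measurable_gt_set; rewrite /G.
  case: (1 <= j < (n %/ r n).+1)%N; last exact: measurable_cst.
  apply: (measurableT_comp _ (measurable_scaled_block n j 0)).
  exact: measurable_csum supp0_unit_share measurable_unit_share.
congr mkset; apply/funext => w; congr is_true; rewrite mem_filter mem_index_iota /G.
case: (1 <= j < (n %/ r n).+1)%N; last by rewrite ltxx andbF.
rewrite andbT csum_unit_share shift_l0_0 -(nexc_scale _ (c_gt0 n)).
by case: (c n < _); rewrite ?ltr01 ?ltxx.
Qed.

Lemma measurable_in_Ne n j : measurable [set w | j \in Ne X c n w].
Proof.
case E : (1 <= j < n.+1)%N.
  rewrite (_ : [set _ | _] = [set w | c n < `|X j%:Z w|]); first exact: measurable_level.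
  congr mkset; apply/funext => w; congr is_true.
  by rewrite mem_filter mem_index_iota E andbT.
rewrite (_ : [set _ | _] = set0)//; apply/seteqP; split => w //=.
by rewrite mem_filter mem_index_iota E andbF.
Qed.

Section bounded_test.
Variables (f : l0 R -> R) (C : R).
Hypotheses (C_gt0 : 0 < C) (cf : continuous f) (fC : itvfun C f).

Let mf := continuous_measurable_l0 cf.

Lemma anchored_clusters_L1 A : anchoring A ->
  {ae Q, forall w, ~ anchor_disc A (Ybar w)} ->
  mean P (fun w => `|Sn n (csum (fun x => anchored A x * f x)) w -
     mean Q (fun w => anchored A (Ybar w) * f (Ybar w))|) @[n --> \oo] --> 0.
Proof.
move=> hA nd.
have := @LLN (fun x => anchored A x * f x) C (supp0_anchored hA f).
apply.
- by apply: measurable_funM => //; exact: measurable_anchored.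
- move=> x; have /andP[a0 a1] := anchored_itv A x; have /andP[f0 fc] := fC x.
  by rewrite mulr_ge0//= (le_trans _ fc)// ler_piMl.
have nd' : {ae Q, forall w, ~ anchor_disc A (Ybar w) /\ no_unit (Ybar w)}.
  by move: nd nounit; apply: filterS2.
move: nd' Ybar_peak; apply: filterS2 => w [ndw Y1] Yp i.
apply: continuous_anchored => //; apply/excE_l0.
by rewrite gt_eqF// (lt_le_trans ltr01)//; exact: nexc_ge1 Yp.
Qed.

Lemma chosen_cluster_cvg (K : nat -> {RV P >-> nat}) A :
  (forall n, cond_uniform P (sigma_upto X n) (Nc X c r n) (K n)) ->
  anchoring A -> {ae Q, forall w, ~ anchor_disc A (Ybar w)} ->
  mean P (fun w => f (anchor_shift A ((c n)^-1 *: block (r n) (K n w) (path_of X w))))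
    @[n --> \oo] -->
  mean Q (fun w => anchored A (Ybar w) * f (Ybar w)) / extremal_mean.
Proof.
move=> NK hA nd.
pose phi n j w := f (anchor_shift A ((c n)^-1 *: shift_l0 0 (block (r n) j (path_of X w)))).
have mfA := measurable_anchor_shift hA mf.
have mphi n j : measurable_fun setT (phi n j).
  exact: (measurableT_comp mfA (measurable_scaled_block n j 0)).
have phiC n j w : 0 <= phi n j w <= C by exact: fC.
have UE n w : (\sum_(j <- Nc X c r n w) phi n j w) / rate n =
    Sn n (csum (fun x => anchored A x * f x)) w.
  rewrite /clsum mulrC; congr (_ * _); rewrite /Nc big_filter big_mkcond/=.
  apply: eq_bigr => j _; rewrite csum_anchor// -(nexc_scale _ (c_gt0 n)) /phi shift_l0_0.
  by case: (c n < _); rewrite ?mul1r ?mul0r.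
have U1 : mean P (fun w => `|(\sum_(j <- Nc X c r n w) phi n j w) / rate n -
    mean Q (fun w => anchored A (Ybar w) * f (Ybar w))|) @[n --> \oo] --> 0.
  have := anchored_clusters_L1 hA nd.
  by under [in X in _ -> X]eq_fun do under [in mean _ _]eq_fun do rewrite UE.
rewrite (_ : (fun n => _) = fun n => mean P (fun w => phi n (K n w) w)); last first.
  by apply/funext => n; congr (mean P _); apply/funext => w; rewrite /phi shift_l0_0.
apply: (select_cvg (m := fun n => (n %/ r n)%N) NK _ _ _ _ C_gt0 mphi phiC _
  extremal_mean_gt0 nP_oo rate_ge0 U1 clusters_L1).
- exact: uniq_Nc.
- by move=> n w j; rewrite mem_filter mem_index_iota => /andP[].
- exact: measurable_in_Nc.
- by move=> n; exact: sigma_uptoT.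
move=> n j /andP[j1 jk] t.
apply: (@block_sigma_upto _ _ _ _ X n (r n) j (c n)^-1 0 _ t _ mfA).
by rewrite (leq_trans _ (leq_divM n (r n)))// leq_mul2r -ltnS jk orbT.
Qed.

(** The test functional is set to 0 at the indices that are not [kept]. *)
Lemma kept_cvg (Tn : nat -> {RV P >-> nat}) :
  (forall n, cond_uniform P (sigma_upto X n) (Ne X c n) (Tn n)) ->
  mean P (fun w => if kept n (Tn n w) then f (seen n (Tn n w) w) else 0)
    @[n --> \oo] --> mean Q (fun w => f (Ybar w)).
Proof.
move=> NT.
pose phi n i w : R := if kept n i then f (seen n i w) else 0.
have mphi n i : measurable_fun setT (phi n i).
  rewrite /phi; case: (kept n i); last exact: measurable_cst.
  exact: (measurableT_comp mf (measurable_scaled_block n _ i%:Z)).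
have phiC n i w : 0 <= phi n i w <= C.
  by rewrite /phi; case: (kept n i); [exact: fC|rewrite lexx ltW].
have Fphi n i : (1 <= i < n.+1)%N -> forall t : R, sigma_upto X n [set w | t <= phi n i w].
  move=> /andP[i1 _] t; rewrite /phi; case: (boolP (kept n i)) => ik.
    apply: (@block_sigma_upto _ _ _ _ X n (r n) (block_index (r n) i) (c n)^-1 i%:Z _ t _ mf).
    apply: (leq_trans _ (leq_divM n (r n))); rewrite /block_index leq_mul2r.
    have r0 : (0 < r n)%N by move: ik; rewrite /kept; case: (r n) => //; rewrite muln0 leqNgt i1.
    by rewrite ltn_divLR//; move: ik; rewrite /kept -{1}(prednK i1) => ->; rewrite orbT.
  have [t0|t0] := leP t 0.
    by rewrite (_ : [set _ | _] = setT); [exact: sigma_uptoT|apply/seteqP; split].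
  rewrite (_ : [set _ | _] = set0); first exact: sigma_algebra0.
  by apply/seteqP; split.
rewrite -[X in _ --> X]divr1.
apply: (select_cvg (m := fun n => n) NT _ _ _ _ C_gt0 mphi phiC Fphi ltr01 nP_oo rate_ge0
  (exceedances_sum_L1 cf fC) exceedances_L1).
- exact: uniq_Ne.
- by move=> n w j; rewrite mem_filter mem_index_iota => /andP[].
- exact: measurable_in_Ne.
- by move=> n; exact: sigma_uptoT.
Qed.

End bounded_test.

(** For the constant 1, [kept_cvg] says that the chosen index is [kept] with
    probability tending to 1. *)
Lemma chosen_exceedance_cvg (f : l0 R -> R) C (Tn : nat -> {RV P >-> nat}) :
  0 < C -> continuous f -> itvfun C f ->
  (forall n, cond_uniform P (sigma_upto X n) (Ne X c n) (Tn n)) ->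
  mean P (fun w => f (seen n (Tn n w) w)) @[n --> \oo] --> mean Q (fun w => f (Ybar w)).
Proof.
move=> C0 cf fC NT; have mf := continuous_measurable_l0 cf.
have c1 : continuous (fun _ : l0 R => 1 : R) by move=> x; exact: continuous_for_cst.
have i1 : itvfun 1 (fun _ : l0 R => 1 : R) by move=> x; rewrite ler01 lexx.
have H1 := kept_cvg ltr01 c1 i1 NT; rewrite mean_cst in H1.
have H2 := kept_cvg C0 cf fC NT.
have bf n : bmeas (fun w => f (seen n (Tn n w) w)).
  apply: (@bmeas_itv _ _ _ _ 0 C) => [|w]; last exact: fC.
  apply: (@measurable_select _ _ _ _ (Tn n) (fun i w => f (seen n i w))) => i.
  exact: (measurableT_comp mf (measurable_scaled_block n _ i%:Z)).
have bk n (g : l0 R -> R) D : continuous g -> itvfun D g -> 0 <= D ->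
    bmeas (fun w => if kept n (Tn n w) then g (seen n (Tn n w) w) else 0 : R).
  move=> cg gD D0; apply: (@bmeas_itv _ _ _ _ 0 D) => [|w]; last first.
    by case: (kept n _); [exact: gD|rewrite lexx].
  apply: (@measurable_select _ _ _ _ (Tn n) (fun i w => if kept n i then g (seen n i w) else 0)) => i.
  case: (kept n i); last exact: measurable_cst.
  exact: (measurableT_comp (continuous_measurable_l0 cg) (measurable_scaled_block n _ i%:Z)).
have up : mean P (fun w => if kept n (Tn n w) then f (seen n (Tn n w) w) else 0) +
   C * (1 - mean P (fun w => if kept n (Tn n w) then 1 else 0)) @[n --> \oo] -->
   mean Q (fun w => f (Ybar w)) + C * (1 - 1).
  by apply: cvgD => //; apply: cvgM; [exact: cvg_cst|apply: cvgB => //; exact: cvg_cst].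
rewrite subrr mulr0 addr0 in up.
apply: (squeeze_cvgr _ H2 up); apply: nearW => n.
have b1 := bk n f C cf fC (ltW C0); have b2 := bk n _ 1 c1 i1 ler01.
apply/andP; split.
  apply: mean_le => // w; case: (kept n _) => //.
  by have /andP[] := fC (seen n (Tn n w) w).
have b3 : bmeas (fun w => 1 - (if kept n (Tn n w) then 1 else 0) : R).
  by apply: bmeasB => //; exact: bmeas_cst.
have -> : 1 - mean P (fun w => if kept n (Tn n w) then 1 else 0) =
    mean P (fun w => 1 - (if kept n (Tn n w) then 1 else 0)).
  by rewrite meanB// ?mean_cst//; exact: bmeas_cst.
rewrite -meanZ// -meanD//; last exact: bmeasZ.
apply: mean_le => //; first by apply: bmeasD => //; exact: bmeasZ.
move=> w; case: (kept n _); first by rewrite subrr mulr0 addr0.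
by rewrite subr0 mulr1 add0r; have /andP[] := fC (seen n (Tn n w) w).
Qed.

End limits.

(** * The limit theorem *)

(** It is enough to test with nonnegative functions: add a constant. *)
Lemma weak_cvg_test {R : realType} d (T : measurableType d) (P : probability T R)
    (V : nat -> T -> l0 R) d' (T' : measurableType d') (Q : probability T' R)
    (W : T' -> l0 R) :
  (forall (f : l0 R -> R) n, continuous f -> measurable_fun setT (f \o V n)) ->
  (forall f : l0 R -> R, continuous f -> measurable_fun setT (f \o W)) ->
  (forall (f : l0 R -> R) C, 0 < C -> continuous f -> itvfun C f ->
    mean P (fun w => f (V n w)) @[n --> \oo] --> mean Q (fun w => f (W w))) ->
  weak_cvg P V Q W.
Proof.
move=> mV mW H f cf [M fM].
have M0 : 0 <= M by exact: le_trans (fM 0).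
have C0 : 0 < M + M + 1 by rewrite ltr_wpDl// addr_ge0.
have cfM : continuous (fun x : l0 R => f x + M).
  by move=> x; apply: continuous_forD; [exact: cf|exact: continuous_for_cst].
have fMC : itvfun (M + M + 1) (fun x : l0 R => f x + M).
  by move=> x; have := fM x; rewrite ler_norml => /andP[h1 h2]; apply/andP; split; lra.
have bV n : bmeas (f \o V n) by split; [exact: mV|exists M => w /=].
have bW : bmeas (f \o W) by split; [exact: mW|exists M => w /=].
have lim := H _ _ C0 cfM fMC.
have addM d0 (T0 : measurableType d0) (P0 : probability T0 R) g :
    bmeas g -> mean P0 (fun w => g w + M) = mean P0 g + M.
  by move=> bg; rewrite meanD ?mean_cst//; exact: bmeas_cst.
rewrite (addM _ _ Q (f \o W) bW) in lim.
have {}lim : mean P (f \o V n) @[n --> \oo] --> mean Q (f \o W).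
  have : mean P (f \o V n) + M - M @[n --> \oo] --> mean Q (f \o W) + M - M.
    apply: cvgB; last exact: cvg_cst.
    rewrite (_ : (fun n => mean P (f \o V n) + M) = fun n => mean P (fun w => f (V n w) + M))//.
    by apply/funext => n; rewrite (addM _ _ P (f \o V n) (bV n)).
  by under eq_fun do rewrite addrK; rewrite addrK.
rewrite (expectation_mean Q bW); apply: cvg_EFin.
  by apply: nearW => n; rewrite (expectation_mean P (bV n)).
by under eq_fun do rewrite /= (expectation_mean P (bV _)).
Qed.

(** Z has the law of Y given A(Y) = 0, so its means are weighted means of Y. *)
Lemma mean_ZA {R : realType} d (T : measurableType d) (Q : probability T R)
    (Y : int -> {RV Q >-> R}) (A : (int -> R) -> int) dZ (TZ : measurableType dZ)
    (QZ : probability TZ R) (Z : TZ -> l0 R) (f : l0 R -> R) (C : R) :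
  anchoring A -> {ae Q, forall w, path_of Y w \in @vanishing R} ->
  is_ZA Y A QZ Z -> 0 < C -> measurable_fun setT (f : l0_borel R -> R) -> itvfun C f ->
  mean QZ (fun w => f (Z w)) =
  mean Q (fun w => anchored A (to_l0 (path_of Y w)) * f (to_l0 (path_of Y w))) /
  mean Q (fun w => anchored A (to_l0 (path_of Y w))).
Proof.
move=> hA Yv HZ C0 mf fC.
pose D := [set w | excE (path_of Y w) /\ anchor_ext A (path_of Y w) = 0].
have mD : measurable D.
  have := measurable_path_of Y measurableT (measurable_anchored0 hA).
  by rewrite setTI.
have mZ : measurable_fun setT (Z : TZ -> l0_borel R).
  by move=> _ B mB; rewrite setTI; have [] := HZ B mB.
have mfY : measurable_fun setT (fun w => f (to_l0 (path_of Y w))).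
  exact: (measurableT_comp mf (to_l0_measurable Y)).
have bA : bmeas (fun w => anchored A (to_l0 (path_of Y w))).
  apply: (bmeas_Y Y (measurable_anchored hA)); exists 1 => x.
  by have /andP[a0 a1] := anchored_itv A x; rewrite ger0_norm.
have bfY : bmeas (fun w => f (to_l0 (path_of Y w))) by exact: bmeas_itv.
have bD := bmeas_indic (R := R) mD.
have DA : {ae Q, forall w, \1_D w = anchored A (to_l0 (path_of Y w)) :> R}.
  apply: filterS Yv => w vY; rewrite /anchored !indicE; congr (nat_of_bool _)%:R.
  have -> : (to_l0 (path_of Y w) : int -> R) = path_of Y w.
    by apply/funext => i; rewrite to_l0K.
  by apply/idP/idP; rewrite !inE.
have pD : prob Q D = mean Q (fun w => anchored A (to_l0 (path_of Y w))).
  by rewrite -mean_indic//; exact: mean_ae_eq.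
transitivity (mean Q (fun w => (prob Q D)^-1 * \1_D w * f (to_l0 (path_of Y w)))).
  have := @eq_mean_layers _ _ _ QZ _ _ Q (fun=> 1) (fun w => f (Z w))
    (fun w => (prob Q D)^-1 * \1_D w) (fun w => f (to_l0 (path_of Y w))) C C0.
  rewrite (_ : (fun w => 1 * f (Z w)) = fun w => f (Z w)); last first.
    by apply/funext => w; rewrite mul1r.
  apply.
  - exact: bmeas_cst.
  - by [].
  - exact: bmeasZ.
  - by move=> w; rewrite mulr_ge0 ?invr_ge0 ?prob_ge0//.
  - exact: (measurableT_comp mf mZ).
  - by [].
  - exact: mfY.
  - by [].
  move=> t; have mt : measurable [set x : l0_borel R | t <= f x] by exact: measurable_ge_set.
  have mtY : measurable [set w | t <= f (to_l0 (path_of Y w))] by exact: measurable_ge_set.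
  have [mZt] := HZ _ mt; rewrite /cprob => Ht.
  transitivity (prob QZ (Z @^-1` [set x : l0_borel R | t <= f x])).
    rewrite -mean_indic//; congr (mean QZ _); apply/funext => w.
    by rewrite mul1r.
  rewrite Ht mulrC -[prob Q (_ `&` _)]mean_indic; last exact: measurableI.
  rewrite -meanZ; last by apply: bmeas_indic; exact: measurableI.
  congr (mean Q _); apply/funext => w; rewrite -mulrA; congr (_ * _).
  by rewrite indicI /= mulrC.
rewrite mulrC -pD -meanZ; last exact: bmeasM.
apply: mean_ae_eq.
- by apply: bmeasM => //; exact: bmeasZ.
- by apply: bmeasZ; exact: bmeasM.
by apply: filterS DA => w ->; rewrite mulrA.
Qed.

Theorem proposition4p3 (R : realType)
  (dX : measure_display) (TX : measurableType dX) (P : probability TX R)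
  (X : int -> {RV P >-> R})
  (dY : measure_display) (TY : measurableType dY) (Q : probability TY R)
  (Y : int -> {RV Q >-> R})
  (c : nat -> R) (r : nat -> nat)
  (X_stationary : stationary X)
  (Y_tail : tail_process X Y)
  (c_gt0 : forall n, 0 < c n)
  (c_oo : c n @[n --> \oo] --> +oo)
  (r_oo : r n @[n --> \oo] --> \oo)
  (nP_oo : n%:R * prob P [set w | c n < `|X 0 w|] @[n --> \oo] --> +oo)
  (rP_0 : (r n)%:R * prob P [set w | c n < `|X 0 w|] @[n --> \oo] --> 0)
  (anticlustering : forall x y : R, 0 < x -> 0 < y ->
    limn_esup (fun n => (cprob P
        [set w | c n * x < \big[Num.max/0]_(m <= i < (r n).+1)
                             Num.max `|X i%:Z w| `|X (- i%:Z) w|]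
        [set w | c n * y < `|X 0 w|])%:E)
      @[m --> \oo] --> 0%E)
  (mixing : forall h : l0 R -> R,
    (forall x, 0 <= h x) ->
    (exists M : R, forall x, h x <= M) ->
    shift_invariant h ->
    lipschitz (h : l0 R -> R^o) ->
    (exists2 e : R, 0 < e &
       closure [set x | h x != 0] `<=` [set x | e < `|x|]) ->
    let a n := (n%:R * prob P [set w | c n < `|X 0 w|])^-1 in
    let H n j w := h ((c n)^-1 *: block (r n) j (path_of X w)) in
    (mean P (fun w => expR (- (a n * \sum_(1 <= j < (n %/ r n).+1) H n j w)))
     - mean P (fun w => expR (- (a n * H n 1%N w))) ^+ (n %/ r n))
      @[n --> \oo] --> (0 : R)) :
  let p n := prob P [set w | c n < `|X 0 w|] in
  [/\ cvg_in_prob P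
        (fun n w => (size (Nc X c r n w))%:R / (theta Y * n%:R * p n)) 1 /\
      cvg_in_prob P
        (fun n w => (size (Ne X c n w))%:R / (n%:R * p n)) 1,
      cvg_in_prob_pinfty P (fun n w => (size (Nc X c r n w))%:R) /\
      cvg_in_prob_pinfty P (fun n w => (size (Ne X c n w))%:R),
      forall K : nat -> {RV P >-> nat},
        (forall n, cond_uniform P (sigma_upto X n) (Nc X c r n) (K n)) ->
        forall A : (int -> R) -> int, anchoring A ->
        Q [set w | anchor_disc A (to_l0 (path_of Y w))] = 0%E ->
        forall (dZ : measure_display) (TZ : measurableType dZ)
               (QZ : probability TZ R) (Z : TZ -> l0 R),
          is_ZA Y A QZ Z ->
          weak_cvg P
            (fun n w => anchor_shift A
               ((c n)^-1 *: block (r n) (K n w) (path_of X w)))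
            QZ Z
    & forall Tn : nat -> {RV P >-> nat},
        (forall n, cond_uniform P (sigma_upto X n) (Ne X c n) (Tn n)) ->
        weak_cvg P
          (fun n w => (c n)^-1 *: shift_l0 (Tn n w)%:Z
             (block (r n) (block_index (r n) (Tn n w)) (path_of X w)))
          Q (fun w => to_l0 (path_of Y w))].
Proof.
move=> p.
have t0 := extremal_mean_gt0 Y_tail c_gt0 c_oo r_oo anticlustering.
have LC := clusters_L1 X_stationary Y_tail c_gt0 c_oo r_oo nP_oo rP_0 anticlustering mixing.
have LE := exceedances_L1 X_stationary Y_tail c_gt0 c_oo r_oo nP_oo rP_0 anticlustering mixing.
have tE := extremal_meanE Y_tail c_gt0 c_oo r_oo anticlustering.
have Yv := Y_vanishing Y_tail c_gt0 c_oo r_oo anticlustering.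
have bC n : bmeas (fun w => (size (Nc X c r n w))%:R / rate X c n).
  rewrite (_ : (fun w => _) = clsum X c r n (csum (@unit_share R))); last first.
    by apply/funext => w; exact: count_clusters.
  exact: (bmeas_Sn_csum X c r n supp0_unit_share measurable_unit_share unit_share_itv).
have bE := bmeas_size_Ne X c.
have [C1 C2 _] := counting_cvg t0 nP_oo bC LC.
have [E1 E2 _] := counting_cvg ltr01 nP_oo bE LE.
split.
- split.
    move=> e e0; have := C1 e e0.
    by under [in X in X -> _]eq_fun do under eq_set do rewrite /rate mulrA -tE.
  move=> e e0; have := E1 e e0.
  by under [in X in X -> _]eq_fun do under eq_set do rewrite mul1r.
- by split.
- move=> K NK A hA disc0 dZ TZ QZ Z HZ.
  have nd : {ae Q, forall w, ~ anchor_disc A (to_l0 (path_of Y w))}.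
    have mdisc : measurable [set w | anchor_disc A (to_l0 (path_of Y w))].
      have := to_l0_measurable Y measurableT (measurable_disc A).
      by rewrite setTI.
    exists [set w | anchor_disc A (to_l0 (path_of Y w))]; split => //.
    by move=> w /= /contrapT.
  apply: weak_cvg_test.
  + move=> f n cf; have mfA := measurable_anchor_shift hA (continuous_measurable_l0 cf).
    apply: (@measurable_select _ _ _ _ (K n)
      (fun j w => f (anchor_shift A ((c n)^-1 *: block (r n) j (path_of X w))))) => j.
    rewrite (_ : (fun w => _) = (fun x => f (anchor_shift A x)) \o
      (fun w => (c n)^-1 *: shift_l0 0 (block (r n) j (path_of X w)))).
      exact: (measurableT_comp mfA (measurable_scaled_block X c r n j 0)).
    by apply/funext => w /=; rewrite shift_l0_0.
  + move=> f cf; apply: (measurableT_comp (continuous_measurable_l0 cf)).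
    by move=> _ B mB; rewrite setTI; have [] := HZ B mB.
  move=> f C C0 cf fC.
  rewrite (mean_ZA hA Yv HZ C0 (continuous_measurable_l0 cf) fC).
  have -> : mean Q (fun w => anchored A (to_l0 (path_of Y w))) = extremal_mean Y.
    have c1 : continuous (fun _ : l0 R => 1 : R) by move=> x; exact: continuous_for_cst.
    have i1 : itvfun 1 (fun _ : l0 R => 1 : R) by move=> x; rewrite ler01 lexx.
    have L1 := anchored_clusters_L1 X_stationary Y_tail c_gt0 c_oo r_oo nP_oo rP_0
      anticlustering mixing c1 i1 hA nd.
    rewrite (_ : (fun w => anchored A (to_l0 (path_of Y w))) =
      fun w => anchored A (to_l0 (path_of Y w)) * 1); last first.
      by apply/funext => w; rewrite mulr1.
    apply: (L1_limit_unique bC _ LC).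
    rewrite (_ : (fun n => mean P _) = fun n => mean P (fun w =>
      `|clsum X c r n (csum (fun x => anchored A x * 1)) w -
        mean Q (fun w => anchored A (to_l0 (path_of Y w)) * 1)|))//.
    apply/funext => n; congr (mean P _); apply/funext => w.
    rewrite (count_clusters X r c_gt0); congr (`|clsum X c r n _ w - _|).
    by apply/funext => x; rewrite csum_unit_share csum_anchor// mulr1.
  exact: (chosen_cluster_cvg X_stationary Y_tail c_gt0 c_oo r_oo nP_oo rP_0
    anticlustering mixing C0 cf fC NK hA nd).
move=> Tn NT; apply: weak_cvg_test.
- move=> f n cf.
  apply: (@measurable_select _ _ _ _ (Tn n) (fun i w => f (seen X c r n i w))) => i.
  exact: (measurableT_comp (continuous_measurable_l0 cf) (measurable_scaled_block X c r n _ i%:Z)).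
- move=> f cf; exact: (measurableT_comp (continuous_measurable_l0 cf) (to_l0_measurable Y)).
move=> f C C0 cf fC.
exact: (chosen_exceedance_cvg X_stationary Y_tail c_gt0 c_oo r_oo nP_oo rP_0
    anticlustering mixing C0 cf fC NT).
Qed.
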